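(* Let $\alpha>0$, $0<\xi<1$. Viewing the static Pfaffian kernel $\boldsymbol\Phi_{\alpha,\xi}(x,y)$, $x,y\in\mathbb{Z}$, as (the matrix of) an operator in $\ell^2(\mathbb{Z})$, one has $$\boldsymbol\Phi_{\alpha,\xi}=\big(\mathrm{Proj}_{>0}(\widetilde{\mathfrak{D}}_{\alpha,\xi})+\tfrac12\,\mathrm{Proj}_{=0}(\widetilde{\mathfrak{D}}_{\alpha,\xi})\big)\mathrm{R},$$ where $\mathrm{R}\colon\ell^2(\mathbb{Z})\to\ell^2(\mathbb{Z})$ is the reflection $(\mathrm{R}f)(x)=f(-x)$.
   Context: $\nu=\frac12\sqrt{1-4\alpha}$ (real in $[0,\frac12)$ if $\alpha\le\frac14$, purely imaginary otherwise). For $x,m\in\mathbb{Z}$, $$\varphi_m(x;\alpha,\xi)=\left(\frac{\Gamma(\frac12+\nu+x)\Gamma(\frac12-\nu+x)}{\Gamma(\frac12+\nu-m)\Gamma(\frac12-\nu-m)}\right)^{\frac12}\xi^{\frac12(x+m)}(1-\xi)^{-m}\,\frac{{}_2F_1(\frac12+\nu+m,\frac12-\nu+m;x+m+1;\frac{\xi}{\xi-1})}{\Gamma(x+m+1)},$$ where ${}_2F_1(A,B;C;w)/\Gamma(C)$ is the regularized Gauss hypergeometric function (entire in $C$; analytically continued in $w\in\mathbb{C}\setminus[1,\infty)$). The static Pfaffian kernel is $$\boldsymbol\Phi_{\alpha,\xi}(x,y)=(-1)^{\min(x,0)+\max(y,0)}\sum_{m=0}^{\infty}2^{-\delta(m)}\varphi_m(x;\alpha,\xi)\varphi_m(-y;\alpha,\xi),\qquad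 x,y\in\mathbb{Z},\quad \delta(m)=\delta_{m,0}.$$ The difference operator $\widetilde{\mathfrak{D}}_{\alpha,\xi}$ in $\ell^2(\mathbb{Z})$ is $$(\widetilde{\mathfrak{D}}_{\alpha,\xi}f)(x)=(-1)^{\mathbf 1_{x<0}}\sqrt{\xi(\alpha+x(x+1))}\,f(x+1)+(-1)^{\mathbf 1_{x\le0}}\sqrt{\xi(\alpha+x(x-1))}\,f(x-1)-x(1+\xi)f(x).$$ The functions $\widetilde\varphi_m(x;\alpha,\xi)=(-1)^{\min(x,0)}\varphi_m(x;\alpha,\xi)$, $m\in\mathbb{Z}$, form an orthonormal basis of $\ell^2(\mathbb{Z})$ and satisfy $\widetilde{\mathfrak{D}}_{\alpha,\xi}\widetilde\varphi_m=m(1-\xi)\widetilde\varphi_m$. $\mathrm{Proj}_{>0}(\widetilde{\mathfrak{D}}_{\alpha,\xi})$ and $\mathrm{Proj}_{=0}(\widetilde{\mathfrak{D}}_{\alpha,\xi})$ denote the orthogonal spectral projections onto the positive part of the spectrum and onto the zero eigenspace (onto the closed span of $\{\widetilde\varphi_m\}_{m\ge1}$ and onto $\mathbb{C}\widetilde\varphi_0$, respectively). *)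

(* Defs.v *)
From HB Require Import structures.
From mathcomp Require Import all_boot all_order all_algebra.
From mathcomp Require Import complex.
From mathcomp Require Import all_classical all_reals all_analysis.

Set Implicit Arguments.
Unset Strict Implicit.
Unset Printing Implicit Defensive.

Import Order.TTheory GRing.Theory Num.Theory.
Import numFieldNormedType.Exports.

Local Open Scope classical_set_scope.
Local Open Scope ring_scope.
Local Open Scope complex_scope.

(* The norm topology of R[i] is carried by its alias (R[i])^o. *)
Definition is_limC (R : realType) (u : nat -> R[i]) (l : R[i]) : Prop :=
  (u : nat -> (R[i])^o) @ \oo --> (l : (R[i])^o).

Definition limC (R : realType) (u : nat -> R[i]) : R[i] :=
  limn (u : nat -> (R[i])^o).

Definition is_seriesC (R : realType) (u : nat -> R[i]) (l : R[i]) : Prop :=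
  is_limC (series u) l.

Definition seriesC (R : realType) (u : nat -> R[i]) : R[i] := limC (series u).

Definition expC (R : realType) (z : R[i]) : R[i] :=
  (expR (complex.Re z))%:C * (cos (complex.Im z) +i* sin (complex.Im z)).

(* Gauss's limit n! n^z / (z (z + 1) ... (z + n)).  At a pole of Gamma the
   terms vanish for n large (division by 0 is 0), so GammaC z = 0 there and
   (GammaC z)^-1 is the entire function 1 / Gamma everywhere. *)
Definition GammaC (R : realType) (z : R[i]) : R[i] :=
  limC (fun n : nat =>
    n`!%:R * expC ((ln n%:R)%:C * z) / \prod_(k < n.+1) (z + k%:R)).

Definition pochhammer (R : realType) (a : R[i]) (k : nat) : R[i] :=
  \prod_(j < k) (a + j%:R).

(* The power series at 0 of 2F1(a, b; c; w) / Gamma(c), valid for |w| < 1. *)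
Definition hyp2F1_coef (R : realType) (a b c : R[i]) (k : nat) : R[i] :=
  pochhammer a k * pochhammer b k / (GammaC (c + k%:R) * k`!%:R).

Definition analytic_at (R : realType) (F : R[i] -> R[i]) (z : R[i]) : Prop :=
  exists (a : nat -> R[i]) (r : R), 0 < r /\
    forall h : R[i], `|h| < r%:C ->
      is_seriesC (fun k => a k * h ^+ k) (F (z + h)).

Definition cut_plane (R : realType) : set R[i] :=
  [set w | forall t : R, 1 <= t -> w != t%:C].

Definition star_shaped (R : realType) (U : set R[i]) : Prop :=
  forall w (t : R), U w -> 0 <= t <= 1 -> U (t%:C * w).

(* The value at w of the principal branch of 2F1(a, b; c; .) / Gamma(c), i.e.,
   of the analytic continuation of its power series to the cut plane.  The cut
   plane is star-shaped with respect to 0, so it is the union of the open sets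
   U below, and by the identity theorem v does not depend on U and F. *)
Definition is_hyp2F1_reg (R : realType) (a b c w v : R[i]) : Prop :=
  exists (U : set R[i]) (F : R[i] -> R[i]),
    [/\ open (U : set (R[i])^o), star_shaped U, U `<=` @cut_plane R & U w] /\
    [/\ forall z, U z -> analytic_at F z,
        forall z, U z -> `|z| < 1 ->
          is_seriesC (fun k => hyp2F1_coef a b c k * z ^+ k) (F z)
      & F w = v].

Definition hyp2F1_reg (R : realType) (a b c w : R[i]) : R[i] :=
  xget 0 [set v | is_hyp2F1_reg a b c w v].

Definition nu (R : realType) (alpha : R) : R[i] :=
  sqrtC ((1 - 4%:R * alpha)%:C) / 2.

Definition phi (R : realType) (alpha xi : R) (m x : int) : R[i] :=
  let v := nu alpha in
  let h := 2^-1 : R[i] in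
  sqrtC (GammaC (h + v + x%:~R) * GammaC (h - v + x%:~R) /
         (GammaC (h + v - m%:~R) * GammaC (h - v - m%:~R))) *
  (xi `^ ((x + m)%:~R / 2))%:C * ((1 - xi) ^ (- m))%:C *
  hyp2F1_reg (h + v + m%:~R) (h - v + m%:~R) (x + m + 1)%:~R
    ((xi / (xi - 1))%:C).

Definition pfaffian_kernel (R : realType) (alpha xi : R) (x y : int) : R[i] :=
  (-1) ^ (Num.min x 0 + Num.max y 0) *
  seriesC (fun m : nat =>
    2 ^- (m == 0%N) * phi alpha xi m%:Z x * phi alpha xi m%:Z (- y)).

Definition sqnorm (R : realType) (f : int -> R[i]) : \bar R :=
  \esum_(x in [set: int]) ((complex.Re `|f x|) ^+ 2)%:E.

Definition ell2 (R : realType) : set (int -> R[i]) :=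
  [set f | (sqnorm f < +oo)%E].

Definition is_sumZ (R : realType) (u : int -> R[i]) (l : R[i]) : Prop :=
  exists a b : R[i], [/\ is_seriesC (fun n => u (Posz n)) a,
    is_seriesC (fun n => u (Negz n)) b & l = a + b].

Definition sumZ (R : realType) (u : int -> R[i]) : R[i] :=
  seriesC (fun n => u (Posz n)) + seriesC (fun n => u (Negz n)).

Definition dot (R : realType) (f g : int -> R[i]) : R[i] :=
  sumZ (fun x => f x * (g x)^*).

(* Operators in ell2 are maps on all functions on the integers, whose values
   matter on ell2, or on a domain contained in ell2, only. *)
Definition operator (R : realType) : Type := (int -> R[i]) -> int -> R[i].

Definition is_orthoprojection (R : realType) (P : operator R) : Prop :=
  [/\ forall f, ell2 f -> ell2 (P f),
      forall (a : R[i]) f g, ell2 f -> ell2 g ->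
        P (fun x => a * f x + g x) = (fun x => a * P f x + P g x),
      forall f, ell2 f -> P (P f) = P f
    & forall f g, ell2 f -> ell2 g -> dot (P f) g = dot f (P g)].

(* mu A = <E A f, f> = ||E A f||^2 *)
Definition is_scalar_measure (R : realType) (E : set R -> operator R)
    (f : int -> R[i]) (mu : {measure set R -> \bar R}) : Prop :=
  forall A : set R, measurable A -> mu A = sqnorm (E A f).

(* E is a projection-valued measure on the Borel sets of R: weak countable
   additivity is the fact that the scalar functions A |-> <E A f, f> are
   measures. *)
Definition is_projection_valued_measure (R : realType)
    (E : set R -> operator R) : Prop :=
  [/\ forall A : set R, measurable A -> is_orthoprojection (E A),
      forall f, ell2 f -> E setT f = f
    & forall f, ell2 f -> exists mu, is_scalar_measure E f mu].

(* D, with domain dom, is the integral of t dE(t): dom is the set of f such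
   that t^2 is integrable with respect to <E f, f>, and
   <D f, f> = \int t d<E f, f>(t) on dom. *)
Definition is_spectral_measure (R : realType) (dom : set (int -> R[i]))
    (D : operator R) (E : set R -> operator R) : Prop :=
  is_projection_valued_measure E /\
  forall f (mu : {measure set R -> \bar R}),
    ell2 f -> is_scalar_measure E f mu ->
    (dom f <-> (\int[mu]_t (t ^+ 2)%:E < +oo)%E) /\
    (dom f -> dot (D f) f = (\int[mu]_t t)%:C).

(* The spectral projection of a self-adjoint operator for the Borel set A. *)
Definition spectral_projection (R : realType) (dom : set (int -> R[i]))
    (D : operator R) (A : set R) : operator R :=
  xget ((fun _ f => f) : set R -> operator R) [set E | is_spectral_measure dom D E] A.

Definition diff_op (R : realType) (alpha xi : R) : operator R := fun f x =>
  ((-1) ^+ (x < 0)%R * Num.sqrt (xi * (alpha + (x * (x + 1))%:~R)))%:C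
    * f (x + 1) +
  ((-1) ^+ (x <= 0)%R * Num.sqrt (xi * (alpha + (x * (x - 1))%:~R)))%:C
    * f (x - 1) -
  (x%:~R * (1 + xi))%:C * f x.

(* The maximal domain, on which the operator is self-adjoint (it is the closure
   of its restriction to finitely supported functions). *)
Definition diff_dom (R : realType) (alpha xi : R) : set (int -> R[i]) :=
  [set f | ell2 f /\ ell2 (diff_op alpha xi f)].

Definition Proj (R : realType) (alpha xi : R) (A : set R) : operator R :=
  spectral_projection (diff_dom alpha xi) (diff_op alpha xi) A.

Definition reflection (R : realType) : operator R := fun f x => f (- x).

(* T is the operator with matrix K: (T f)(x) = \sum_y K(x, y) f(y). *)
Definition has_matrix (R : realType) (T : operator R) (K : int -> int -> R[i])
  : Prop :=
  forall f, ell2 f -> ell2 (T f) /\ forall x, is_sumZ (fun y => K x y * f y) (T f x).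

(* Main.v *)
Require Import Defs.
From HB Require Import structures.
From mathcomp Require Import all_boot all_order all_algebra.
From mathcomp Require Import complex.
From mathcomp Require Import all_classical all_reals all_analysis.
From mathcomp Require Import measurable_realfun.
From mathcomp Require Import ring lra zify.

Set Implicit Arguments.
Unset Strict Implicit.
Unset Printing Implicit Defensive.
Import Order.TTheory GRing.Theory Num.Theory.
Import numFieldNormedType.Exports.
Local Open Scope classical_set_scope.
Local Open Scope ring_scope.
Local Open Scope complex_scope.

(* Pfaff's transformation identifies the value of the hypergeometric function
   at xi / (xi - 1) with a power series in xi that makes phi_m(x) symmetric in m
   and x, and shows that phi_m is, up to explicit factors, the correlation of
   two binomial series on the integers.  Combining the expressions obtained from
   nu and - nu, orthonormality reduces to the convolution
   (1 - z) ^ (- a) * (1 - z) ^ (- b) = (1 - z) ^ (- (a + b)), and the three-term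
   recurrence in x comes from a first-order differential equation.  By symmetry
   the matrix (phi_m(x)) is then a unitary involution of l2; together with the
   signs (-1) ^ min(x, 0) it diagonalizes the difference operator, with
   eigenvalues m (1 - xi).
   The resulting spectral measure is unique: if D f = l f and h = E(A) f, all
   the vectors f + u h with |1 + u| = 1 have the same scalar measure, so
   <D h, h> = l <h, h> is the mean of the scalar measure of h; taking A on either
   side of l, this forces h = 0.  The identity of kernels is finally an exchange
   of absolutely convergent summations, the rows of (phi_m(x)) being summable. *)

(** * Absolutely convergent families *)

(** The hypergeometric value is taken at xi / (xi - 1), whose modulus is at least 1 as soon as xi >=
    1/2, out of reach of the defining series; the series in z / (z - 1) converges on Re z < 1/2,
    which contains all these points. After the transformation the two numerator parameters are 1/2 +
    nu + m and 1/2 + nu + x, whence the symmetry. The form of phi_m(x) as a correlation carries a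
    factor 1 / Gamma(1/2 + nu + x). Multiplying the form written with nu by the one written with -
    nu leaves, besides the correlations, the squared prefactor divided by Gamma(1/2 + nu + x)
    Gamma(1/2 - nu + x), which is constant in x. Symmetry then serves three times: orthonormal rows
    are orthonormal columns, which is completeness; the recurrence in x is also one in m; and the
    latter writes x phi_m(x) as a combination of three rows, so that it lies in l2 and the rows lie
    in l1, as needed to exchange sums. Uniqueness of the spectral measure matters because [Proj]
    picks by choice some E, of which only the domain and the quadratic form <D f, f> are
    prescribed. *)

Section Cabs.
Variable R : realType.
Implicit Types z w : R[i].

Definition cabs z : R := complex.Re `|z|.

Lemma cabsE z : `|z| = (cabs z)%:C.
Proof. by rewrite /cabs; case: z => a b; rewrite normc_def. Qed.

Lemma cabs_ge0 z : 0 <= cabs z.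
Proof. by have := normr_ge0 z; rewrite cabsE ler0c. Qed.

Lemma cabsM z w : cabs (z * w) = cabs z * cabs w.
Proof. by apply/complexI; rewrite -cabsE normrM !cabsE rmorphM. Qed.

Lemma cabsD z w : cabs (z + w) <= cabs z + cabs w.
Proof. by rewrite -lecR rmorphD -!cabsE ler_normD. Qed.

Lemma cabsN z : cabs (- z) = cabs z.
Proof. by rewrite /cabs normrN. Qed.

Lemma cabsB z w : cabs (z - w) <= cabs z + cabs w.
Proof. by rewrite -(cabsN w) cabsD. Qed.

Lemma cabsr (r : R) : cabs r%:C = `|r|.
Proof. by rewrite /cabs normc_def /= expr0n addr0 sqrtr_sqr. Qed.

Lemma cabs0 : cabs 0 = 0. Proof. by rewrite /cabs normr0. Qed.
Lemma cabs1 : cabs 1 = 1. Proof. by rewrite /cabs normr1. Qed.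

Lemma cabs_nat n : cabs n%:R = n%:R.
Proof. by rewrite /cabs normr_nat -(rmorph_nat (real_complex R)). Qed.

Lemma cabs_eq0 z : (cabs z == 0) = (z == 0).
Proof. by rewrite -(normr_eq0 z) cabsE -(inj_eq (@complexI R)). Qed.

Lemma cabsV z : cabs z^-1 = (cabs z)^-1.
Proof. by apply/complexI; rewrite -cabsE normfV cabsE fmorphV. Qed.

Lemma cabsX z n : cabs (z ^+ n) = cabs z ^+ n.
Proof. by apply/complexI; rewrite -cabsE normrX cabsE rmorphXn. Qed.

Lemma cabsJ z : cabs z^* = cabs z.
Proof. by rewrite /cabs normcJ. Qed.

Lemma cabs_sqr z : cabs z ^+ 2 = complex.Re z ^+ 2 + complex.Im z ^+ 2.
Proof.
by apply/complexI; rewrite add_Re2_Im2 cabsE rmorphXn.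
Qed.

Lemma mulcJ z : z * z^* = (cabs z ^+ 2)%:C.
Proof. by rewrite -sqr_normc cabsE rmorphXn. Qed.

Lemma ler_Re z : `|complex.Re z| <= cabs z.
Proof. by have := normc_ge_Re z; rewrite cabsE lecR. Qed.

Lemma ler_Im z : `|complex.Im z| <= cabs z.
Proof.
rewrite -(ler_pXn2r (n := 2)) ?nnegrE ?cabs_ge0// real_normK ?num_real//.
by rewrite cabs_sqr lerDr sqr_ge0.
Qed.

Lemma cabs_le z : cabs z <= `|complex.Re z| + `|complex.Im z|.
Proof.
rewrite -(ler_pXn2r (n := 2)) ?nnegrE ?cabs_ge0 ?addr_ge0//.
rewrite cabs_sqr sqrrD !real_normK ?num_real//.
by rewrite lerD2r lerDl mulrn_wge0// mulr_ge0.
Qed.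

Lemma cabs_sum (I : Type) (r : seq I) (P : pred I) (f : I -> R[i]) :
  cabs (\sum_(i <- r | P i) f i) <= \sum_(i <- r | P i) cabs (f i).
Proof.
elim/big_ind2 : _ => //; first by rewrite cabs0.
by move=> z x w y hz hw; rewrite (le_trans (cabsD _ _))// lerD.
Qed.

End Cabs.

(** * Sums of nonnegative families over an arbitrary index type *)

Section Psum.
Variable R : realType.

(** [fine] turns an infinite sum into 0, hence the companion predicate [summ] in most lemmas
    below. *)
Definition psum (I : choiceType) (u : I -> R) : R :=
  fine (\esum_(i in [set: I]) (u i)%:E).

Definition summ (I : choiceType) (u : I -> R) : Prop :=
  (\esum_(i in [set: I]) `|u i|%:E < +oo)%E.

Lemma psumE (I : choiceType) (u : I -> R) : (forall i, 0 <= u i) -> summ u ->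
  (psum u)%:E = (\esum_(i in [set: I]) (u i)%:E)%E.
Proof.
move=> u0 su; rewrite /psum fineK// ge0_fin_numE; last first.
  by apply: esum_ge0 => i _; rewrite lee_fin.
apply: le_lt_trans su; apply: le_esum => i _; rewrite lee_fin ger0_norm//.
Qed.

Lemma psum_ge0 (I : choiceType) (u : I -> R) : (forall i, 0 <= u i) ->
  0 <= psum u.
Proof.
by move=> u0; apply: fine_ge0; apply: esum_ge0 => i _; rewrite lee_fin.
Qed.

Lemma le_summ (I : choiceType) (u v : I -> R) :
  (forall i, `|u i| <= `|v i|) -> summ v -> summ u.
Proof.
move=> uv; apply: le_lt_trans; apply: le_esum => i _; rewrite lee_fin//.
Qed.

Lemma summD (I : choiceType) (u v : I -> R) :
  summ u -> summ v -> summ (fun i => u i + v i).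
Proof.
move=> su sv; apply: le_lt_trans (lte_add_pinfty su sv).
rewrite -esumD; [|by move=> *; rewrite lee_fin ..].
by apply: le_esum => i _; rewrite lee_fin ler_normD.
Qed.

(** Only the inequality [<=] is proved directly, for every positive factor; applied to [c^-1] it
    yields the reverse one. *)
Lemma esumZl (I : choiceType) (c : R) (u : I -> R) :
  0 <= c -> (forall i, 0 <= u i) ->
  (\esum_(i in [set: I]) (c * u i)%:E =
   c%:E * \esum_(i in [set: I]) (u i)%:E)%E.
Proof.
move=> c0 u0; have [->|cn0] := eqVneq c 0.
  by rewrite mul0e esum1// => i _; rewrite mul0r.
have cp : 0 < c by rewrite lt_neqAle eq_sym cn0.
have H (d : R) (w : I -> R) : 0 < d ->
    (\esum_(i in [set: I]) (d * w i)%:E <=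
     d%:E * \esum_(i in [set: I]) (w i)%:E)%E.
  move=> d0; apply: ge_ereal_sup => _ [F [finF _] <-].
  rewrite (_ : \sum_(x \in F) (d * w x)%:E = d%:E * \sum_(x \in F) (w x)%:E)%E.
    rewrite lee_pmul2l ?lte_fin//; apply: ereal_sup_ubound; exists F => //.
  rewrite !fsbig_finite//= !sumEFin -EFinM mulr_sumr//.
apply/eqP; rewrite eq_le H//=.
have := H c^-1 (fun i => c * u i); rewrite invr_gt0 => /(_ cp) h.
rewrite (_ : (\esum_(i in _) _) = \esum_(i in [set: I]) (u i)%:E)%E in h.
  by rewrite -[leRHS]mul1e -(mulfV cn0) EFinM -muleA lee_pmul2l ?lte_fin.
by apply: eq_esum => i _; rewrite mulrA mulVf// mul1r.
Qed.

Lemma summZ (I : choiceType) (c : R) (u : I -> R) :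
  summ u -> summ (fun i => c * u i).
Proof.
move=> su; rewrite /summ; under eq_esum do rewrite normrM.
rewrite esumZl// -(psumE (u := fun i => `|u i|))// ?ltry//.
by apply: le_summ su => i; rewrite normr_id.
Qed.

Lemma psumD (I : choiceType) (u v : I -> R) :
  (forall i, 0 <= u i) -> (forall i, 0 <= v i) -> summ u -> summ v ->
  psum (fun i => u i + v i) = psum u + psum v.
Proof.
move=> u0 v0 su sv; apply: EFin_inj; rewrite EFinD !psumE//; last 2 first.
- by move=> i; rewrite addr_ge0.
- exact: summD.
by rewrite -esumD; [apply: eq_esum|move=> *; rewrite lee_fin ..].
Qed.

Lemma psumZ (I : choiceType) (c : R) (u : I -> R) :
  0 <= c -> (forall i, 0 <= u i) -> psum (fun i => c * u i) = c * psum u.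
Proof.
move=> c0 u0; rewrite /psum esumZl//.
have [->|] := eqVneq c 0; first by rewrite mul0e mul0r.
move=> cn0; have cp : 0 < c by rewrite lt_neqAle eq_sym cn0.
have : (0 <= \esum_(i in [set: I]) (u i)%:E)%E.
  by apply: esum_ge0 => i _; rewrite lee_fin.
case: (\esum_(i in [set: I]) (u i)%:E)%E => [r||]//= _.
by rewrite gt0_muley//= mulr0.
Qed.

Lemma le_psum (I : choiceType) (u v : I -> R) :
  (forall i, 0 <= u i) -> (forall i, u i <= v i) -> summ v ->
  psum u <= psum v.
Proof.
move=> u0 uv sv.
have v0 i : 0 <= v i by apply: le_trans (uv i).
have su : summ u by apply: le_summ sv => i; rewrite !ger0_norm.
rewrite -lee_fin !psumE//; apply: le_esum => i _; rewrite lee_fin//.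
Qed.

(** Tonelli's theorem, from which the exchanges of summations below are derived. *)
Lemma esum_pair (I J : choiceType) (a : I -> J -> \bar R) :
  (forall i j, 0 <= a i j)%E ->
  (\esum_(i in [set: I]) \esum_(j in [set: J]) a i j =
   \esum_(k in [set: (I * J)%type]) a k.1 k.2)%E.
Proof.
move=> a0; rewrite (esum_esum (fun i j _ _ => a0 i j)).
by congr esum; apply/seteqP; split.
Qed.

Lemma psum_pair (I J : choiceType) (a : I -> J -> R) :
  (forall i j, 0 <= a i j) -> summ (fun k : I * J => a k.1 k.2) ->
  [/\ forall i, summ (a i), summ (fun i => psum (a i)) &
   psum (fun k : I * J => a k.1 k.2) = psum (fun i => psum (a i))].
Proof.
move=> a0 sa.
have E : (\esum_(i in [set: I]) \esum_(j in [set: J]) (a i j)%:E =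
   \esum_(k in [set: (I * J)%type]) (a k.1 k.2)%:E)%E.
  by rewrite esum_pair// => i j; rewrite lee_fin.
have Ea : (\esum_(k in [set: (I * J)%type]) (a k.1 k.2)%:E < +oo)%E.
  by rewrite -psumE ?ltry// => k; rewrite a0.
have fin i : (\esum_(j in [set: J]) (a i j)%:E < +oo)%E.
  apply: le_lt_trans Ea; rewrite -E.
  rewrite (esumID [set i] [set: I])//; last first.
    by move=> k _; apply: esum_ge0 => j _; rewrite lee_fin.
  rewrite setTI esum_set1; last by apply: esum_ge0 => j _; rewrite lee_fin.
  rewrite leeDl//; apply: esum_ge0 => k _; apply: esum_ge0 => j _.
  by rewrite lee_fin.
have s i : summ (a i).
  by rewrite /summ; under eq_esum do rewrite ger0_norm//.
have s2 : summ (fun i => psum (a i)).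
  rewrite /summ (_ : (\esum_(_ in _) _ = \esum_(i in [set: I])
     \esum_(j in [set: J]) (a i j)%:E)%E); first by rewrite E.
  apply: eq_esum => i _; rewrite ger0_norm ?psumE//; exact: psum_ge0.
split => //; apply: EFin_inj; rewrite !psumE//; last first.
  by move=> i; apply: psum_ge0.
by rewrite -E; apply: eq_esum => i _; rewrite psumE.
Qed.

Lemma summ_pair (I J : choiceType) (a : I -> J -> R) :
  (forall i j, 0 <= a i j) -> (forall i, summ (a i)) ->
  summ (fun i => psum (a i)) -> summ (fun k : I * J => a k.1 k.2).
Proof.
move=> a0 s s2; rewrite /summ.
rewrite (_ : (\esum_(_ in _) _)%E = \esum_(k in [set: (I * J)%type])
   (a k.1 k.2)%:E)%E; last by apply: eq_esum => k _; rewrite ger0_norm.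
rewrite -(esum_pair (a := fun i j => (a i j)%:E))//.
rewrite (eq_esum (b := fun i => (psum (a i))%:E)); last first.
  by move=> i _; rewrite psumE.
rewrite -psumE ?ltry// => i; exact: psum_ge0.
Qed.

Lemma psum_reindex (I J : choiceType) (e : J -> I) (u : I -> R) :
  bijective e -> psum (fun j => u (e j)) = psum u.
Proof.
by move=> be; rewrite /psum [in RHS](reindex_esum setT setT e)// setTT_bijective.
Qed.

Lemma summ_reindex (I J : choiceType) (e : J -> I) (u : I -> R) :
  bijective e -> summ (fun j => u (e j)) <-> summ u.
Proof.
move=> be; rewrite /summ [in X in _ <-> X](reindex_esum setT setT e)//.
by rewrite setTT_bijective.
Qed.

Lemma ger_psum (I : choiceType) (u : I -> R) i :
  (forall i, 0 <= u i) -> summ u -> u i <= psum u.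
Proof.
move=> u0 su; rewrite -lee_fin psumE//.
rewrite -(@esum_set1 _ _ i (fun i => (u i)%:E)) ?lee_fin//.
by rewrite [leRHS](esumID [set i])// ?setTI ?leeDl// ?esum_ge0// => *; rewrite lee_fin.
Qed.

Lemma psum_cvg (u : nat -> R) : (forall i, 0 <= u i) -> summ u ->
  series u @ \oo --> psum u.
Proof.
move=> u0 su.
have h : (fun n => (series u n)%:E) @ \oo --> (psum u)%:E.
  rewrite psumE// -nneseries_esumT; last by move=> n; rewrite lee_fin.
  rewrite (_ : (fun _ => _) = fun n => \sum_(0 <= i < n) (u i)%:E)%E; last first.
    by apply/funext => n; rewrite sumEFin.
  by apply: is_cvg_nneseries => n _; rewrite lee_fin.
by have /fine_cvgP[_] := h.
Qed.

End Psum.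

(** * Absolutely summable real and complex families *)

Section Csum.
Variable R : realType.
Local Notation C := R[i].

Definition rpos (x : R) : R := Num.max x 0.

Lemma rpos_ge0 x : 0 <= rpos x. Proof. by rewrite /rpos le_max lexx orbT. Qed.

Lemma rposB x : rpos x - rpos (- x) = x.
Proof. by rewrite /rpos; case: (leP x 0); case: (leP (- x) 0); lra. Qed.

Lemma rpos_le x : rpos x <= `|x|.
Proof. by rewrite /rpos ge_max ler_norm normr_ge0. Qed.

Definition rsum (I : choiceType) (u : I -> R) : R :=
  psum (fun i => rpos (u i)) - psum (fun i => rpos (- u i)).

Lemma summ_pos (I : choiceType) (u : I -> R) : summ u ->
  summ (fun i => rpos (u i)).
Proof.
apply: le_summ => i; rewrite ger0_norm ?rpos_ge0// rpos_le//.
Qed.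

Lemma summN (I : choiceType) (u : I -> R) : summ u -> summ (fun i => - u i).
Proof. by apply: le_summ => i; rewrite normrN. Qed.

(** Any decomposition into a difference of summable nonnegative families may replace the one into
    positive and negative parts, because [p + u^- = q + u^+] and [psum] is additive. Additivity of
    [rsum] follows from this freedom. *)
Lemma rsumB (I : choiceType) (p q : I -> R) :
  (forall i, 0 <= p i) -> (forall i, 0 <= q i) -> summ p -> summ q ->
  rsum (fun i => p i - q i) = psum p - psum q.
Proof.
move=> p0 q0 sp sq; set u := fun i => _.
have su : summ u by apply: summD => //; apply: summN.
apply/eqP; rewrite /rsum subr_eq addrAC eq_sym subr_eq; apply/eqP.
rewrite -!psumD => //; try (by move=> i; exact: rpos_ge0);
  try exact: summ_pos; try (by apply: summ_pos; apply: summN).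
congr psum; apply/funext => i; have := rposB (u i); rewrite /u; lra.
Qed.

Lemma rsum_psum (I : choiceType) (u : I -> R) : (forall i, 0 <= u i) ->
  rsum u = psum u.
Proof.
move=> u0; rewrite /rsum.
rewrite (_ : (fun i => rpos (u i)) = u); last first.
  by apply/funext => i; rewrite /rpos max_l.
rewrite (_ : (fun i => rpos (- u i)) = fun=> 0); last first.
  by apply/funext => i; rewrite /rpos max_r// oppr_le0.
by rewrite [X in _ - X](_ : _ = 0) ?subr0// /psum esum1.
Qed.

Lemma rsumD (I : choiceType) (u v : I -> R) : summ u -> summ v ->
  rsum (fun i => u i + v i) = rsum u + rsum v.
Proof.
move=> su sv; have su' := summN su; have sv' := summN sv.
rewrite (_ : (fun i => u i + v i) = (fun i => (rpos (u i) + rpos (v i)) -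
   (rpos (- u i) + rpos (- v i)))); last first.
  by apply/funext => i; rewrite -[in LHS](rposB (u i)) -[in LHS](rposB (v i)); ring.
rewrite rsumB; try (by move=> i; rewrite addr_ge0 ?rpos_ge0);
  try (by apply: summD; apply: summ_pos).
rewrite !psumD; try (by move=> i; exact: rpos_ge0); try exact: summ_pos.
rewrite /rsum; ring.
Qed.

Lemma rsumN (I : choiceType) (u : I -> R) : rsum (fun i => - u i) = - rsum u.
Proof.
by rewrite /rsum opprB; congr (_ - _); congr psum; apply/funext => i; rewrite opprK.
Qed.

Lemma rsumZ (I : choiceType) (c : R) (u : I -> R) :
  rsum (fun i => c * u i) = c * rsum u.
Proof.
wlog c0 : c / 0 <= c => [H|].
  case: (leP 0 c) => [/H//|c0].
  rewrite -[RHS]opprK -mulNr -H ?oppr_ge0 ?ltW// -rsumN.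
  by congr rsum; apply/funext => i; rewrite mulNr opprK.
rewrite /rsum mulrBr -!psumZ//; try (by move=> i; exact: rpos_ge0).
congr (_ - _); congr psum; apply/funext => i; rewrite /rpos maxr_pMr ?mulr0//.
by rewrite mulrN.
Qed.

Lemma le_rsum (I : choiceType) (u v : I -> R) :
  (forall i, u i <= v i) -> summ u -> summ v -> rsum u <= rsum v.
Proof.
move=> uv su sv; rewrite -subr_ge0 -rsumN -rsumD//; last exact: summN.
by rewrite rsum_psum ?psum_ge0// => i; rewrite subr_ge0.
Qed.

Lemma rsum_cvg (u : nat -> R) : summ u -> series u @ \oo --> rsum u.
Proof.
move=> su; rewrite (_ : series u = series (fun i => rpos (u i)) -
   series (fun i => rpos (- u i))).
  apply: cvgB; apply: psum_cvg; try (by move=> i; exact: rpos_ge0).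
  - exact: summ_pos.
  - by apply: summ_pos; apply: summN.
apply/funext => n /=; rewrite !fctE /series/= -sumrB; apply: eq_bigr => i _.
by rewrite rposB.
Qed.

Definition csum (I : choiceType) (f : I -> C) : C :=
  rsum (fun i => complex.Re (f i)) +i* rsum (fun i => complex.Im (f i)).

Definition csumm (I : choiceType) (f : I -> C) : Prop :=
  summ (fun i => cabs (f i)).

Lemma csumm_Re (I : choiceType) (f : I -> C) : csumm f ->
  summ (fun i => complex.Re (f i)).
Proof. by apply: le_summ => i; rewrite (ger0_norm (cabs_ge0 _)) ler_Re. Qed.

Lemma csumm_Im (I : choiceType) (f : I -> C) : csumm f ->
  summ (fun i => complex.Im (f i)).
Proof. by apply: le_summ => i; rewrite (ger0_norm (cabs_ge0 _)) ler_Im. Qed.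

Lemma le_csumm (I : choiceType) (f : I -> C) (u : I -> R) :
  (forall i, cabs (f i) <= u i) -> summ u -> csumm f.
Proof.
move=> fu; apply: le_summ => i; rewrite ger0_norm ?cabs_ge0//.
exact: le_trans (ler_norm _).
Qed.

Lemma csummD (I : choiceType) (f g : I -> C) :
  csumm f -> csumm g -> csumm (fun i => f i + g i).
Proof.
by move=> sf sg; apply: le_csumm (summD sf sg) => i; exact: cabsD.
Qed.

Lemma csummZ (I : choiceType) (c : C) (f : I -> C) :
  csumm f -> csumm (fun i => c * f i).
Proof.
move=> sf; apply: le_csumm (summZ (cabs c) sf) => i; rewrite cabsM//.
Qed.

Lemma csummN (I : choiceType) (f : I -> C) :
  csumm f -> csumm (fun i => - f i).
Proof. by move=> sf; apply: le_csumm sf => i; rewrite cabsN. Qed.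

Lemma csumD (I : choiceType) (f g : I -> C) : csumm f -> csumm g ->
  csum (fun i => f i + g i) = csum f + csum g.
Proof.
move=> sf sg; rewrite /csum /=; apply/eqP; rewrite eq_complex/=.
rewrite -(rsumD (csumm_Re sf) (csumm_Re sg)) -(rsumD (csumm_Im sf) (csumm_Im sg)).
by apply/andP; split; apply/eqP; congr rsum; apply/funext => i;
  case: (f i) => ? ?; case: (g i).
Qed.

Lemma csumZ (I : choiceType) (c : C) (f : I -> C) : csumm f ->
  csum (fun i => c * f i) = c * csum f.
Proof.
case: c => a b sf; rewrite /csum /=; apply/eqP; rewrite eq_complex/=.
have sr := csumm_Re sf; have si := csumm_Im sf.
have sbi := summN (summZ b si).
rewrite -!rsumZ -rsumN -(rsumD (summZ a sr) sbi).
rewrite -(rsumD (summZ a si) (summZ b sr)).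
by apply/andP; split; apply/eqP; congr rsum; apply/funext => i;
  case: (f i) => ? ?.
Qed.

Lemma csumN (I : choiceType) (f : I -> C) : csumm f ->
  csum (fun i => - f i) = - csum f.
Proof.
move=> sf; rewrite -mulN1r -csumZ//; congr csum; apply/funext => i.
by rewrite mulN1r.
Qed.

Lemma csumB (I : choiceType) (f g : I -> C) : csumm f -> csumm g ->
  csum (fun i => f i - g i) = csum f - csum g.
Proof. by move=> sf sg; rewrite csumD ?csumN//; apply: csummN. Qed.

Lemma csumJ (I : choiceType) (f : I -> C) :
  csum (fun i => (f i)^*) = (csum f)^*.
Proof.
rewrite /csum /=; apply/eqP; rewrite eq_complex/= -rsumN.
by apply/andP; split; apply/eqP; congr rsum; apply/funext => i;
  case: (f i) => ? ?.
Qed.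

Lemma csum_real (I : choiceType) (u : I -> R) :
  csum (fun i => (u i)%:C) = (rsum u)%:C.
Proof.
by rewrite /csum /= [X in _ +i* X]rsum_psum// /psum esum1.
Qed.

Lemma csum0 (I : choiceType) : csum (fun _ : I => 0) = 0.
Proof. by rewrite (csum_real (fun _ : I => 0)) rsum_psum// /psum esum1. Qed.

(** With z the sum, |z|^2 is the sum of the real parts of z^* f_i, each at most |z| |f_i|; then one
    divides by |z|. *)
Lemma cabs_csum (I : choiceType) (f : I -> C) : csumm f ->
  cabs (csum f) <= psum (fun i => cabs (f i)).
Proof.
move=> sf; set z := csum f.
have [->|z0] := eqVneq z 0.
  by rewrite cabs0; apply: psum_ge0 => i; exact: cabs_ge0.
have zp : 0 < cabs z by rewrite lt_neqAle cabs_ge0 eq_sym cabs_eq0 z0.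
rewrite -(ler_pM2l zp) -psumZ//; [|exact: cabs_ge0|by move=> i; exact: cabs_ge0].
have := csumZ z^* sf; rewrite -/z [z^* * z]mulrC mulcJ expr2 => /(congr1 (@complex.Re _)) /= <-.
rewrite -rsum_psum; last by move=> i; rewrite mulr_ge0 ?cabs_ge0.
apply: le_rsum.
- move=> i; apply: (le_trans (ler_norm _)); rewrite (le_trans (ler_Re _))//.
  by rewrite -[leLHS]/(cabs (z^* * f i)) cabsM cabsJ.
- exact: csumm_Re (csummZ z^* sf).
- exact: summZ.
Qed.

Lemma rsum_pair (I J : choiceType) (a : I -> J -> R) :
  summ (fun k : I * J => a k.1 k.2) ->
  [/\ forall i, summ (a i), summ (fun i => rsum (a i)) &
   rsum (fun k : I * J => a k.1 k.2) = rsum (fun i => rsum (a i))].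
Proof.
move=> sa.
have [s1 s2 e1] := psum_pair (a := fun i j => rpos (a i j))
  (fun i j => rpos_ge0 _) (summ_pos sa).
have [s3 s4 e2] := psum_pair (a := fun i j => rpos (- a i j))
  (fun i j => rpos_ge0 _) (summ_pos (summN sa)).
split.
- move=> i; have := summD (s1 i) (summN (s3 i)); apply: le_summ => j.
  by rewrite rposB.
- by apply: summD => //; exact: summN.
- rewrite [LHS]/rsum e1 e2 rsumB// => i; apply: psum_ge0 => j; exact: rpos_ge0.
Qed.

Lemma csum_pair (I J : choiceType) (a : I -> J -> C) :
  csumm (fun k : I * J => a k.1 k.2) ->
  [/\ forall i, csumm (a i), csumm (fun i => csum (a i)) &
   csum (fun k : I * J => a k.1 k.2) = csum (fun i => csum (a i))].
Proof.
move=> sa.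
have [_ h1 e1] := rsum_pair (a := fun i j => complex.Re (a i j)) (csumm_Re sa).
have [_ h2 e2] := rsum_pair (a := fun i j => complex.Im (a i j)) (csumm_Im sa).
have [s1 s2 _] := psum_pair (a := fun i j => cabs (a i j)) (fun i j => cabs_ge0 _) sa.
split => //.
- apply: le_csumm s2 => i; apply: cabs_csum; exact: s1.
- by rewrite [LHS]/csum e1 e2.
Qed.

Lemma csumm_pair (I J : choiceType) (a : I -> J -> C) :
  (forall i, csumm (a i)) -> summ (fun i => psum (fun j => cabs (a i j))) ->
  csumm (fun k : I * J => a k.1 k.2).
Proof.
move=> s1 s2; apply: (summ_pair (a := fun i j => cabs (a i j))) => //.
by move=> i j; exact: cabs_ge0.
Qed.

Lemma csum_reindex (I J : choiceType) (e : J -> I) (f : I -> C) :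
  bijective e -> csum (fun j => f (e j)) = csum f.
Proof.
move=> be; rewrite /csum /rsum.
rewrite (psum_reindex (fun i => rpos (complex.Re (f i))) be).
rewrite (psum_reindex (fun i => rpos (- complex.Re (f i))) be).
rewrite (psum_reindex (fun i => rpos (complex.Im (f i))) be).
by rewrite (psum_reindex (fun i => rpos (- complex.Im (f i))) be).
Qed.

Lemma csumm_reindex (I J : choiceType) (e : J -> I) (f : I -> C) :
  bijective e -> csumm (fun j => f (e j)) <-> csumm f.
Proof. exact: (@summ_reindex R I J e (fun i => cabs (f i))). Qed.

(** Fubini: both iterated sums equal the sum over pairs, which is invariant under the swap of
    coordinates. *)
Lemma csum_exchange (I J : choiceType) (a : I -> J -> C) :
  csumm (fun k : I * J => a k.1 k.2) ->
  csum (fun i => csum (a i)) = csum (fun j => csum (fun i => a i j)).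
Proof.
move=> sa; have [_ _ <-] := csum_pair sa.
pose sw (k : J * I) := (k.2, k.1).
have bsw : bijective sw by exists (fun k => (k.2, k.1)); case.
have sa' : csumm (fun k : J * I => a k.2 k.1).
  by have /csumm_reindex := bsw => /(_ (fun k => a k.1 k.2)) [_]; exact.
have [_ _ <-] := csum_pair (a := fun j i => a i j) sa'.
by rewrite -(csum_reindex (fun k => a k.1 k.2) bsw).
Qed.

Lemma csumm_pairT (I J : choiceType) (a : I -> J -> C) :
  csumm (fun k : I * J => a k.1 k.2) -> csumm (fun k : J * I => a k.2 k.1).
Proof.
pose sw (k : J * I) := (k.2, k.1).
have bsw : bijective sw by exists (fun k => (k.2, k.1)); case.
by have /csumm_reindex := bsw => /(_ (fun k => a k.1 k.2)) [_]; exact.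
Qed.

Lemma csumm_mul (I J : choiceType) (f : I -> C) (g : J -> C) :
  csumm f -> csumm g -> csumm (fun k : I * J => f k.1 * g k.2).
Proof.
move=> sf sg; apply: (csumm_pair (a := fun i j => f i * g j)) => [i|].
  exact: csummZ.
rewrite (_ : (fun i => _) = fun i => psum (fun j => cabs (g j)) * cabs (f i)).
  exact: summZ.
apply/funext => i; rewrite mulrC -psumZ ?cabs_ge0//; last by move=> j; exact: cabs_ge0.
by congr psum; apply/funext => j; rewrite cabsM.
Qed.

End Csum.

(** * Limits, series and two-sided sums in [R[i]] *)

Section LimC.
Variable R : realType.
Local Notation C := R[i].

Lemma is_limCP (u : nat -> C) (l : C) :
  is_limC u l <->
  forall e : R, 0 < e -> \forall n \near \oo, cabs (l - u n) < e.
Proof.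
rewrite /is_limC; split.
  move=> /cvgrPdist_lt h e e0.
  have /h : 0 < e%:C :> C by rewrite ltcR.
  by apply: filterS => n; rewrite cabsE ltcR.
(* The norm takes values in [R[i]], and a positive element of [R[i]] is necessarily real. *)
move=> h; apply/cvgrPdist_lt => e; rewrite ltcE => /andP[/eqP /= ei er].
have -> : e = (complex.Re e)%:C by case: e ei er => a b /= ->.
have := h _ er; apply: filterS => n.
by rewrite cabsE ltcR.
Qed.

Lemma is_limC_ReIm (u : nat -> C) (l : C) :
  is_limC u l <->
  (fun n => complex.Re (u n)) @ \oo --> complex.Re l /\
  (fun n => complex.Im (u n)) @ \oo --> complex.Im l.
Proof.
split=> [/is_limCP h|[/cvgrPdist_lt h1 /cvgrPdist_lt h2]].
  split; apply/cvgrPdist_lt => e e0; have := h e e0; apply: filterS => n.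
    by apply: le_lt_trans; rewrite -raddfB ler_Re.
  by apply: le_lt_trans; rewrite -raddfB ler_Im.
apply/is_limCP => e e0; have e2 : 0 < e / 2 by rewrite divr_gt0.
have := h1 _ e2; have := h2 _ e2; apply: filterS2 => n a b.
apply: (le_lt_trans (cabs_le _)); rewrite !raddfB /=.
by rewrite [ltRHS](splitr e) ltrD.
Qed.

Lemma is_limC_unique (u : nat -> C) (l l' : C) :
  is_limC u l -> is_limC u l' -> l = l'.
Proof. by move=> h h'; exact: (@cvg_unique C^o (@norm_hausdorff _ C^o) _ _ l l' h h'). Qed.

Lemma limCE (u : nat -> C) (l : C) : is_limC u l -> limC u = l.
Proof. by move=> h; exact: (@cvg_lim C^o (@norm_hausdorff _ C^o) _ _ _ u l h). Qed.

Lemma seriesCE (u : nat -> C) (l : C) : is_seriesC u l -> seriesC u = l.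
Proof. exact: limCE. Qed.

Lemma is_limC_cst (c : C) : is_limC (fun=> c) c.
Proof. exact: cvg_cst. Qed.

Lemma is_limCD (u v : nat -> C) (l k : C) : is_limC u l -> is_limC v k ->
  is_limC (fun n => u n + v n) (l + k).
Proof. exact: (@cvgD _ C^o). Qed.

Lemma is_limCM (u v : nat -> C) (l k : C) : is_limC u l -> is_limC v k ->
  is_limC (fun n => u n * v n) (l * k).
Proof. exact: (@cvgM C). Qed.

Lemma is_limC_near (u v : nat -> C) (l : C) :
  (\forall n \near \oo, u n = v n) -> is_limC u l -> is_limC v l.
Proof.
move=> uv /is_limCP h; apply/is_limCP => e e0.
by have := h e e0; apply: filterS2 uv => n ->.
Qed.

Lemma is_limC_shift (u : nat -> C) (l : C) :
  is_limC u l <-> is_limC (fun n => u n.+1) l.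
Proof. by rewrite /is_limC -(cvg_shiftS (V := C^o) u). Qed.

Lemma csum_series (f : nat -> C) : csumm f -> is_seriesC f (csum f).
Proof.
move=> sf; apply/is_limC_ReIm; split.
  rewrite (_ : (fun n => _) = series (fun n => complex.Re (f n))).
    exact/rsum_cvg/csumm_Re.
  by apply/funext => n; rewrite /series/= raddf_sum.
rewrite (_ : (fun n => _) = series (fun n => complex.Im (f n))).
  exact/rsum_cvg/csumm_Im.
by apply/funext => n; rewrite /series/= raddf_sum.
Qed.

Lemma seriesC_csum (f : nat -> C) : csumm f -> seriesC f = csum f.
Proof. by move=> sf; apply: seriesCE; exact: csum_series. Qed.

Lemma summ_inj (I J : choiceType) (e : J -> I) (u : I -> R) :
  injective e -> summ u -> summ (fun j => u (e j)).
Proof.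
move=> ei; apply: le_lt_trans.
rewrite -(esum_image setT e (fun i => `|u i|%:E)%E); last by move=> x y _ _; exact: ei.
rewrite [leRHS](esumID (e @` setT))// setTI leeDl//.
by apply: esum_ge0 => i _; rewrite lee_fin.
Qed.

Lemma csumm_inj (I J : choiceType) (e : J -> I) (f : I -> C) :
  injective e -> csumm f -> csumm (fun j => f (e j)).
Proof. by move=> ei; apply: (@summ_inj _ _ e (fun i => cabs (f i))). Qed.

(** The constructors [Posz] and [Negz] cut the integers into the two half-lines over which [is_sumZ]
    sums. *)
Lemma esum_int (a : int -> \bar R) : (forall i, 0 <= a i)%E ->
  (\esum_(i in [set: int]) a i = \esum_(n in [set: nat]) a (Posz n) +
     \esum_(n in [set: nat]) a (Negz n))%E.
Proof.
move=> a0; rewrite (esumID (range Posz))// setTI; congr (_ + _)%E.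
  by rewrite esum_image// => x y _ _ [].
rewrite setTI (_ : ~` _ = range Negz); last first.
  apply/seteqP; split=> [[n /= h|n _]|x [n _ <-] [m _]//].
    by exfalso; apply: h; exists n.
  by exists n.
by rewrite esum_image// => x y _ _ [].
Qed.

Lemma summ_int (u : int -> R) : summ (u \o Posz) -> summ (u \o Negz) -> summ u.
Proof.
move=> h1 h2; rewrite /summ esum_int; last by move=> i; rewrite lee_fin.
exact: lte_add_pinfty.
Qed.

Lemma psum_int (u : int -> R) : (forall i, 0 <= u i) -> summ u ->
  psum u = psum (u \o Posz) + psum (u \o Negz).
Proof.
move=> u0 su; apply: EFin_inj; rewrite EFinD !psumE//.
- by rewrite esum_int// => i; rewrite lee_fin.
- by move=> n; exact: u0.
- by apply: summ_inj su => x y [].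
- by move=> n; exact: u0.
- by apply: summ_inj su => x y [].
Qed.

Lemma csum_int (f : int -> C) : csumm f ->
  csum f = csum (f \o Posz) + csum (f \o Negz).
Proof.
move=> sf; rewrite /csum /rsum /=.
have h (u : int -> R) : summ u -> psum (fun i => rpos (u i)) =
    psum (fun i => rpos (u (Posz i))) + psum (fun i => rpos (u (Negz i))).
  by move=> su; rewrite psum_int//; [move=> i; exact: rpos_ge0|exact: summ_pos].
have sr := csumm_Re sf; have si := csumm_Im sf.
rewrite (h _ sr) (h _ (summN sr)) (h _ si) (h _ (summN si)).
by apply/eqP; rewrite eq_complex/=; apply/andP; split; apply/eqP; ring.
Qed.

Lemma csum_sumZ (f : int -> C) : csumm f -> is_sumZ f (csum f).
Proof.
move=> sf; exists (csum (f \o Posz)), (csum (f \o Negz)); split.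
- by apply: csum_series; apply: csumm_inj sf => x y [].
- by apply: csum_series; apply: csumm_inj sf => x y [].
- exact: csum_int.
Qed.

Lemma is_sumZE (f : int -> C) l : is_sumZ f l -> sumZ f = l.
Proof. by move=> [a [b [h1 h2 ->]]]; rewrite /sumZ (seriesCE h1) (seriesCE h2). Qed.

Lemma sumZ_csum (f : int -> C) : csumm f -> sumZ f = csum f.
Proof. by move=> sf; apply: is_sumZE; exact: csum_sumZ. Qed.

Lemma csum_single (I : choiceType) (i0 : I) (f : I -> C) :
  (forall i, i != i0 -> f i = 0) -> csum f = f i0.
Proof.
move=> f0.
have h (u : I -> R) : (forall i, i != i0 -> u i = 0) -> rsum u = u i0.
  have h' (v : I -> R) : (forall i, i != i0 -> v i = 0) -> 0 <= v i0 -> psum v = v i0.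
    move=> v0 vp; rewrite /psum (esumID [set i0])//; last first.
      by move=> i _; rewrite lee_fin; have [->//|/v0->] := eqVneq i i0.
    rewrite setTI esum_set1 ?lee_fin// esum1 ?adde0//.
    by move=> i [_ /= /eqP/v0 ->].
  move=> u0; rewrite /rsum !h' ?rposB ?rpos_ge0// => i /u0 ->.
    by rewrite oppr0 /rpos maxxx.
  by rewrite /rpos maxxx.
rewrite /csum !h; [by case: (f i0)|by move=> i /f0 ->|by move=> i /f0 ->].
Qed.

Lemma csumm_fin (I : choiceType) (s : seq I) (f : I -> C) :
  (forall i, i \notin s -> f i = 0) -> csumm f.
Proof.
move=> f0; rewrite /csumm /summ.
rewrite (_ : (\esum_(_ in _) _ = \esum_(i in [set` s]) `|cabs (f i)|%:E)%E).
  by rewrite esum_fset// fsbig_finite//= sumEFin ltry.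
rewrite [RHS]esum_mkcond; apply: eq_esum => i _.
by rewrite mem_setE; case: ifPn => // /f0 ->; rewrite cabs0 normr0.
Qed.

End LimC.

(** * Power series and their composition *)

Section Geometric.
Variable R : realType.

Lemma summ_bounded (u : nat -> R) (M : R) : (forall i, 0 <= u i) ->
  (forall n, \sum_(0 <= i < n) u i <= M) -> summ u.
Proof.
move=> u0 uM; rewrite /summ.
under eq_esum do rewrite ger0_norm//.
rewrite -nneseries_esumT; last by move=> n; rewrite lee_fin.
apply: (@le_lt_trans _ _ M%:E); last exact: ltry.
apply: lime_le; first by apply: is_cvg_nneseries => n _; rewrite lee_fin.
by apply: nearW => n; rewrite sumEFin lee_fin.
Qed.

Lemma summ_geometric (r : R) : 0 <= r < 1 -> summ (fun n => r ^+ n).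
Proof.
move=> /andP[r0 r1]; apply: (summ_bounded (M := (1 - r)^-1)).
  by move=> i; rewrite exprn_ge0.
move=> n; have r10 : 1 - r > 0 by rewrite subr_gt0.
rewrite -[leRHS]mul1r ler_pdivlMr// mulrC big_mkord.
have := subrX1 r n => /(congr1 -%R).
rewrite -mulNr !opprB => <-; rewrite lerBlDr lerDl exprn_ge0//.
Qed.

Lemma psum_geometric (r : R) : 0 <= r < 1 -> psum (fun n => r ^+ n) = (1 - r)^-1.
Proof.
move=> /[dup] hr /andP[r0 r1].
have h : series (fun n => r ^+ n) @ \oo --> (psum (fun n => r ^+ n) : R).
  by apply: psum_cvg; [move=> i; rewrite exprn_ge0|exact: summ_geometric].
have h2 : series (geometric 1 r) @ \oo --> 1 * (1 - r)^-1.
  by apply: cvg_geometric_series; rewrite ger0_norm.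
rewrite mul1r in h2; apply: (cvg_unique (@norm_hausdorff _ R) h).
by move: h2; rewrite (_ : geometric 1 r = fun n => r ^+ n)//; apply/funext => n /=; rewrite mul1r.
Qed.

End Geometric.

Section PowerSeries.
Variable R : realType.
Local Notation C := R[i].
Implicit Types (a b u v : nat -> C) (r : R) (z h : C).

Definition psr a r : Prop := summ (fun n => cabs (a n) * r ^+ n).
(** The weighted l1 norm: submultiplicative for [conv], and a bound for [pser a] on the closed disc
    of radius [r]. The norm of the inner series decides at which radius the outer one must converge
    in a composition. *)
Definition nrm a r : R := psum (fun n => cabs (a n) * r ^+ n).
Definition pser a z : C := csum (fun n => a n * z ^+ n).
Definition conv a b (n : nat) : C := \sum_(k < n.+1) a k * b (n - k)%N.
Definition one_seq (n : nat) : C := (n == 0)%:R.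

Lemma nrm_ge0 a r : 0 <= r -> 0 <= nrm a r.
Proof. by move=> r0; apply: psum_ge0 => i; rewrite mulr_ge0 ?cabs_ge0 ?exprn_ge0. Qed.

Lemma psr_csumm a r z : cabs z <= r -> psr a r -> csumm (fun n => a n * z ^+ n).
Proof.
move=> zr; apply: le_csumm => n; rewrite cabsM cabsX ler_wpM2l ?cabs_ge0//.
by rewrite lerXn2r ?nnegrE ?cabs_ge0// (le_trans _ zr)// cabs_ge0.
Qed.

Lemma psr_le a r r' : 0 <= r <= r' -> psr a r' -> psr a r.
Proof.
move=> /andP[r0 rr']; apply: le_summ => n.
have r'0 := le_trans r0 rr'.
rewrite !ger0_norm ?mulr_ge0 ?cabs_ge0 ?exprn_ge0// ler_wpM2l ?cabs_ge0//.
by rewrite lerXn2r ?nnegrE.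
Qed.

Lemma pser_series a r z : cabs z <= r -> psr a r ->
  is_seriesC (fun n => a n * z ^+ n) (pser a z).
Proof. by move=> zr sa; apply: csum_series; exact: psr_csumm sa. Qed.

Lemma csum_recl (f : nat -> C) : csumm f -> csum f = f 0%N + csum (fun n => f n.+1).
Proof.
move=> sf; have sf' : csumm (fun n => f n.+1) by apply: csumm_inj sf => x y [].
have := is_limCD (@is_limC_cst R (f 0%N)) (csum_series sf').
apply: is_limC_unique; have /is_limC_shift := csum_series sf.
by congr is_limC; apply/funext => n; rewrite /series/= big_nat_recl.
Qed.

Lemma csum_inj (I J : choiceType) (e : J -> I) (f : I -> C) :
  injective e -> (forall i, ~ range e i -> f i = 0) ->
  csum (fun j => f (e j)) = csum f.
Proof.
move=> ei f0.
have h (u : I -> R) : (forall i, ~ range e i -> u i = 0) -> (forall i, 0 <= u i) ->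
   psum (fun j => u (e j)) = psum u.
  move=> u0 up; rewrite /psum [in RHS](esumID (range e)); last by move=> *; rewrite lee_fin.
  rewrite !setTI [X in fine (_ + X)]esum1 ?adde0.
    by rewrite esum_image// => x y _ _; exact: ei.
  by move=> i /= /u0 ->.
rewrite /csum /rsum.
rewrite (h (fun i => rpos (complex.Re (f i)))); [|by move=> i /f0 ->; rewrite /rpos maxxx|by move=> i; exact: rpos_ge0].
rewrite (h (fun i => rpos (- complex.Re (f i)))); [|by move=> i /f0 ->; rewrite oppr0 /rpos maxxx|by move=> i; exact: rpos_ge0].
rewrite (h (fun i => rpos (complex.Im (f i)))); [|by move=> i /f0 ->; rewrite /rpos maxxx|by move=> i; exact: rpos_ge0].
by rewrite (h (fun i => rpos (- complex.Im (f i)))); [|by move=> i /f0 ->; rewrite oppr0 /rpos maxxx|by move=> i; exact: rpos_ge0].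
Qed.

Lemma summ_supp (I J : choiceType) (e : J -> I) (u : I -> R) :
  injective e -> (forall i, ~ range e i -> u i = 0) ->
  summ (fun j => u (e j)) -> summ u.
Proof.
move=> ei u0; rewrite /summ [in X in _ -> X](esumID (range e)); last by move=> *; rewrite lee_fin.
rewrite !setTI [X in (_ + X)%E]esum1 ?adde0.
  by rewrite esum_image// => x y _ _; exact: ei.
by move=> i /= /u0 ->; rewrite normr0.
Qed.

Lemma csum_fin (f : nat -> C) n : (forall k, (n <= k)%N -> f k = 0) ->
  csum f = \sum_(k < n) f k.
Proof.
move=> f0; have sf : csumm f.
  by apply: (csumm_fin (s := iota 0 n)) => k; rewrite mem_iota/= add0n -leqNgt => /f0.
apply: (is_limC_unique (csum_series sf)).
apply: is_limC_near (@is_limC_cst R _); near=> k.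
have nk : (n <= k)%N by near: k; exact: nbhs_infty_ge.
rewrite -(big_mkord xpredT) /series/= [RHS](big_cat_nat (n := n))//=.
rewrite [X in _ = _ + X]big_nat_cond [X in _ = _ + X]big1 ?addr0// => i /andP[/andP[ni _] _].
exact: f0.
Unshelve. all: by end_near. Qed.

(** The pair (k, l) is sent injectively to (k + l, k); [G] extends the family by zero off the
    triangle k <= n, so that its inner sums are finite. *)
Lemma csum_triangle (F : nat -> nat -> C) :
  csumm (fun k : nat * nat => F k.1 k.2) ->
  csumm (fun n => \sum_(k < n.+1) F k (n - k)%N) /\
  csum (fun k : nat * nat => F k.1 k.2) = csum (fun n => \sum_(k < n.+1) F k (n - k)%N).
Proof.
pose G (n k : nat) : C := if (k <= n)%N then F k (n - k)%N else 0.
pose e (k : nat * nat) := ((k.1 + k.2)%N, k.1).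
have ei : injective e by move=> [a b] [c d] [/= h1 h2]; congr pair; lia.
have G0 (p : nat * nat) : ~ range e p -> G p.1 p.2 = 0.
  move: p => [n k] /= h; rewrite /G; case: leqP => // kn; exfalso; apply: h.
  by exists (k, (n - k)%N) => //=; rewrite /e/= subnKC.
have FG p : F p.1 p.2 = G (e p).1 (e p).2.
  by case: p => a b /=; rewrite /G leq_addr addKn.
move=> sF; have sG : csumm (fun p : nat * nat => G p.1 p.2).
  apply: (summ_supp (e := e) ei) => [i /G0 ->|]; first by rewrite cabs0.
  by apply: le_summ sF => p; rewrite -FG.
have [_ s2 E] := csum_pair sG.
have EG n : csum (G n) = \sum_(k < n.+1) F k (n - k)%N.
  rewrite (@csum_fin _ n.+1).
    by apply: eq_bigr => i _; rewrite /G -ltnS ltn_ord.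
  by move=> k nk; rewrite /G leqNgt nk.
rewrite (_ : (fun n => \sum_(k < n.+1) _) = fun n => csum (G n)); last by apply/funext => n; rewrite EG.
split => //; rewrite -E.
rewrite -(csum_inj (f := fun p => G p.1 p.2) ei)//.
by congr csum; apply/funext => p; exact: FG.
Qed.

Lemma csum_mul (I J : choiceType) (f : I -> C) (g : J -> C) :
  csumm f -> csumm g ->
  csum (fun k : I * J => f k.1 * g k.2) = csum f * csum g.
Proof.
move=> sf sg; have [_ _ ->] := csum_pair (a := fun i j => f i * g j) (csumm_mul sf sg).
rewrite [RHS]mulrC -csumZ//; congr csum; apply/funext => i.
by rewrite csumZ// mulrC.
Qed.

Lemma conv_psr a b r : 0 <= r -> psr a r -> psr b r ->
  psr (conv a b) r /\ nrm (conv a b) r <= nrm a r * nrm b r.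
Proof.
move=> r0 sa sb.
pose A (c : nat -> C) n : R := cabs (c n) * r ^+ n.
have A0 c n : 0 <= A c n by rewrite mulr_ge0 ?cabs_ge0 ?exprn_ge0.
pose D n := \sum_(k < n.+1) A a k * A b (n - k)%N.
have D0 n : 0 <= D n by apply: sumr_ge0 => i _; rewrite mulr_ge0.
have cA c : psr c r -> csumm (fun n => (A c n)%:C : C).
  by move=> sc; apply: le_csumm sc => n; rewrite cabsr ger0_norm.
have sAB := csumm_mul (cA _ sa) (cA _ sb).
have [s1 e1] := csum_triangle (F := fun i j => (A a i)%:C * (A b j)%:C) sAB.
have ED : (fun n => \sum_(k < n.+1) (A a k)%:C * (A b (n - k)%N)%:C : C) =
    fun n => (D n)%:C.
  by apply/funext => n; rewrite /D rmorph_sum; apply: eq_bigr => i _; rewrite [RHS]rmorphM.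
rewrite {}ED in s1 e1.
have sD : summ D.
  by apply: le_summ s1 => n; rewrite cabsr normr_id.
have eD : psum D = nrm a r * nrm b r.
  apply/complexI; rewrite -rsum_psum// -csum_real -e1 rmorphM /=.
  have nE c : (nrm c r)%:C = csum (fun n => (A c n)%:C).
    by rewrite csum_real rsum_psum.
  by rewrite !nE (csum_mul (cA _ sa) (cA _ sb)).
have le1 n : A (conv a b) n <= D n.
  rewrite /A /D /conv.
  rewrite (_ : \sum_(k < n.+1) _ = (\sum_(k < n.+1) cabs (a k * b (n - k)%N)) * r ^+ n).
    by rewrite ler_wpM2r ?exprn_ge0// cabs_sum.
  rewrite mulr_suml; apply: eq_bigr => i _.
  by rewrite /A cabsM mulrACA -exprD subnKC// -ltnS ltn_ord.
rewrite -eD; split; last exact: le_psum (A0 _) le1 sD.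
by apply: le_summ sD => n; rewrite (ger0_norm (D0 n)) (ger0_norm (A0 _ n)).
Qed.

Lemma pser_conv a b r z : cabs z <= r -> psr a r -> psr b r ->
  pser (conv a b) z = pser a z * pser b z.
Proof.
move=> zr sa sb; have ca := psr_csumm zr sa; have cb := psr_csumm zr sb.
have sAB := csumm_mul ca cb.
have [s1 e1] := csum_triangle (F := fun i j => (a i * z ^+ i) * (b j * z ^+ j)) sAB.
rewrite /pser -(csum_mul ca cb) e1; congr csum; apply/funext => n.
rewrite mulr_suml; apply: eq_bigr => i _.
by rewrite mulrACA -exprD subnKC// -ltnS ltn_ord.
Qed.

Lemma psr_one r : 0 <= r -> psr one_seq r.
Proof.
move=> r0; have : csumm (fun n => one_seq n * r%:C ^+ n).
  apply: (csumm_fin (s := [:: 0%N])) => -[//|n] _.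
  by rewrite /one_seq mul0r.
by apply: le_summ => n; rewrite cabsM cabsX cabsr (ger0_norm r0).
Qed.

Lemma pser_one z : pser one_seq z = 1.
Proof.
rewrite /pser (@csum_single _ _ 0%N) ?mul1r ?expr0// => -[//|n] _.
by rewrite /one_seq mul0r.
Qed.

Lemma iter_conv_psr u v r k : 0 <= r -> psr u r -> psr v r ->
  psr (iter k (conv u) v) r /\ nrm (iter k (conv u) v) r <= nrm u r ^+ k * nrm v r.
Proof.
move=> r0 su sv; elim: k => [|k [IH1 IH2]] /=; first by rewrite expr0 mul1r.
have [h1 h2] := conv_psr r0 su IH1; split => //.
by rewrite (le_trans h2)// exprS -mulrA ler_wpM2l ?nrm_ge0.
Qed.

Lemma pser_iter_conv u v r z k : cabs z <= r -> psr u r -> psr v r ->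
  pser (iter k (conv u) v) z = pser u z ^+ k * pser v z.
Proof.
move=> zr su sv; have r0 : 0 <= r by apply: le_trans zr; exact: cabs_ge0.
elim: k => [|k IH] /=; first by rewrite expr0 mul1r.
rewrite (pser_conv (r := r))// ?IH ?exprS ?mulrA//.
by have [] := iter_conv_psr k r0 su sv.
Qed.

(** Coefficient of z^n in v(z) g(u(z)): [iter k (conv u) v] holds the coefficients of u^k v. The sum
    over k is infinite in general, because u(0) need not vanish when a series is recentered. *)
Definition comp_coef (g u v : nat -> C) (n : nat) : C :=
  csum (fun k => g k * iter k (conv u) v n).

(* Fubini turns sum_k g_k v(z) u(z)^k into a power series in z. *)
Lemma pser_comp (g u v : nat -> C) r :
  0 <= r -> psr u r -> psr v r -> psr g (nrm u r) ->
  psr (comp_coef g u v) r /\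
  forall z, cabs z <= r -> pser (comp_coef g u v) z = pser v z * pser g (pser u z).
Proof.
move=> r0 su sv sg.
pose W k := iter k (conv u) v.
have hW k : psr (W k) r /\ nrm (W k) r <= nrm u r ^+ k * nrm v r.
  exact: iter_conv_psr.
(* Summing over n first bounds row k by |g k| (nrm u r)^k nrm v r, which is summable since [g]
   converges at radius [nrm u r]. *)
have fub z : cabs z <= r -> csumm (fun p : nat * nat => g p.1 * W p.1 p.2 * z ^+ p.2).
  move=> zr; apply: (csumm_pair (a := fun k n => g k * W k n * z ^+ n)).
    move=> k; rewrite (_ : (fun n => _) = fun n => g k * (W k n * z ^+ n)).
      by apply: csummZ; apply: psr_csumm zr _; have [] := hW k.
    by apply/funext => n; rewrite mulrA.
  apply: le_summ (summZ (nrm v r) sg) => k.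
  rewrite ger0_norm; last by apply: psum_ge0 => n; exact: cabs_ge0.
  rewrite ger0_norm; last by rewrite !mulr_ge0 ?cabs_ge0 ?exprn_ge0 ?nrm_ge0.
  have [h1 h2] := hW k.
  apply: (@le_trans _ _ (cabs (g k) * nrm (W k) r)).
    rewrite /nrm -psumZ ?cabs_ge0//; last by move=> n; rewrite mulr_ge0 ?cabs_ge0 ?exprn_ge0.
    apply: le_psum; [by move=> n; exact: cabs_ge0| |exact: summZ].
    move=> n; rewrite !cabsM -mulrA ler_wpM2l ?cabs_ge0// ler_wpM2l ?cabs_ge0//.
    by rewrite cabsX lerXn2r ?nnegrE ?cabs_ge0.
  by rewrite mulrCA ler_wpM2l ?cabs_ge0// mulrC.
have key z : cabs z <= r ->
    csumm (fun n => comp_coef g u v n * z ^+ n) /\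
    pser (comp_coef g u v) z = pser v z * pser g (pser u z).
  move=> zr; have sf := fub z zr; have sf' := csumm_pairT (a := fun k n => g k * W k n * z ^+ n) sf.
  have [_ s2 _] := csum_pair (a := fun n k => g k * W k n * z ^+ n) sf'.
  have [s3 s4 _] := csum_pair (a := fun k n => g k * W k n * z ^+ n) sf.
  have E n : csum (fun k => g k * W k n * z ^+ n) = comp_coef g u v n * z ^+ n.
    (* When z^n is nonzero, summability in k of the bare coefficient is recovered by dividing by it;
       otherwise both sides vanish. *)
    have [->|z0] := eqVneq (z ^+ n) 0.
      by rewrite mulr0 -[RHS](@csum0 R nat); congr csum; apply/funext => k; rewrite mulr0.
    have [s5 _ _] := csum_pair (a := fun n k => g k * W k n * z ^+ n) sf'.
    rewrite mulrC -csumZ.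
      by congr csum; apply/funext => k; rewrite mulrC.
    have := csummZ (z ^+ n)^-1 (s5 n); congr csumm; apply/funext => k.
    by rewrite mulrC mulfK.
  split.
    by move: s2; congr csumm; apply/funext => n; rewrite E.
  rewrite /pser (_ : csum _ = csum (fun n => csum (fun k => g k * W k n * z ^+ n))).
    rewrite -(csum_exchange (a := fun k n => g k * W k n * z ^+ n) sf) -csumZ.
      congr csum; apply/funext => k.
      have := pser_iter_conv k zr su sv; rewrite /pser -/(W k) => eW.
      transitivity (g k * csum (fun n => W k n * z ^+ n)); last by rewrite eW; ring.
      rewrite -csumZ; first by congr csum; apply/funext => n; rewrite mulrA.
      by apply: psr_csumm zr _; have [] := hW k.
    apply: psr_csumm sg; rewrite (le_trans (cabs_csum _))//; first exact: psr_csumm zr su.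
    apply: le_psum; [by move=> n; exact: cabs_ge0| |exact: su].
    by move=> n; rewrite cabsM cabsX ler_wpM2l ?cabs_ge0// lerXn2r ?nnegrE ?cabs_ge0.
  by congr csum; apply/funext => n; rewrite E.
split; last by move=> z /key[].
have [|h _] := key r%:C; first by rewrite cabsr ger0_norm.
by apply: le_summ h => n; rewrite cabsM cabsX cabsr (ger0_norm r0).
Qed.

End PowerSeries.

(** * Analytic functions and propagation of identities along segments *)

Section Analytic.
Variable R : realType.
Local Notation C := R[i].
Implicit Types (a b : nat -> C) (z w h : C).

Lemma series_bounded (f : nat -> C) l : is_seriesC f l ->
  exists M : R, forall n, cabs (f n) <= M.
Proof.
move=> /is_limCP/(_ 1 ltr01) [N _ hN].
exists (2 + \sum_(n < N) cabs (f n)) => n.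
have s0 : 0 <= \sum_(n < N) cabs (f n) by apply: sumr_ge0 => i _; exact: cabs_ge0.
have [nN|nN] := ltnP n N.
  rewrite (bigD1 (Ordinal nN))//= addrCA lerDl addr_ge0//.
  by apply: sumr_ge0 => i _; exact: cabs_ge0.
have h1 := hN n nN; have h2 := hN n.+1 (leqW nN).
have -> : f n = (l - series f n) - (l - series f n.+1).
  by rewrite /series/= big_nat_recr//=; ring.
apply: (le_trans (cabsB _ _)); move: h1 h2 => /=; lra.
Qed.

(** Abel's lemma: convergence at [h] bounds the terms, and at a radius r < |h| they are dominated by
    a geometric series of ratio r / |h|. *)
Lemma psr_series a h l r : is_seriesC (fun n => a n * h ^+ n) l ->
  0 <= r < cabs h -> psr a r.
Proof.
move=> /series_bounded[M hM] /andP[r0 rh].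
have h0 : 0 < cabs h by apply: le_lt_trans rh.
have q : 0 <= r / cabs h < 1 by rewrite divr_ge0 ?(ltW h0)//= ltr_pdivrMr// mul1r.
apply: le_summ (summZ M (summ_geometric q)) => n.
have M0 : 0 <= M by apply: le_trans (hM 0%N); exact: cabs_ge0.
rewrite !ger0_norm ?mulr_ge0 ?cabs_ge0 ?exprn_ge0//; last by case/andP: q.
rewrite expr_div_n mulrA ler_pdivlMr ?exprn_gt0// mulrAC ler_wpM2r ?exprn_ge0//.
by rewrite -cabsX -cabsM.
Qed.

(** [analytic_at] asks only for plain convergence. Convergence at the real point r / 2 makes the
    series absolutely convergent at radius r / 4, and uniqueness of limits identifies its sum with
    F. *)
Lemma analyticP (F : C -> C) z :
  analytic_at F z <-> exists a r, [/\ 0 < r, psr a r &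
    forall h, cabs h <= r -> F (z + h) = pser a h].
Proof.
split.
  move=> [a [r [r0 hF]]]; exists a, (r / 4); have r40 : 0 < r / 4 by lra.
  have pa : psr a (r / 4).
    apply: (@psr_series a (r / 2)%:C (F (z + (r / 2)%:C)) (r / 4)).
      by apply: hF; rewrite cabsE ltcR cabsr ger0_norm; lra.
    by rewrite cabsr ger0_norm; lra.
  split => // h hr.
  have hh : `|h| < r%:C by rewrite cabsE ltcR; lra.
  exact: is_limC_unique (hF h hh) (pser_series hr pa).
move=> [a [r [r0 pa hF]]]; exists a, r; split => // h; rewrite cabsE ltcR => /ltW hr.
by rewrite hF//; exact: pser_series pa.
Qed.

Lemma psrB a b r : psr a r -> psr b r -> psr (fun n => a n - b n) r.
Proof.
move=> sa sb; apply: le_summ (summD sa sb) => n.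
rewrite -mulrDl !normrM ler_wpM2r// (ger0_norm (cabs_ge0 _)).
by apply: le_trans (ler_norm _); exact: cabsB.
Qed.

Lemma pserB a b r z : cabs z <= r -> psr a r -> psr b r ->
  pser (fun n => a n - b n) z = pser a z - pser b z.
Proof.
move=> zr sa sb; rewrite /pser -csumB; try exact: psr_csumm zr _.
by congr csum; apply/funext => n; rewrite mulrBl.
Qed.

Lemma analyticB (F G : C -> C) z : analytic_at F z -> analytic_at G z ->
  analytic_at (fun y => F y - G y) z.
Proof.
move=> /analyticP[a [r [r0 sa hF]]] /analyticP[b [s [s0 sb hG]]].
apply/analyticP; exists (fun n => a n - b n), (Num.min r s).
have m0 : 0 < Num.min r s by rewrite lt_min r0.
have sa' : psr a (Num.min r s) by apply: psr_le sa; rewrite (ltW m0) ge_min lexx.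
have sb' : psr b (Num.min r s) by apply: psr_le sb; rewrite (ltW m0) ge_min lexx orbT.
split => //; first exact: psrB.
move=> h hrs; rewrite (pserB hrs)//.
by move: hrs; rewrite le_min => /andP[/hF -> /hG ->].
Qed.

Lemma pser_recl a r z : 0 < r -> cabs z <= r -> psr a r ->
  psr (fun n => a n.+1) r /\ pser a z = a 0%N + z * pser (fun n => a n.+1) z.
Proof.
move=> r0 zr sa.
have sa' : psr (fun n => a n.+1) r.
  have := summZ r^-1 (summ_inj succn_inj sa); apply: le_summ => n.
  by rewrite exprS mulrCA mulKf ?gt_eqF.
split => //; rewrite /pser csum_recl; last exact: psr_csumm sa.
rewrite expr0 mulr1 -csumZ; last exact: psr_csumm sa'.
by congr (_ + _); congr csum; apply/funext => n; rewrite exprS mulrCA.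
Qed.

Lemma cabs_pser a r z : cabs z <= r -> psr a r -> cabs (pser a z) <= nrm a r.
Proof.
move=> zr sa; apply: (le_trans (cabs_csum (psr_csumm zr sa))).
apply: le_psum => // n; first exact: cabs_ge0.
by rewrite cabsM cabsX ler_wpM2l ?cabs_ge0// lerXn2r ?nnegrE ?cabs_ge0// (le_trans _ zr) ?cabs_ge0.
Qed.

(** A nonzero constant term would dominate the rest of the series at e w for small e, so it
    vanishes; dividing by the variable gives a series with the same zeros, and induction on n
    concludes. *)
Lemma pser_eq0 a r w : 0 < r -> psr a r -> w != 0 ->
  (exists e0 : R, 0 < e0 /\ forall e : R, 0 < e < e0 -> pser a (e%:C * w) = 0) ->
  forall n, a n = 0.
Proof.
move=> r0 sa w0 [e0 [e00 he]] n.
have wp : 0 < cabs w by rewrite lt_neqAle eq_sym cabs_eq0 w0 cabs_ge0.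
wlog e0r : e0 e00 he / e0 * cabs w <= r.
  move=> H; apply: (H (Num.min e0 (r / cabs w))).
  - by rewrite lt_min e00 divr_gt0.
  - by move=> e /andP[ep]; rewrite lt_min => /andP[h _]; apply: he; rewrite ep.
  - by rewrite -ler_pdivlMr// ge_min lexx orbT.
have ew e : 0 < e < e0 -> cabs (e%:C * w) <= r.
  move=> /andP[ep ee]; rewrite cabsM cabsr gtr0_norm// (le_trans _ e0r)//.
  by rewrite ler_wpM2r ?cabs_ge0// ltW.
have step b : psr b r -> (forall e : R, 0 < e < e0 -> pser b (e%:C * w) = 0) -> b 0%N = 0.
  move=> sb hb; apply/eqP; rewrite -cabs_eq0 eq_le cabs_ge0 andbT leNgt.
  apply/negP => b0.
  (* The tail at e w is at most e (K - 1), while e is chosen with e K <= |b 0|; since b 0 equals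
     minus the tail, this is contradictory. The added 1 makes K positive and the inequality
     strict. *)
  pose K := cabs w * nrm (fun n => b n.+1) r + 1.
  have K0 : 0 < K by rewrite ltr_wpDl// mulr_ge0 ?cabs_ge0 ?nrm_ge0// ltW.
  pose e := Num.min (e0 / 2) (cabs (b 0%N) / K).
  have ep : 0 < e by rewrite lt_min !divr_gt0.
  have ee : e < e0 by rewrite gt_min; apply/orP; left; lra.
  have ee' : 0 < e < e0 by rewrite ep.
  have [sb' E] := pser_recl r0 (ew e ee') sb.
  have := hb e ee'; rewrite E => /eqP; rewrite addr_eq0 => /eqP/(congr1 (@cabs R)).
  rewrite cabsN !cabsM cabsr (gtr0_norm ep) => Eb.
  have h1 := cabs_pser (ew e ee') sb'.
  have h2 : cabs (b 0%N) <= e * (K - 1).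
    by rewrite Eb /K addrK -mulrA !ler_wpM2l ?cabs_ge0 ?(ltW ep).
  have h3 : e * K <= cabs (b 0%N) by rewrite -ler_pdivlMr// ge_min lexx orbT.
  by move: h2 h3; nra.
have next b : psr b r -> (forall e : R, 0 < e < e0 -> pser b (e%:C * w) = 0) ->
    psr (fun n => b n.+1) r /\ (forall e : R, 0 < e < e0 -> pser (fun n => b n.+1) (e%:C * w) = 0).
  move=> sb hb; have b0 := step b sb hb; split.
    have [] // := pser_recl (z := 0) r0 _ sb; by rewrite cabs0 ltW.
  move=> e ee; have [_ E] := pser_recl r0 (ew e ee) sb.
  have := hb e ee; rewrite E b0 add0r => /eqP; rewrite !mulf_eq0 (negPf w0) orbF.
  case/orP => [/eqP/complexI e_0|/eqP//]; by move: ee; rewrite e_0 ltxx.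
elim: n a sa he => [|n IH] a sa he; first exact: step.
have [sa' he'] := next a sa he.
exact: (IH (fun n => a n.+1)).
Qed.

(** The identity theorem on the segment from 0 to w: at the supremum t0 of the parameters up to
    which G vanishes, the local expansion vanishes on one side, hence identically, so t0 could be
    increased unless it is 1. *)
Lemma analytic_ray (G : C -> C) w :
  (forall t : R, 0 <= t <= 1 -> analytic_at G (t%:C * w)) ->
  (exists d : R, 0 < d /\ forall t : R, 0 <= t <= 1 -> t < d -> G (t%:C * w) = 0) ->
  G w = 0.
Proof.
move=> aG [d [d0 hd]].
have [w0|w0] := eqVneq w 0.
  by have := hd 0; rewrite w0 mulr0; apply; rewrite ?lexx ?ler01.
pose T := [set t : R | 0 <= t <= 1 /\ forall s, 0 <= s <= t -> G (s%:C * w) = 0].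
have T0 : T 0.
  split; first by rewrite lexx ler01.
  by move=> s /andP[s0 s1]; apply: hd; rewrite ?s0/=; lra.
have hT : has_sup T by split; [exists 0|exists 1 => t [/andP[]]].
pose t0 := sup T.
have supT t : T t -> t <= t0 by move: t; exact: ub_le_sup hT.2.
have t01 : 0 <= t0 <= 1.
  apply/andP; split; first exact: supT T0.
  by apply: ge_sup; [exists 0|move=> t [/andP[]]].
have below s : 0 <= s < t0 -> G (s%:C * w) = 0.
  move=> /andP[s0 st]; have e0 : 0 < t0 - s by rewrite subr_gt0.
  have [t [Tt1 Tt2] tt] := sup_adherent e0 hT.
  by apply: Tt2; rewrite s0/=; rewrite /t0 in tt; lra.
have t0p : 0 < t0.
  apply: (@lt_le_trans _ _ (Num.min (d / 2) 1)); first by rewrite lt_min divr_gt0//= ltr01.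
  apply: supT; split; first by rewrite ge_min lexx orbT le_min ler01 divr_ge0// ltW.
  move=> s /andP[s0]; rewrite le_min => /andP[s1 s2]; apply: hd; rewrite ?s0//; lra.
have /analyticP[a [r [r0 sa hG]]] := aG t0 t01.
have wp : 0 < cabs w by rewrite lt_neqAle eq_sym cabs_eq0 w0 cabs_ge0.
have a0 : forall n, a n = 0.
  (* The known zeros are the points (t0 - e) w below t0, hence the direction - w. *)
  apply: (@pser_eq0 a r (- w)) => //; first by rewrite oppr_eq0.
  exists (Num.min t0 (r / cabs w)); split; first by rewrite lt_min t0p divr_gt0.
  move=> e /andP[e0]; rewrite lt_min => /andP[et er].
  rewrite -hG.
    rewrite (_ : _ + _ = (t0 - e)%:C * w); last by rewrite rmorphB /=; ring.
    by apply: below; lra.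
  by rewrite cabsM cabsN cabsr gtr0_norm// -ler_pdivlMr// ltW.
have near s : `|s - t0| <= r / cabs w -> G (s%:C * w) = 0.
  move=> hs; rewrite (_ : _ * _ = t0%:C * w + (s - t0)%:C * w); last by rewrite rmorphB /=; ring.
  rewrite hG; last by rewrite cabsM cabsr -ler_pdivlMr.
  by rewrite /pser -[RHS](@csum0 R nat); congr csum; apply/funext => n; rewrite a0 mul0r.
pose t1 := Num.min 1 (t0 + r / cabs w).
have rw0 : 0 < r / cabs w by rewrite divr_gt0.
have Tt1 : T t1.
  split; first by rewrite ge_min lexx le_min ler01/=; lra.
  move=> s /andP[s0]; rewrite le_min => /andP[s1 s2].
  have [st|st] := ltP s t0; first by apply: below; rewrite s0.
  by apply: near; rewrite ger0_norm; lra.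
have : t1 <= t0 by exact: supT Tt1.
rewrite ge_min => /orP[h|h]; last by exfalso; lra.
have t1e : t0 = 1 by lra.
have := near 1; rewrite t1e subrr normr0 mul1r; apply; exact: ltW.
Qed.

End Analytic.

(** * A ratio test for hypergeometric coefficients *)

Section Ratio.
Variable R : realType.
Local Notation C := R[i].

Lemma summ_ratio (u : nat -> R) (q : R) (K : nat) : (forall n, 0 <= u n) ->
  0 < q < 1 -> (forall n, (K <= n)%N -> u n.+1 <= q * u n) -> summ u.
Proof.
move=> u0 /andP[q0 q1] hu.
pose M := \sum_(j < K.+1) u j / q ^+ j.
have M0 : 0 <= M by apply: sumr_ge0 => i _; rewrite divr_ge0 ?exprn_ge0 ?(ltW q0).
have uM n : u n <= M * q ^+ n.
  have [nK|nK] := leqP n K.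
    rewrite -ler_pdivrMr ?exprn_gt0//.
    rewrite /M (bigD1 (Ordinal (nK : (n < K.+1)%N)))//= lerDl.
    by apply: sumr_ge0 => i _; rewrite divr_ge0 ?exprn_ge0 ?(ltW q0).
  elim: n nK => // n IH; rewrite ltnS leq_eqVlt => /predU1P[Kn|Kn].
    rewrite exprS mulrCA (le_trans (hu n _)) ?Kn// ler_wpM2l ?(ltW q0)//.
    rewrite -ler_pdivrMr ?exprn_gt0// -Kn.
    rewrite /M (bigD1 ord_max)//= lerDl.
    by apply: sumr_ge0 => i _; rewrite divr_ge0 ?exprn_ge0 ?(ltW q0).
  rewrite exprS mulrCA (le_trans (hu n (ltnW Kn)))// ler_wpM2l ?(ltW q0)//.
  exact: IH.
have hq : 0 <= q < 1 by rewrite (ltW q0).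
apply: le_summ (summZ M (summ_geometric hq)) => n.
by rewrite !ger0_norm// mulr_ge0// exprn_ge0// ltW.
Qed.

(** Quantitative form of the fact that (x + A) (x + D) / ((x + 1) (n + x)) tends to 1: times r, it
    falls below (1 + r) / 2, a number between r and 1, once x passes an explicit threshold. *)
Lemma ratio_ineq (A D n n' x r : R) : 0 <= A -> 0 <= D -> 0 < r -> r < 1 ->
  - n' <= n -> 0 <= n' -> 1 <= x -> (1 + 2 * n' + A + D + A * D) * 2 <= (1 - r) * x ->
  r * ((x + A) * (x + D)) <= (1 + r) / 2 * ((x + 1) * (n + x)).
Proof.
move=> A0 D0 rp r1 NN N0 kR k2; have r0 := ltW rp.
have h1 : (1 + 2 * n' + A + D + A * D) * 2 * x <= (1 - r) * x * x by rewrite ler_wpM2r//; lra.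
have h2 : r * A <= A by rewrite ler_piMl// ltW.
have h3 : r * D <= D by rewrite ler_piMl// ltW.
have AD0 := mulr_ge0 A0 D0.
have h4 : r * (A * D) <= A * D by rewrite ler_piMl// ltW.
have h5 : A * D <= A * D * x by rewrite ler_peMr.
have h6 : r * A * x <= A * x by rewrite ler_wpM2r//; lra.
have h7 : r * D * x <= D * x by rewrite ler_wpM2r//; lra.
have h8 : (1 + r) / 2 * (x + 1) * n >= - (2 * n' * x).
  have : (1 + r) / 2 * (x + 1) * - n' <= (1 + r) / 2 * (x + 1) * n.
    by rewrite ler_wpM2l// mulr_ge0; lra.
  have : (1 + r) / 2 * (x + 1) * n' <= 2 * x * n'.
    rewrite ler_wpM2r//; nra.
  lra.
have h9 : 0 <= (1 + r) / 2 * x by rewrite mulr_ge0; lra.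
have : 0 <= n' * x by rewrite mulr_ge0; lra.
have : 0 <= A * x by rewrite mulr_ge0; lra.
have : 0 <= D * x by rewrite mulr_ge0; lra.
move: h1 h4 h5 h6 h7 h8 h9.
rewrite !mulrDr !mulrDl !mulrDr.
lra.
Qed.

(** The recurrence is kept multiplied out because N + k may vanish for finitely many k; only the
    indices k > |N| enter the ratio test. *)
Lemma hyp_psr (f : nat -> C) (A D : R) (N : int) (r : R) :
  0 <= A -> 0 <= D ->
  (forall k, cabs (f k.+1) * k.+1%:R * `|(N + k%:Z)%:~R| <=
     (k%:R + A) * (k%:R + D) * cabs (f k)) ->
  0 <= r < 1 -> psr f r.
Proof.
move=> A0 D0 hf /andP[r0 r1].
wlog rp : r r0 r1 / 0 < r.
  move=> H; apply: (@psr_le _ _ _ ((r + 1) / 2)); first lra.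
  by apply: H; lra.
pose B : R := 1 + 2 * `|N%:~R| + A + D + A * D.
(* Beyond K both the threshold of [ratio_ineq] and the positivity of N + k hold. *)
pose K := (Num.truncn (B * 2 / (1 - r) + `|N%:~R|)).+1.
have B1 : 1 <= B.
  rewrite /B; have := mulr_ge0 A0 D0; have := normr_ge0 (N%:~R : R).
  by move: A0 D0; move: (A * D) => AD; lra.
apply: (@summ_ratio _ ((1 + r) / 2) K); first by move=> n; rewrite mulr_ge0 ?cabs_ge0 ?exprn_ge0.
  lra.
move=> k kK.
have k1 : B * 2 / (1 - r) + `|N%:~R| < k%:R :> R.
  apply: (lt_le_trans (truncnS_gt _)); rewrite ler_nat//.
have N0 := normr_ge0 (N%:~R : R).
have q0 : 0 < B * 2 / (1 - r) by rewrite divr_gt0//; lra.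
have k2 : B * 2 <= (1 - r) * k%:R.
  rewrite [leRHS]mulrC -ler_pdivrMr ?subr_gt0//; apply: ltW; apply: le_lt_trans k1.
  by rewrite lerDl.
set Q := B * 2 / (1 - r) in k1 q0.
have k3 : `|N%:~R| <= k%:R :> R by lra.
have eN : `|(N + k%:Z)%:~R| = N%:~R + k%:R :> R.
  rewrite intrD ger0_norm//.
  have : - N%:~R <= `|N%:~R| :> R by rewrite -normrN ler_norm.
  rewrite -pmulrn; lra.
have := hf k; rewrite eN => H.
have kR : 1 <= k%:R :> R by move: q0 k2 B1 r1 rp; nra.
have Np : 0 < N%:~R + k%:R :> R.
  have : - N%:~R <= `|N%:~R| :> R by rewrite -normrN ler_norm.
  lra.
have pos : 0 < k.+1%:R * (N%:~R + k%:R) :> R by rewrite mulr_gt0.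
rewrite exprS !mulrA ler_wpM2r ?exprn_ge0//.
rewrite -(ler_pM2r pos).
rewrite (_ : cabs (f k.+1) * r * _ = r * (cabs (f k.+1) * k.+1%:R * (N%:~R + k%:R))); last by ring.
apply: (le_trans (ler_wpM2l r0 H)).
rewrite (_ : r * _ = (r * ((k%:R + A) * (k%:R + D))) * cabs (f k)); last by ring.
rewrite [leRHS](_ : _ = ((1 + r) / 2 * (k.+1%:R * (N%:~R + k%:R))) * cabs (f k)); last by ring.
rewrite ler_wpM2r ?cabs_ge0//.
have NN : - `|N%:~R| <= N%:~R :> R by rewrite lerNl -normrN ler_norm.
rewrite -(natr1 k); apply: (@ratio_ineq A D _ `|N%:~R|) => //.
Qed.

End Ratio.

(** * Pochhammer symbols and the binomial series *)

Section Poch.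
Variable R : realType.
Local Notation C := R[i].
Implicit Types (a b d : C).

Lemma poch0 a : pochhammer a 0 = 1. Proof. by rewrite /pochhammer big_ord0. Qed.

Lemma pochS a k : pochhammer a k.+1 = pochhammer a k * (a + k%:R).
Proof. by rewrite /pochhammer big_ord_recr. Qed.

Lemma pochSl a k : pochhammer a k.+1 = a * pochhammer (a + 1) k.
Proof.
rewrite /pochhammer big_ord_recl addr0; congr (_ * _); apply: eq_bigr => i _.
by rewrite -addrA lift0 -natr1 [1 + _]addrC.
Qed.

Lemma pochD a k n : pochhammer a (k + n) = pochhammer a k * pochhammer (a + k%:R) n.
Proof.
elim: n => [|n IH]; first by rewrite addn0 poch0 mulr1.
by rewrite addnS !pochS IH natrD mulrA addrA.
Qed.

(* Taylor coefficients of (1 - z) ^ (- a) at 0. *)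
Definition bc a (k : nat) : C := pochhammer a k / k`!%:R.

Lemma fact_neq0 k : k`!%:R != 0 :> C.
Proof. by rewrite pnatr_eq0 -lt0n fact_gt0. Qed.

Lemma natr1_neq0 k : k.+1%:R != 0 :> C. Proof. by rewrite pnatr_eq0. Qed.

Lemma bcS a k : k.+1%:R * bc a k.+1 = (a + k%:R) * bc a k.
Proof.
rewrite /bc pochS factS natrM; field.
by rewrite fact_neq0 [1 + _]addrC natr1 natr1_neq0.
Qed.

Lemma bc0 : bc 0 = @one_seq R.
Proof.
apply/funext => -[|n]; first by rewrite /bc poch0 fact0 divr1.
by rewrite /bc pochSl mul0r mul0r.
Qed.

Lemma bc_psr a r : 0 <= r < 1 -> psr (bc a) r.
Proof.
apply: (@hyp_psr _ _ (cabs a) 1 1) => //; [exact: cabs_ge0|move=> k].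
have -> : `|(1 + k%:Z)%:~R| = k.+1%:R :> R.
  by rewrite intrD -pmulrn ger0_norm ?addr_ge0// -natr1 addrC.
rewrite natr1 -mulrA mulrA -(@cabs_nat R k.+1) -cabsM [bc a k.+1 * _]mulrC bcS.
rewrite cabsM cabs_nat [leRHS]mulrAC ler_wpM2r// ler_wpM2r ?cabs_ge0//.
by rewrite addrC -(@cabs_nat R k) cabsD.
Qed.

(* Chu-Vandermonde: (1 - z) ^ (- a) * (1 - z) ^ (- b) = (1 - z) ^ (- (a + b)). *)
Lemma conv_bc a b : conv (bc a) (bc b) = bc (a + b).
Proof.
apply/funext => n; elim: n => [|n IH].
  by rewrite /conv big_ord1 /bc !poch0 fact0 !divr1 mulr1.
apply: (mulfI (natr1_neq0 n)); rewrite bcS -IH /conv.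
rewrite mulr_sumr (eq_bigr (fun k : 'I_n.+2 => k%:R * bc a k * bc b (n.+1 - k)%N +
   bc a k * ((n.+1 - k)%N%:R * bc b (n.+1 - k)%N))); last first.
  move=> k _; have hk : (k <= n.+1)%N by rewrite -ltnS.
  have -> : n.+1%:R = k%:R + (n.+1 - k)%N%:R :> C by rewrite -natrD subnKC.
  by move: (n.+1 - k)%N => l; ring.
rewrite big_split/= big_ord_recl/= !mul0r add0r.
rewrite [X in _ + X]big_ord_recr/= subnn !mul0r mulr0 addr0.
rewrite mulr_sumr -big_split/=; apply: eq_bigr => i _.
have hi : (i <= n)%N by rewrite -ltnS.
rewrite bcS subSS subSn// bcS.
have -> : n%:R = i%:R + (n - i)%N%:R :> C by rewrite -natrD subnKC.
by move: (n - i)%N => l; ring.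
Qed.

Lemma pser_bcD a b (z : C) : cabs z < 1 -> pser (bc a) z * pser (bc b) z = pser (bc (a + b)) z.
Proof.
move=> z1; rewrite -(pser_conv (r := cabs z))// ?conv_bc//;
  by apply: bc_psr; rewrite cabs_ge0.
Qed.

End Poch.

(** * Pfaff's transformation *)

Section Pfaff.
Variable R : realType.
Local Notation C := R[i].
Variable rho : int -> C.
Hypothesis rhoE : forall j, rho j = j%:~R * rho (j + 1).
Hypothesis rho1 : rho 1 = 1.
Implicit Types (a b d z h : C) (N : int).

(** Coefficients of 2F1(a, d; N; z) / Gamma(N), with [rho] standing for 1 / Gamma on the integers.
    Only the functional equation and the value at 1 are assumed, so nonpositive N need no separate
    treatment. *)
Definition hypc a d N (k : nat) : C :=
  pochhammer a k * pochhammer d k * rho (N + k%:Z) / k`!%:R.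

Lemma hypcS a d N k :
  k.+1%:R * (N + k%:Z)%:~R * hypc a d N k.+1 = (a + k%:R) * (d + k%:R) * hypc a d N k.
Proof.
rewrite /hypc !pochS factS natrM (rhoE (N + k%:Z)) -addrA.
rewrite (_ : k%:Z + 1 = k.+1%:Z); last by lia.
move: (rho _) => t; field.
by rewrite fact_neq0 [1 + _]addrC natr1 natr1_neq0.
Qed.

Lemma hypc_psr a d N r : 0 <= r < 1 -> psr (hypc a d N) r.
Proof.
apply: (@hyp_psr _ _ (cabs a) (cabs d) N); try exact: cabs_ge0.
move=> k.
have -> : cabs (hypc a d N k.+1) * k.+1%:R * `|(N + k%:Z)%:~R| =
    cabs (k.+1%:R * (N + k%:Z)%:~R * hypc a d N k.+1).
  rewrite !cabsM cabs_nat -(rmorph_int (real_complex R)) cabsr; ring.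
rewrite hypcS; move: (hypc a d N k) => y.
rewrite !cabsM ler_wpM2r ?cabs_ge0// ler_pM ?cabs_ge0//.
  by rewrite addrC -(@cabs_nat R k) cabsD.
by rewrite addrC -(@cabs_nat R k) cabsD.
Qed.

(** The Chu-Vandermonde sum for 2F1(-n, d; N; 1), multiplied by 1 / Gamma(N) so as to hold at every
    integer N. *)
Lemma chu_vandermonde n d N :
  \sum_(k < n.+1) (-1) ^+ k * 'C(n, k)%:R * pochhammer d k * rho (N + k%:Z) =
  pochhammer (N%:~R - d) n * rho (N + n%:Z).
Proof.
elim: n d N => [|n IH] d N.
  by rewrite big_ord1 /= bin0 !poch0 !mulr1.
rewrite big_ord_recl/= bin0 poch0 expr0 !mul1r addr0.
(* Pascal's rule splits the sum into the one for (n, d, N) and - d times the one for (n, d + 1, N +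
   1); both have the same difference N - d. *)
transitivity ((rho N + \sum_(i < n.+1) (-1) ^+ i.+1 * 'C(n, i.+1)%:R * pochhammer d i.+1 * rho (N + i.+1%:Z)) -
   d * \sum_(i < n.+1) (-1) ^+ i * 'C(n, i)%:R * pochhammer (d + 1) i * rho (N + 1 + i%:Z)).
  rewrite -addrA; congr (_ + _); rewrite mulr_sumr -sumrB; apply: eq_bigr => i _.
  rewrite /bump/= !add1n binS natrD pochSl.
  rewrite (_ : N + 1 + i%:Z = N + i.+1%:Z); last by lia.
  by move: (rho _) ('C(n, i.+1))%:R ('C(n, i))%:R => t u v; rewrite exprS; ring.
have -> : rho N + \sum_(i < n.+1) (-1) ^+ i.+1 * 'C(n, i.+1)%:R * pochhammer d i.+1 * rho (N + i.+1%:Z) =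
   \sum_(k < n.+1) (-1) ^+ k * 'C(n, k)%:R * pochhammer d k * rho (N + k%:Z).
  rewrite big_ord_recr/= bin_small// !(mulr0, mul0r) addr0 [RHS]big_ord_recl/=.
  by rewrite bin0 poch0 expr0 !mul1r addr0.
rewrite !IH pochS (rhoE (N + n%:Z)).
rewrite (_ : N + 1 + n%:Z = N + n.+1%:Z); last by lia.
rewrite (_ : N + n%:Z + 1 = N + n.+1%:Z); last by lia.
rewrite (_ : (N + 1)%:~R - (d + 1) = N%:~R - d); last by rewrite intrD; ring.
rewrite intrD -pmulrn; ring.
Qed.

Lemma binE n k : (k <= n)%N -> 'C(n, k)%:R = n`!%:R / (k`!%:R * (n - k)`!%:R) :> C.
Proof.
move=> kn; rewrite -(bin_fact kn) !natrM mulfK// mulf_neq0 ?fact_neq0//.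
Qed.

Lemma rho0 : rho 0 = 0. Proof. by rewrite rhoE mul0r. Qed.

Lemma rhoS n : rho n.+1%:Z = (n`!%:R)^-1.
Proof.
elim: n => [|n IH]; first by rewrite rho1 fact0 invr1.
have := rhoE n.+1%:Z; rewrite IH (_ : n.+1%:Z + 1 = n.+2%:Z); last by lia.
move=> E; apply: (mulfI (natr1_neq0 R n)); rewrite factS natrM.
rewrite -pmulrn in E; rewrite -E; field.
by rewrite fact_neq0 [1 + _]addrC natr1 natr1_neq0.
Qed.

(* Taylor coefficients of z / (z - 1) at 0. *)
Definition mob0 (n : nat) : C := if n is 0%N then 0 else -1.

(** This expresses (z / (z - 1))^k (1 - z)^(-A) = (-1)^k z^k (1 - z)^(-(A + k)). For fixed n only k
    <= n contribute, so the composed coefficients below are finite sums. *)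
Lemma iter_conv_mob0 A k n : iter k (conv mob0) (bc A) n =
  if (k <= n)%N then (-1) ^+ k * bc (A + k%:R) (n - k) else 0.
Proof.
elim: k n => [|k IH] n /=; first by rewrite subn0 mul1r addr0.
pose B k n : C := if (k <= n)%N then bc (A + k%:R) (n - k) else 0.
have BS m : B k.+1 m.+1 = B k.+1 m + B k m.
  rewrite /B ltnS; have [km|km] := leqP k m; last first.
    by rewrite ltnNge (ltnW km) addr0.
  move: km; rewrite leq_eqVlt => /predU1P[<-|km].
    by rewrite ltnn !subnn add0r /bc !poch0.
  rewrite km subSS; have -> : (m - k = (m - k.+1).+1)%N by lia.
  move: (m - k.+1)%N => j; rewrite /bc (pochS (A + k.+1%:R)) (pochSl (A + k%:R)) factS natrM -(natr1 k).
  rewrite addrA; move: (pochhammer _ j) => p; field.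
  by rewrite fact_neq0 [1 + _]addrC natr1 natr1_neq0.
have Bsum m : \sum_(i < m) B k i = B k.+1 m.
  elim: m => [|m IHm]; first by rewrite big_ord0.
  by rewrite big_ord_recr/= IHm BS.
have -> : (if (k < n)%N then (-1) ^+ k.+1 * bc (A + k.+1%:R) (n - k.+1) else 0) =
   (-1) ^+ k.+1 * B k.+1 n by rewrite /B; case: ifP; rewrite ?mulr0.
have convE f : conv mob0 f n = \sum_(i < n) - f (n - i.+1)%N.
  rewrite /conv big_ord_recl /= mul0r add0r; apply: eq_bigr => i _.
  by rewrite /bump/= add1n mulN1r.
rewrite -Bsum convE mulr_sumr (reindex_inj rev_ord_inj)/=; apply: eq_bigr => i _.
have hi := ltn_ord i.
rewrite IH (_ : (n - (n - i.+1).+1 = i)%N); last by lia.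
by rewrite /B; case: ifP => _; rewrite ?mulr0 ?oppr0// exprS !mulNr !mul1r.
Qed.

Lemma mob0_norm r : 0 <= r < 1 -> psr mob0 r /\ nrm mob0 r = r / (1 - r).
Proof.
move=> hr; have [r0 r1] := andP hr.
have sg := summZ r (summ_geometric hr).
have E n : cabs (mob0 n) * r ^+ n = if n is m.+1 then r * r ^+ m else 0.
  by case: n => [|n] /=; rewrite ?cabs0 ?mul0r// cabsN cabs1 mul1r exprS.
have s : psr mob0 r.
  apply: (@summ_supp _ _ _ succn) succn_inj _ _ => [[|n] h|].
  - by rewrite cabs0 mul0r.
  - by exfalso; apply: h; exists n.
  - by apply: le_summ sg => n; rewrite E.
split => //; rewrite /nrm.
have c : csumm (fun n => (cabs (mob0 n) * r ^+ n)%:C : C).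
  by apply: le_csumm s => n; rewrite cabsr ger0_norm// mulr_ge0 ?cabs_ge0 ?exprn_ge0.
apply/complexI; rewrite -rsum_psum; last by move=> n; rewrite mulr_ge0 ?cabs_ge0 ?exprn_ge0.
rewrite -csum_real csum_recl//= cabs0 mul0r add0r.
rewrite (_ : (fun n => _) = fun n => (r * r ^+ n)%:C); last first.
  by apply/funext => n; rewrite cabsN cabs1 mul1r exprS.
rewrite csum_real rsum_psum; last by move=> n; rewrite mulr_ge0 ?exprn_ge0.
by rewrite psumZ ?psum_geometric// => n; rewrite exprn_ge0.
Qed.

Lemma bc1 n : bc (1 : C) n = 1.
Proof.
rewrite /bc; elim: n => [|n IH]; first by rewrite poch0 fact0 divr1.
rewrite pochS factS natrM [1 + _]addrC natr1 [n.+1%:R * _]mulrC -mulf_div IH mul1r.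
by rewrite divff ?natr1_neq0.
Qed.

Lemma sub1_neq0 z : cabs z < 1 -> 1 - z != 0.
Proof.
by move=> z1; rewrite subr_eq0; apply/eqP => E; move: z1; rewrite -E cabs1 ltxx.
Qed.

Lemma pser_bc1 z : cabs z < 1 -> pser (bc 1) z = (1 - z)^-1.
Proof.
move=> z1; have := pser_bcD (-1 : C) 1 z1; rewrite addNr bc0 pser_one.
have -> : pser (bc (-1)) z = 1 - z.
  rewrite /pser (@csum_fin _ _ 2%N).
    rewrite big_ord_recl big_ord1 /bc /= poch0 pochSl poch0 fact0 factS fact0.
    by rewrite muln1 !invr1 expr0 !mulr1 mulN1r.
  move=> [|[|k]] // _; rewrite /bc !pochSl.
  by rewrite addNr mul0r mulr0 mul0r mul0r.
by move=> E; apply: (mulfI (sub1_neq0 z1)); rewrite E mulfV// sub1_neq0.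
Qed.

Lemma pser_mob0 z : cabs z < 1 -> pser mob0 z = z / (z - 1).
Proof.
move=> z1; have hr : 0 <= cabs z < 1 by rewrite cabs_ge0.
have [s _] := mob0_norm hr.
have z10 := sub1_neq0 z1.
have sb := bc_psr (1 : C) hr.
have -> : mob0 = fun n => one_seq R n - bc 1 n.
  by apply/funext => -[|n]; rewrite bc1 /one_seq /= ?subrr ?sub0r.
rewrite (pserB (r := cabs z))// ?pser_one ?pser_bc1//.
- by field; rewrite z10 -opprB oppr_eq0 z10.
- exact/psr_one/cabs_ge0.
Qed.

(** Both sides are (1 - z)^(-a), since 1 - z / (z - 1) = (1 - z)^(-1). On coefficients this is
    Chu-Vandermonde at N = 0. *)
Lemma euler_bc a z : cabs z <= 1 / 4 ->
  pser (bc (- a)) (z / (z - 1)) = pser (bc a) z.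
Proof.
move=> zr; have z1 : cabs z < 1 by apply: le_lt_trans zr _; lra.
have hr : 0 <= (1 / 4 : R) < 1 by lra.
have [s n1] := mob0_norm hr.
(* The norm of z / (z - 1) at radius r is r / (1 - r), below 1 exactly for r < 1/2; the radius 1/4
   gives 1/3. *)
have hq : 0 <= nrm mob0 (1 / 4) < 1.
  rewrite n1 (_ : 1 / 4 / (1 - 1 / 4) = 1 / 3 :> R); last by field.
  lra.
have r0 : 0 <= 1 / 4 :> R by lra.
have [_ /(_ z zr)] := pser_comp r0 s (bc_psr (0 : C) hr) (bc_psr (- a) hq).
have B0 : pser (bc (0 : C)) z = 1 by rewrite (@bc0 R) pser_one.
rewrite B0 mul1r (pser_mob0 z1) => <-; congr (pser _ z).
apply/funext => -[|n].
  rewrite /comp_coef (@csum_fin _ _ 1%N) ?big_ord1 /=.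
    by rewrite /bc !poch0 fact0 divr1 mulr1.
  by move=> k k0; rewrite iter_conv_mob0 leqNgt k0 mulr0.
rewrite /comp_coef (@csum_fin _ _ n.+2); last first.
  by move=> k k0; rewrite iter_conv_mob0 leqNgt k0 mulr0.
have := chu_vandermonde n.+1 (- a) 0.
rewrite opprK !add0r rhoS.
rewrite (_ : pochhammer a n.+1 / n`!%:R = n.+1%:R * bc a n.+1); last first.
  rewrite /bc factS natrM; field.
  by rewrite fact_neq0 [1 + _]addrC natr1 natr1_neq0.
move=> E; apply: (mulfI (natr1_neq0 R n)); rewrite -{}E mulr_sumr.
apply: eq_bigr => k _; rewrite add0r iter_conv_mob0.
have kn : (k <= n.+1)%N by rewrite -ltnS.
rewrite kn add0r /bc.
case: k kn => -[|k] /= _ kn.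
  rewrite rho0 mulr0 subn0 pochSl mul0r mul0r !mulr0//.
rewrite rhoS subSS.
have P : pochhammer k.+1%:R (n - k) = n`!%:R / k`!%:R :> C.
  have kn' : (k <= n)%N by rewrite -ltnS.
  rewrite -(subnKC kn') addKn; elim: (n - k)%N => [|j IH].
    by rewrite poch0 addn0 divff// fact_neq0.
  by rewrite pochS IH addnS factS natrM -natrD addSn [LHS]mulrC mulrA.
rewrite P binE// subSS !factS !natrM; field.
by rewrite !fact_neq0 ![1 + _]addrC natr1 !natr1_neq0.
Qed.

(* Near 0, the substitution [z / (z - 1)] turns one series into the other. *)
Lemma pfaff_near0 a b N z : cabs z <= 1 / 4 ->
  pser (hypc a b N) z =
  pser (conv (bc (- a)) (hypc a (N%:~R - b) N)) (z / (z - 1)).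
Proof.
move=> zr; have z1 : cabs z < 1 by apply: le_lt_trans zr _; lra.
have hr : 0 <= (1 / 4 : R) < 1 by lra.
have [s n1] := mob0_norm hr.
have hq : 0 <= nrm mob0 (1 / 4) < 1.
  rewrite n1 (_ : 1 / 4 / (1 - 1 / 4) = 1 / 3 :> R); last by field.
  lra.
have r0 : 0 <= 1 / 4 :> R by lra.
have zq : cabs (z / (z - 1)) <= nrm mob0 (1 / 4).
  by rewrite -(pser_mob0 z1); exact: cabs_pser.
rewrite (pser_conv zq); [|exact: bc_psr|exact: hypc_psr].
rewrite euler_bc//.
have [_ /(_ z zr)] := pser_comp r0 s (bc_psr a hr) (hypc_psr a (N%:~R - b) N hq).
rewrite (pser_mob0 z1) => <-; congr (pser _ z).
apply/funext => n; rewrite /comp_coef (@csum_fin _ _ n.+1); last first.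
  by move=> k k0; rewrite iter_conv_mob0 leqNgt k0 mulr0.
(* With d = N - b the right-hand side is (b)_n / Gamma(N + n), the factor missing from the
   coefficient of index n. *)
have := chu_vandermonde n (N%:~R - b) N; rewrite opprB addrCA subrr addr0 => E.
transitivity (pochhammer a n / n`!%:R * (pochhammer b n * rho (N + n%:Z))).
  by rewrite /hypc; ring.
rewrite -E mulr_sumr; apply: eq_bigr => k _.
have kn : (k <= n)%N by rewrite -ltnS.
rewrite iter_conv_mob0 kn /hypc binE//.
have -> : pochhammer a n = pochhammer a k * pochhammer (a + k%:R) (n - k).
  by rewrite -pochD subnKC.
rewrite /bc; move: (pochhammer a k) (pochhammer _ (n - k)) (pochhammer _ k) (rho _) ((-1) ^+ k) => p q s' t e.
by field; rewrite !fact_neq0.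
Qed.

(* The hypergeometric series in z / (z - 1), of modulus < 1 on the half plane
   Re z < 1 / 2: this gives the analytic continuation to that half plane. *)
Definition pfaff a b N (z : C) : C :=
  pser (conv (bc (- a)) (hypc a (N%:~R - b) N)) (z / (z - 1)).

Lemma pfaff_psr a b N r : 0 <= r < 1 ->
  psr (conv (bc (- a)) (hypc a (N%:~R - b) N)) r.
Proof.
move=> hr; have [r0 _] := andP hr.
by have [] := conv_psr r0 (bc_psr (- a) hr) (hypc_psr a (N%:~R - b) N hr).
Qed.

(* Taylor coefficients of the identity at z, used to recenter a power series. *)
Definition rec_seq (z : C) (n : nat) : C :=
  if n is m.+1 then (if m is 0%N then 1 else 0) else z.

Lemma pser_rec_seq z h : pser (rec_seq z) h = z + h.
Proof.
rewrite /pser (@csum_fin _ _ 2%N); last by move=> [|[|k]] // _; rewrite mul0r.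
by rewrite big_ord_recl big_ord1 /= mul1r expr0 mulr1 expr1.
Qed.

Lemma rec_seq_norm z r : 0 <= r -> psr (rec_seq z) r /\ nrm (rec_seq z) r = cabs z + r.
Proof.
move=> r0.
have cf : forall k, (2 <= k)%N -> (cabs (rec_seq z k) * r ^+ k)%:C = 0 :> C.
  by move=> [|[|k]] // _; rewrite /= cabs0 mul0r.
have s : psr (rec_seq z) r.
  have : csumm (fun k => (cabs (rec_seq z k) * r ^+ k)%:C : C).
    by apply: (csumm_fin (s := iota 0 2)) => k; rewrite mem_iota/= add0n -leqNgt => /cf.
  by apply: le_summ => k; rewrite cabsr normr_id.
split => //; apply/complexI; rewrite /nrm -rsum_psum; last by move=> n; rewrite mulr_ge0 ?cabs_ge0 ?exprn_ge0.
rewrite -csum_real (csum_fin cf) big_ord_recl big_ord1 /= cabs1 mul1r expr0 mulr1 expr1.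
by rewrite rmorphD.
Qed.

(** Recentering at z is composition with z + h, of norm |z| + r; r is half the distance to the unit
    circle. *)
Lemma pser_analytic (c : nat -> C) z : (forall r, 0 <= r < 1 -> psr c r) ->
  cabs z < 1 -> analytic_at (pser c) z.
Proof.
move=> hc z1; pose r : R := (1 - cabs z) / 2.
have z0 := cabs_ge0 z.
have r0 : 0 <= r by rewrite /r; lra.
have [s n1] := rec_seq_norm z r0.
have hq : 0 <= nrm (rec_seq z) r < 1 by rewrite n1 /r; lra.
have [s' E] := pser_comp r0 s (@psr_one R r r0) (hc _ hq).
apply/analyticP; exists (comp_coef c (rec_seq z) (one_seq R)), r; split => //.
  by rewrite /r; lra.
by move=> h hr; rewrite (E h hr) pser_one mul1r pser_rec_seq.
Qed.

(* Taylor coefficients of w / (w - 1) at w = z. *)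
Definition mob (z : C) (n : nat) : C :=
  (if n is 0%N then 1 else 0) - (1 - z)^-1 ^+ n.+1.

Lemma mob_norm z : cabs z < cabs (1 - z) ->
  exists r : R, [/\ 0 < r, psr (mob z) r, nrm (mob z) r < 1 &
   forall h, cabs h <= r -> pser (mob z) h = (z + h) / (z + h - 1)].
Proof.
set d := 1 - z => hz; have z0 := cabs_ge0 z.
have d0 : 0 < cabs d by apply: le_lt_trans hz.
have dn0 : d != 0 by rewrite -cabs_eq0 gt_eqF.
(* The norm at radius r is (|z| + r / (|d| - r)) / |d|. The first bound gives |d| - r >= |d| / 2,
   the second then makes r / (|d| - r) smaller than |d| - |z|. *)
pose r : R := Num.min (cabs d / 2) (cabs d * (cabs d - cabs z) / 4).
have rp : 0 < r by rewrite /r lt_min !divr_gt0// mulr_gt0// subr_gt0.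
have rd : r <= cabs d / 2 by rewrite /r ge_min lexx.
have rd2 : r <= cabs d * (cabs d - cabs z) / 4 by rewrite /r ge_min lexx orbT.
pose q := r / cabs d.
have hq : 0 <= q < 1 by rewrite /q divr_ge0 ?(ltW rp) ?(ltW d0)//= ltr_pdivrMr// mul1r; lra.
have sg := summZ (cabs d)^-1 (summ_geometric hq).
have E n : cabs (mob z n.+1) * r ^+ n.+1 = (cabs d)^-1 * q * q ^+ n.
  rewrite /mob /= sub0r cabsN cabsX cabsV exprS -mulrA -exprMn.
  by rewrite [_^-1 * r]mulrC -/q exprS mulrA.
have m0 : mob z 0 = - z / d.
  by rewrite /mob /= expr1; apply: (mulIf dn0); rewrite mulrBl mulVf// mulfVK// mul1r /d; ring.
have s : psr (mob z) r.
  apply: (@summ_ratio _ _ ((q + 1) / 2) 1) => [n||n].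
  - by rewrite mulr_ge0 ?cabs_ge0 ?exprn_ge0 ?(ltW rp).
  - by lra.
  - case: n => // n _; rewrite !E exprS mulrCA ler_wpM2r; [|rewrite mulr_ge0 ?mulr_ge0 ?invr_ge0 ?exprn_ge0 ?cabs_ge0//; lra|lra]; last by lra.
exists r; split => //.
  rewrite /nrm.
  have c : csumm (fun n => (cabs (mob z n) * r ^+ n)%:C : C).
    by apply: le_csumm s => n; rewrite cabsr ger0_norm// mulr_ge0 ?cabs_ge0 ?exprn_ge0// ltW.
  have -> : psum (fun n => cabs (mob z n) * r ^+ n) = cabs z / cabs d + (cabs d)^-1 * q / (1 - q).
    apply/complexI; rewrite -rsum_psum; last by move=> n; rewrite mulr_ge0 ?cabs_ge0 ?exprn_ge0// ltW.
    rewrite -csum_real csum_recl// m0 expr0 mulr1 cabsM cabsN cabsV [RHS]rmorphD /=; congr (_ + _).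
    rewrite (_ : (fun n => _) = fun n => ((cabs d)^-1 * q * q ^+ n)%:C); last first.
      by apply/funext => n; rewrite E.
    have p0 : 0 <= (cabs d)^-1 * q by rewrite mulr_ge0 ?invr_ge0//; lra.
    rewrite csum_real rsum_psum; last by move=> n; rewrite mulr_ge0 ?exprn_ge0//; lra.
    by rewrite psumZ// ?psum_geometric// => n; rewrite exprn_ge0//; lra.
  have dr : 0 < cabs d - r by lra.
  have -> : cabs z / cabs d + (cabs d)^-1 * q / (1 - q) = (cabs z + r / (cabs d - r)) / cabs d.
    by rewrite /q; field; rewrite !gt_eqF.
  rewrite ltr_pdivrMr// mul1r -ltrBrDl ltr_pdivrMr//.
  apply: (@lt_le_trans _ _ ((cabs d - cabs z) * (cabs d / 2))); last first.
    by rewrite ler_wpM2l//; lra.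
  by lra.
move=> h hr.
have hd : cabs (h / d) < 1 by rewrite cabsM cabsV ltr_pdivrMr// mul1r; lra.
have hd' : 0 <= cabs (h / d) < 1 by rewrite cabs_ge0.
have sd := psr_csumm (lexx _) (bc_psr (1 : C) hd').
have s1 := psr_csumm (lexx _) (psr_one (cabs_ge0 h)).
transitivity (pser (@one_seq R) h - d^-1 * pser (bc 1) (h / d)).
  rewrite /pser -(csumZ _ sd) -(csumB s1 (csummZ _ sd)).
  by congr csum; apply/funext => n; rewrite /mob bc1 mul1r mulrBl /one_seq;
    congr (_ - _); [case: n|rewrite exprS expr_div_n mulrA mulrAC -exprVn].
rewrite pser_one (pser_bc1 hd).
have n1 : d - h != 0.
  have := sub1_neq0 hd; apply: contraNneq => e.
  by rewrite (_ : h = d) ?divff ?subrr//; apply/eqP; rewrite eq_sym -subr_eq0 e.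
have n2 : z + h - 1 != 0 by rewrite (_ : z + h - 1 = - (d - h)) ?oppr_eq0// /d; ring.
have -> : 1 - h / d = (d - h) / d by rewrite mulrBl divff.
rewrite invfM invrK mulrCA mulVf// mulr1; apply: (mulIf n2); rewrite mulfVK//.
rewrite mulrBl mul1r (_ : z + h - 1 = - (d - h)); last by rewrite /d; ring.
by rewrite mulrN mulVf// /d; ring.
Qed.

End Pfaff.

(** * Gauss's product for the Gamma function *)

Section ExpBounds.
Variable R : realType.
Local Notation C := R[i].

Lemma expR_quad (x : R) : `|x| <= 1 / 2 -> `|expR x - 1 - x| <= 2 * x ^+ 2.
Proof.
rewrite ler_norml => /andP[x1 x2].
have h1 := expR_ge1Dx x; have h2 := expR_ge1Dx (- x).
have h3 : expR x * expR (- x) = 1 by rewrite -expRD subrr expR0.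
have h4 : expR x * (1 - x) <= 1 by rewrite -[leRHS]h3 ler_wpM2l// ltW// expR_gt0.
have sq := sqr_ge0 x.
have h5 : expR x <= 1 + x + 2 * x ^+ 2.
  rewrite -(ler_pM2r (x := 1 - x)); last by lra.
  apply: (le_trans h4); rewrite -subr_ge0 (_ : _ - 1 = x ^+ 2 * (1 - 2 * x)); last by ring.
  by rewrite mulr_ge0//; lra.
rewrite ler_norml; apply/andP; split; lra.
Qed.

Lemma sin_lip (y : R) : `|sin y| <= `|y|.
Proof.
wlog y0 : y / 0 <= y.
  move=> H; case: (leP 0 y) => [/H//|yn].
  by rewrite -[y]opprK sinN normrN [leRHS]normrN H// oppr_ge0 ltW.
have [|c _] := @MVT_segment _ sin cos 0 y y0 (fun x _ => is_derive_sin x).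
  by apply: continuous_subspaceT => x; exact: continuous_sin.
rewrite sin0 !subr0 => ->; rewrite normrM ler_piMl//; exact: cos_max.
Qed.

Lemma cos_quad (y : R) : `|cos y - 1| <= y ^+ 2.
Proof.
wlog y0 : y / 0 <= y.
  move=> H; case: (leP 0 y) => [/H//|yn].
  by rewrite -[y]opprK cosN sqrrN H// oppr_ge0 ltW.
have [|c hc] := @MVT_segment _ cos (fun x => - sin x) 0 y y0 (fun x _ => is_derive_cos x).
  by apply: continuous_subspaceT => x; exact: continuous_cos.
rewrite cos0 subr0 => ->; rewrite normrM normrN (ger0_norm y0) expr2 ler_wpM2r//.
apply: (le_trans (sin_lip c)); move: hc; rewrite in_itv /= => /andP[c0 cy].
by rewrite ger0_norm.
Qed.

Lemma sin_quad (y : R) : `|y| <= 1 -> `|sin y - y| <= y ^+ 2.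
Proof.
wlog y0 : y / 0 <= y.
  move=> H; case: (leP 0 y) => [/H//|yn].
  by rewrite -[y]opprK sinN sqrrN -opprD !normrN => y1; apply: H; rewrite ?normrN// oppr_ge0 ltW.
have [|c hc] := @MVT_segment _ sin cos 0 y y0 (fun x _ => is_derive_sin x).
  by apply: continuous_subspaceT => x; exact: continuous_sin.
rewrite sin0 !subr0 => -> y1; rewrite -{2}[y]mul1r -mulrBl normrM expr2.
apply: ler_pM => //; last by rewrite ger0_norm.
move: hc; rewrite in_itv /= => /andP[c0 cy].
apply: (le_trans (cos_quad c)); rewrite expr2; rewrite (ger0_norm y0) in y1.
apply: (@le_trans _ _ (1 * c)); last by rewrite mul1r.
by rewrite ler_wpM2r//; lra.
Qed.

Lemma expCD (z w : C) : expC (z + w) = expC z * expC w.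
Proof.
case: z w => a b [c d]; rewrite /expC /= expRD sinD cosD.
by apply/eqP; rewrite eq_complex /=; apply/andP; split; apply/eqP; ring.
Qed.

Lemma expC_real (x : R) : expC x%:C = (expR x)%:C.
Proof.
by rewrite /expC /= cos0 sin0; apply/eqP; rewrite eq_complex /= !(mulr1, mulr0, mul0r) subr0 addr0 !eqxx.
Qed.

Lemma expC0 : expC 0 = 1 :> C.
Proof. by rewrite (expC_real 0) expR0. Qed.

Lemma expC_neq0 (z : C) : expC z != 0.
Proof.
apply/eqP => E; have := expCD z (- z); rewrite subrr expC0 E mul0r => /eqP.
by rewrite oner_eq0.
Qed.

(** For w = x + iy the real and imaginary parts are bounded by 2 x^2 + 2 y^2 and 4 x^2 + 6 y^2; the
    constant 8 covers their sum, and only the quadratic order matters later. *)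
Lemma expC_quad (w : C) : cabs w <= 1 / 2 -> cabs (expC w - 1 - w) <= 8 * cabs w ^+ 2.
Proof.
move=> hw; rewrite cabs_sqr; have := ler_Re w; have := ler_Im w.
move: hw; case: w => x y /= hw hy hx.
have hx' := le_trans hx hw; have hy' := le_trans hy hw.
apply: (le_trans (cabs_le _)); rewrite /expC /=.
have e2 : expR x <= 2.
  by have := expR_quad hx'; rewrite ler_norml => /andP[_]; move: hx'; rewrite ler_norml => /andP[]; nra.
have e0 : 0 <= expR x by rewrite ltW// expR_gt0.
have q1 := expR_quad hx'; have q2 := cos_quad y.
have q3 : `|sin y - y| <= y ^+ 2 by apply: sin_quad; lra.
have sx := sqr_ge0 x; have sy := sqr_ge0 y.
have sqn (t : R) : t ^+ 2 = `|t| ^+ 2 by rewrite real_normK ?num_real.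
have r1 : `|expR x * cos y - 0 * sin y - 1 - x| <= 2 * y ^+ 2 + 2 * x ^+ 2.
  rewrite (_ : _ - x = expR x * (cos y - 1) + (expR x - 1 - x)); last by ring.
  apply: (le_trans (ler_normD _ _)); rewrite lerD// normrM (ger0_norm e0).
  by apply: ler_pM.
have r2 : `|expR x * sin y + 0 * cos y - 0 - y| <= 2 * y ^+ 2 + 4 * (x ^+ 2 + y ^+ 2).
  rewrite (_ : _ - y = expR x * (sin y - y) + (expR x - 1) * y); last by ring.
  apply: (le_trans (ler_normD _ _)); apply: lerD; rewrite normrM.
    by rewrite (ger0_norm e0); apply: ler_pM.
  have e1 : `|expR x - 1| <= 2 * `|x|.
    rewrite (_ : expR x - 1 = (expR x - 1 - x) + x); last by ring.
    apply: (le_trans (ler_normD _ _)).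
    have : 2 * x ^+ 2 <= `|x|.
      by rewrite sqn; have := normr_ge0 x; nra.
    lra.
  apply: (@le_trans _ _ (2 * `|x| * `|y|)); first by rewrite ler_wpM2r.
  by rewrite (sqn x) (sqn y); nra.
by apply: (le_trans (lerD r1 r2)); lra.
Qed.

End ExpBounds.

Section GaussConv.
Variable R : realType.
Local Notation C := R[i].

Lemma summ_invsq : summ (fun n => (n.+1%:R ^+ 2)^-1 : R).
Proof.
apply: (summ_bounded (M := 2)) => [i|n]; first by rewrite invr_ge0 exprn_ge0.
have H k : \sum_(0 <= i < k.+1) (i.+1%:R ^+ 2)^-1 <= 2 - k.+1%:R^-1 :> R.
  elim: k => [|k IH]; first by rewrite big_nat1 expr1n invr1; lra.
  rewrite big_nat_recr//=; apply: (le_trans (lerD IH (lexx _))).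
  have p1 : 0 < k.+1%:R :> R by [].
  rewrite -(natr1 k.+1); move: (k.+1%:R) p1 => y p1.
  have h : (y^-1 - (y + 1)^-1) - ((y + 1) ^+ 2)^-1 = (y * (y + 1) ^+ 2)^-1.
    by field; rewrite !gt_eqF//; lra.
  have : 0 <= (y * (y + 1) ^+ 2)^-1 by rewrite invr_ge0 mulr_ge0 ?exprn_ge0//; lra.
  lra.
case: n => [|n]; first by rewrite big_geq.
apply: (le_trans (H n)); rewrite lerBlDr lerDl invr_ge0//.
Qed.

Lemma is_limC_shiftn (u : nat -> C) l n :
  is_limC (fun k => u (k + n)%N) l -> is_limC u l.
Proof.
elim: n => [|m IH] h; first by move: h; congr is_limC; apply/funext => k; rewrite addn0.
apply: IH; apply/is_limC_shift; move: h; congr is_limC; apply/funext => k.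
by rewrite addnS addSn.
Qed.

(** The sequence |u n| exp(K / n) is eventually nonincreasing, because 1 / n - 1 / (n + 1) >= 1 / (n
    + 1)^2. So u is bounded and its increments are O(1 / n^2), hence summable. *)
Lemma gauss_cvg (u : nat -> C) (K : R) (N : nat) : 0 <= K ->
  (forall n, (N <= n)%N -> cabs (u n.+1 - u n) <= K / n.+1%:R ^+ 2 * cabs (u n)) ->
  exists l, is_limC u l.
Proof.
move=> K0 hu.
pose v n : R := cabs (u n) * expR (K / n%:R).
pose N' := N.+1.
have vS n : (N' <= n)%N -> v n.+1 <= v n.
  move=> Nn; have n0 : 0 < n%:R :> R by rewrite ltr0n; lia.
  have Nn' : (N <= n)%N by lia.
  have h1 : cabs (u n.+1) <= (1 + K / n.+1%:R ^+ 2) * cabs (u n).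
    have := cabsD (u n.+1 - u n) (u n); rewrite subrK mulrDl mul1r => h.
    by apply: (le_trans h); rewrite addrC lerD2l hu.
  have h2 := expR_ge1Dx (K / n.+1%:R ^+ 2).
  apply: (@le_trans _ _ (expR (K / n.+1%:R ^+ 2) * cabs (u n) * expR (K / n.+1%:R))).
    rewrite ler_wpM2r ?(ltW (expR_gt0 _))//; apply: (le_trans h1).
    by rewrite ler_wpM2r ?cabs_ge0.
  rewrite mulrAC -expRD mulrC ler_wpM2l ?cabs_ge0// ler_expR -mulrDr ler_wpM2l//.
  rewrite -(natr1 n); move: (n%:R) n0 => y n0.
  have h : y^-1 - (((y + 1) ^+ 2)^-1 + (y + 1)^-1) = (y * (y + 1) ^+ 2)^-1.
    by field; rewrite !gt_eqF//; lra.
  have : 0 <= (y * (y + 1) ^+ 2)^-1 by rewrite invr_ge0 mulr_ge0 ?exprn_ge0//; lra.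
  by rewrite -h subr_ge0.
pose M := v N'.
have vM k : v (N' + k)%N <= M.
  elim: k => [|k IH]; first by rewrite addn0.
  by rewrite addnS (le_trans (vS _ _))// leq_addr.
have uM k : cabs (u (N' + k)%N) <= M.
  apply: le_trans (vM k); rewrite /v ler_peMr ?cabs_ge0//.
  by rewrite -expR0 ler_expR divr_ge0.
have M0 : 0 <= M by apply: le_trans (uM 0%N); exact: cabs_ge0.
pose d k := u (N' + k).+1 - u (N' + k)%N.
have sd : csumm d.
  apply: le_csumm (summZ (K * M) summ_invsq) => k.
  have h : (N <= N' + k)%N by rewrite /N'; lia.
  apply: (le_trans (hu _ h)).
  rewrite mulrAC; apply: ler_pM; rewrite ?mulr_ge0 ?cabs_ge0 ?invr_ge0 ?exprn_ge0//.
    by rewrite ler_wpM2l// uM.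
  rewrite lef_pV2 ?posrE ?exprn_gt0// lerXn2r ?nnegrE// ler_nat; lia.
have hl := is_limCD (@is_limC_cst R (u N')) (csum_series sd).
exists (u N' + csum d).
have E k : u N' + series d k = u (k + N')%N.
  rewrite addnC /series/=; elim: k => [|k IH]; first by rewrite big_geq// addn0 addr0.
  by rewrite big_nat_recr//= addrA IH /d addnS addrC subrK.
have hl' : is_limC (fun k => u (k + N')%N) (u N' + csum d).
  by move: hl; congr is_limC; apply/funext => k; rewrite E.
exact: is_limC_shiftn hl'.
Qed.

(** The inverses satisfy the same kind of estimate, so they converge too, and the product of the two
    limits is 1. *)
Lemma gauss_cvg_neq0 (u : nat -> C) (K : R) (N : nat) : 0 <= K ->
  (forall n, u n != 0) ->
  (forall n, (N <= n)%N -> cabs (u n.+1 - u n) <= K / n.+1%:R ^+ 2 * cabs (u n)) ->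
  exists l, l != 0 /\ is_limC u l.
Proof.
move=> K0 un0 hu.
have [l hl] := gauss_cvg K0 hu.
(* For n > 2 K a step changes u by at most half of |u n|, so |u n| <= 2 |u (n + 1)|; this costs the
   factor 2 in 2 K. *)
have [|n Nn|l' hl'] := @gauss_cvg (fun n => (u n)^-1) (2 * K) (maxn N (Num.truncn (2 * K)).+1).
- by rewrite mulr_ge0.
- have [Nn1 Nn2] : (N <= n)%N /\ ((Num.truncn (2 * K)).+1 <= n)%N by apply/andP; rewrite -geq_max.
  have Kn : K / n.+1%:R ^+ 2 <= 1 / 2.
    rewrite ler_pdivrMr ?exprn_gt0//.
    have h1 : 2 * K < n.+1%:R :> R.
      by apply: (lt_le_trans (truncnS_gt _)); rewrite ler_nat (leq_trans Nn2).
    have h2 : 1 <= n.+1%:R :> R by rewrite ler1n.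
    by nra.
  have h := hu n Nn1.
  have pn : 0 < cabs (u n) by rewrite lt_neqAle cabs_ge0 eq_sym cabs_eq0 un0.
  have pn1 : 0 < cabs (u n.+1) by rewrite lt_neqAle cabs_ge0 eq_sym cabs_eq0 un0.
  rewrite (_ : _ - _ = - ((u n.+1 - u n) / (u n * u n.+1))); last first.
    by field; rewrite !un0.
  rewrite cabsN cabsM !cabsV cabsM ler_pdivrMr ?mulr_gt0//.
  rewrite mulrA mulfVK ?gt_eqF//; apply: (le_trans h).
  have : cabs (u n) <= 2 * cabs (u n.+1).
    have := cabsB (u n.+1) (u n.+1 - u n); rewrite opprB addrCA subrr addr0.
    have : K / n.+1%:R ^+ 2 * cabs (u n) <= 1 / 2 * cabs (u n) by rewrite ler_wpM2r ?cabs_ge0.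
    by move=> /(le_trans h); lra.
  have kk : 0 <= K / n.+1%:R ^+ 2 by rewrite divr_ge0 ?exprn_ge0.
  move=> /(ler_wpM2l kk) /le_trans; apply.
  by rewrite le_eqVlt; apply/orP; left; apply/eqP; move: (_^-1) (cabs _) => a b; ring.
exists l; split => //; apply/eqP => l0.
have := is_limCM hl hl'; rewrite l0 mul0r => h0.
have : (0 : C) = 1.
  apply: (is_limC_unique h0); rewrite (_ : (fun n => _) = fun=> 1); first exact: is_limC_cst.
  by apply/funext => n; rewrite mulfV.
by move/esym/eqP; rewrite oner_eq0.
Qed.

End GaussConv.

(** * Convergence of Gauss's limit and the functional equation of Gamma *)

Section Gamma.
Variable R : realType.
Local Notation C := R[i].
Implicit Types z : C.

Definition gauss z (n : nat) : C :=
  n`!%:R * expC ((ln n%:R)%:C * z) / \prod_(k < n.+1) (z + k%:R).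

Lemma gaussS z n : (0 < n)%N -> z + n.+1%:R != 0 ->
  gauss z n.+1 = gauss z n * (n.+1%:R * expC ((ln n.+1%:R - ln n%:R)%:C * z) / (z + n.+1%:R)).
Proof.
move=> n0 zn; rewrite /gauss big_ord_recr/= factS natrM.
have -> : expC ((ln n.+1%:R)%:C * z) =
    expC ((ln n%:R)%:C * z) * expC ((ln n.+1%:R - ln n%:R)%:C * z) :> C.
  by rewrite -expCD -mulrDl -rmorphD /= addrC subrK.
by rewrite invfM; move: (expC _) (expC _) (_^-1) (_^-1) => a b c d; ring.
Qed.

Lemma ln_step n : (0 < n)%N ->
  let L : R := ln n.+1%:R - ln n%:R in
  n.+1%:R^-1 <= L /\ L - n.+1%:R^-1 <= 2 / n.+1%:R ^+ 2 /\ L <= 2 / n.+1%:R.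
Proof.
move=> n0 L.
have np : 0 < n%:R :> R by rewrite ltr0n.
have n1 : 1 <= n%:R :> R by rewrite ler1n.
have sp : 0 < n.+1%:R :> R by [].
have L1 : L <= n%:R^-1.
  rewrite /L -ln_div ?posrE// (_ : n.+1%:R / n%:R = 1 + n%:R^-1 :> R).
    by apply: le_ln1Dx; apply: lt_trans (_ : 0 < _); rewrite ?ltrN10// invr_gt0.
  by rewrite -natr1; field; rewrite gt_eqF.
have L2 : n.+1%:R^-1 <= L.
  rewrite -[L]opprB -ln_div ?posrE// lerNr.
  rewrite (_ : n%:R / n.+1%:R = 1 + - n.+1%:R^-1 :> R).
    apply: le_ln1Dx; rewrite ltrN2 invf_lt1// ltr1n//.
  by rewrite -natr1; field; rewrite natr1 gt_eqF.
split => //; move: L1 L2; rewrite -(natr1 n); move: (n%:R) np n1 => y yp y1 L1 L2.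
have e1 : y^-1 - (y + 1)^-1 = (y * (y + 1))^-1 by field; rewrite !gt_eqF//; lra.
have e2 : 2 / (y + 1) ^+ 2 - (y * (y + 1))^-1 = (y - 1) / (y * (y + 1) ^+ 2).
  by field; rewrite !gt_eqF//; lra.
have p2 : 0 <= (y - 1) / (y * (y + 1) ^+ 2).
  by rewrite divr_ge0 ?mulr_ge0 ?exprn_ge0//; lra.
have e3 : 2 / (y + 1) - y^-1 = (y - 1) / (y * (y + 1)).
  by field; rewrite !gt_eqF//; lra.
have p3 : 0 <= (y - 1) / (y * (y + 1)).
  by rewrite divr_ge0 ?mulr_ge0//; lra.
split; lra.
Qed.

(** With L = ln(n + 1) - ln n, the ratio of consecutive terms is (n + 1) exp(L z) / (z + n + 1).
    Since L = 1 / (n + 1) + O(1 / n^2), the terms of order 1 / n cancel and the ratio is 1 + O(1 /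
    n^2). *)
Lemma gauss_ex z : (forall k : nat, z + k%:R != 0) ->
  exists l, l != 0 /\ is_limC (gauss z) l.
Proof.
move=> zk; have z0 := cabs_ge0 z.
(* The constant is 2 (8 * 4 |z|^2 + 2 |z|): 8 from [expC_quad], 4 and 2 from L <= 2 / (n + 1) and L
   - 1 / (n + 1) <= 2 / (n + 1)^2, and the outer 2 from |z + n + 1| >= (n + 1) / 2. The bound 4 |z|
   < n + 1 gives the last inequality and |L z| <= 1 / 2. *)
apply: (@gauss_cvg_neq0 R _ (64 * cabs z ^+ 2 + 4 * cabs z) (Num.truncn (4 * cabs z)).+1).
- by rewrite addr_ge0// mulr_ge0// sqr_ge0.
- move=> n; rewrite /gauss; apply: mulf_neq0.
    by rewrite mulf_neq0 ?fact_neq0 ?expC_neq0.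
  by rewrite invr_eq0; apply/prodf_neq0 => i _.
move=> n nN; have n0 : (0 < n)%N by apply: leq_trans nN.
have bn : 4 * cabs z < n.+1%:R.
  by apply: (lt_le_trans (truncnS_gt _)); rewrite ler_nat (leq_trans nN).
rewrite gaussS// -[X in _ - X]mulr1 -mulrBr cabsM mulrC ler_wpM2r ?cabs_ge0//.
have [L1 [L2 L3]] := ln_step n0.
set L := ln n.+1%:R - ln n%:R in L1 L2 L3 *.
clearbody L.
have sp : 0 < n.+1%:R :> R by [].
have tz : 0 <= (n.+1%:R : R)^-1 by rewrite invr_ge0.
have hz : n.+1%:R / 2 <= cabs (z + n.+1%:R).
  have := cabsB (z + n.+1%:R) z; rewrite addrC addKr cabs_nat; lra.
have E : n.+1%:R * expC (L%:C * z) / (z + n.+1%:R) - 1 =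
   n.+1%:R * ((expC (L%:C * z) - 1 - L%:C * z) + (L - n.+1%:R^-1)%:C * z) / (z + n.+1%:R).
  move: (expC _) => e; rewrite rmorphB /= fmorphV /= rmorph_nat; move: (L%:C) => l.
  by field; rewrite [1 + _]addrC natr1 zk natr1_neq0.
rewrite {}E !cabsM cabs_nat cabsV.
have zp : 0 < cabs (z + n.+1%:R) by rewrite (lt_le_trans _ hz)// divr_gt0.
have hL : cabs (L%:C * z) <= 2 / n.+1%:R * cabs z.
  by rewrite cabsM cabsr ger0_norm ?ler_wpM2r// (le_trans tz).
have q : cabs (L%:C * z) <= 1 / 2.
  apply: (le_trans hL); rewrite mulrAC ler_pdivrMr//; lra.
have h1 := expC_quad q.
have h2 : cabs ((L - n.+1%:R^-1)%:C * z) <= 2 / n.+1%:R ^+ 2 * cabs z.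
  by rewrite cabsM cabsr ger0_norm ?subr_ge0// ler_wpM2r.
have h3 : cabs (L%:C * z) ^+ 2 <= 4 * cabs z ^+ 2 / n.+1%:R ^+ 2.
  rewrite (_ : 4 * _ / _ = (2 / n.+1%:R * cabs z) ^+ 2).
    by rewrite lerXn2r ?nnegrE ?cabs_ge0// mulr_ge0// divr_ge0.
  by rewrite !exprMn exprVn; ring.
have := cabsD (expC (L%:C * z) - 1 - L%:C * z) ((L - n.+1%:R^-1)%:C * z).
set Y := cabs (_ + _) => hY.
have Y0 : 0 <= Y by exact: cabs_ge0.
apply: (@le_trans _ _ (2 * Y)).
  rewrite ler_pdivrMr// mulrAC ler_wpM2r//; lra.
have hY' : Y <= 8 * (4 * cabs z ^+ 2 / n.+1%:R ^+ 2) + 2 / n.+1%:R ^+ 2 * cabs z.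
  by apply: (le_trans hY); apply: lerD => //; apply: (le_trans h1); rewrite ler_wpM2l.
rewrite (_ : (64 * _ + _) / _ = 2 * (8 * (4 * cabs z ^+ 2 / n.+1%:R ^+ 2) + 2 / n.+1%:R ^+ 2 * cabs z)).
  by rewrite ler_wpM2l.
by move: (_^-1) => i; ring.
Qed.

Lemma GammaC_gauss z l : is_limC (gauss z) l -> GammaC z = l.
Proof. exact: limCE. Qed.

Lemma GammaC_neq0 z : (forall k : nat, z + k%:R != 0) -> GammaC z != 0.
Proof. by move=> /gauss_ex[l [l0 hl]]; rewrite (GammaC_gauss hl). Qed.

Lemma is_limC_ratio z : is_limC (fun n => n%:R / (z + n.+1%:R)) (1 : C).
Proof.
apply/is_limCP => e e0; pose K := cabs (z + 1).
exists (Num.truncn (2 * K / e + 2 * K)).+1 => // n /= nN.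
have K0 : 0 <= K by exact: cabs_ge0.
have bn : 2 * K / e + 2 * K < n%:R.
  by apply: (lt_le_trans (truncnS_gt _)); rewrite ler_nat.
have ke : 0 <= 2 * K / e by rewrite divr_ge0 ?mulr_ge0// ltW.
have hz : n%:R / 2 < cabs (z + n.+1%:R).
  have := cabsB (z + n.+1%:R) (z + 1); rewrite -(natr1 n) (_ : z + (n%:R + 1) - (z + 1) = n%:R); last by ring.
  rewrite cabs_nat -/K; move: bn ke; move: (2 * K / e) => Q; lra.
have np : 0 < n%:R :> R by move: bn ke; move: (2 * K / e) => Q; lra.
have zp : 0 < cabs (z + n.+1%:R) by apply: le_lt_trans hz; rewrite divr_ge0// ltW.
have zn0 : z + n.+1%:R != 0 by rewrite -cabs_eq0 gt_eqF.
have -> : 1 - n%:R / (z + n.+1%:R) = (z + 1) / (z + n.+1%:R) :> C.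
  by rewrite -[X in X - _](divff zn0) -mulrBl -(natr1 n); congr (_ / _); ring.
rewrite cabsM cabsV -/K ltr_pdivrMr//.
have : 2 * K <= e * n%:R by rewrite [leRHS]mulrC -ler_pdivrMr//; move: bn ke; move: (2 * K / e) => Q; lra.
move: hz; nra.
Qed.

(** The term for z + 1 is z times the term for z times n / (z + n + 1), whose limit is 1. *)
Lemma gauss_shift z l : z != 0 -> is_limC (gauss z) l -> is_limC (gauss (z + 1)) (z * l).
Proof.
move=> z0 hl; have := is_limCM (is_limCM (@is_limC_cst R z) hl) (is_limC_ratio z).
rewrite mulr1; apply: is_limC_near; exists 1%N => // n /= n0.
have -> : gauss (z + 1) n = n`!%:R * (expC ((ln n%:R)%:C * z) * n%:R) / \prod_(k < n.+1) (z + 1 + k%:R).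
  rewrite /gauss mulrDr mulr1 expCD expC_real lnK ?posrE ?ltr0n//.
  by rewrite rmorph_nat.
have E : z * \prod_(k < n.+1) (z + 1 + k%:R) = (\prod_(k < n.+1) (z + k%:R)) * (z + n.+1%:R).
  transitivity (\prod_(k < n.+2) (z + k%:R)); last by rewrite big_ord_recr.
  rewrite [RHS]big_ord_recl/= addr0; congr (_ * _).
  by apply: eq_bigr => i _; rewrite /bump/= add1n -natr1 [i%:R + 1]addrC addrA.
have -> : (\prod_(k < n.+1) (z + 1 + k%:R))^-1 = z / (z + n.+1%:R) / \prod_(k < n.+1) (z + k%:R).
  apply: (mulfI (invr_neq0 z0)); rewrite -invfM E invfM !mulrA mulVf// mul1r mulrC.
  by [].
rewrite /gauss; move: (_^-1) (_^-1) (expC _) => a b c; ring.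
Qed.

Lemma GammaC_shift z : (forall k : nat, z + k%:R != 0) -> GammaC (z + 1) = z * GammaC z.
Proof.
move=> zk; have [l [_ hl]] := gauss_ex zk.
have z0 : z != 0 by have := zk 0%N; rewrite addr0.
by rewrite (GammaC_gauss hl) (GammaC_gauss (gauss_shift z0 hl)).
Qed.

Lemma GammaC1 : GammaC 1 = 1 :> C.
Proof.
apply: GammaC_gauss; have := is_limC_ratio 0.
apply: is_limC_near; exists 1%N => // n /= n0.
rewrite /gauss mulr1 expC_real lnK ?posrE ?ltr0n// rmorph_nat add0r.
have -> : \prod_(k < n.+1) (1 + k%:R) = (n.+1)`!%:R :> C.
  elim: n {n0} => [|n IH]; first by rewrite big_ord1 addr0.
  by rewrite big_ord_recr/= IH [in RHS]factS natrM mulrC [1 + _]addrC natr1.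
by rewrite factS natrM [n`!%:R * _]mulrC -mulf_div divff ?fact_neq0// mulr1.
Qed.

Lemma GammaC_pole (n : nat) : GammaC (- n%:R) = 0 :> C.
Proof.
apply: GammaC_gauss; apply: is_limC_near (@is_limC_cst R 0); exists n => // m /= nm.
rewrite /gauss (bigD1 (Ordinal (nm : (n < m.+1)%N)))//= addNr mul0r invr0 mulr0.
by [].
Qed.

Definition rgam (j : int) : C := (GammaC j%:~R)^-1.

(** At j <= 0 both sides are 0, because [GammaC] and its inverse take the value 0 at the poles; at j
    = 0 the factor j kills the right-hand side. *)
Lemma rgamE j : rgam j = j%:~R * rgam (j + 1).
Proof.
rewrite /rgam intrD; case: j => [[|n]|n].
- by rewrite mul0r -[X in GammaC X]oppr0 (GammaC_pole 0) invr0.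
- rewrite GammaC_shift; last first.
    by move=> k; rewrite -pmulrn -natrD pnatr_eq0.
  by rewrite invfM mulrA mulfV ?mul1r// -pmulrn natr1_neq0.
- rewrite NegzE !mulrNz -!pmulrn GammaC_pole invr0.
  have -> : - n.+1%:R + 1 = - n%:R :> C by rewrite -natr1; ring.
  by rewrite GammaC_pole invr0 mulr0.
Qed.

Lemma rgam1 : rgam 1 = 1.
Proof. by rewrite /rgam GammaC1 invr1. Qed.

End Gamma.

(** * Continuation of the hypergeometric series *)

Section Hyp2F1.
Variable R : realType.
Local Notation C := R[i].
Implicit Types (a b z w : C) (N : int).

Local Notation hyc := (hypc (@rgam R)).
Local Notation pfa := (pfaff (@rgam R)).

Lemma hyp2F1_coefE a b N k : hyp2F1_coef a b N%:~R k = hyc a b N k.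
Proof. by rewrite /hyp2F1_coef /hypc /rgam invfM mulrA intrD. Qed.

(** Here |z| < |1 - z|, that is, |z / (z - 1)| < 1. The arguments xi / (xi - 1) are negative and lie
    in it. *)
Definition half_plane : set C := [set z | complex.Re z < 1 / 2].

Lemma half_plane_cabs z : half_plane z -> cabs z < cabs (1 - z).
Proof.
rewrite /half_plane /= => hz.
rewrite -(ltr_pXn2r (n := 2)) ?nnegrE ?cabs_ge0// !cabs_sqr.
by case: z hz => x y /=; nra.
Qed.

Lemma half_plane_star : star_shaped half_plane.
Proof.
rewrite /star_shaped /half_plane /= => -[x y] t /= hx /andP[t0 t1].
rewrite mul0r subr0; have [x0|x0] := leP 0 x.
  apply: le_lt_trans hx; rewrite ler_piMl//.
by apply: (@le_lt_trans _ _ 0); rewrite ?mulr_ge0_le0 ?(ltW x0)//; lra.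
Qed.

Lemma half_plane_open : open (half_plane : set C^o).
Proof.
rewrite openE => z hz; apply/nbhs_ballP.
have e0 : 0 < 1 / 2 - complex.Re z by rewrite subr_gt0.
exists (1 / 2 - complex.Re z)%:C; first by rewrite /= ltcR.
move=> y; rewrite -ball_normE /= cabsE ltcR => h.
have := ler_Re (z - y); rewrite raddfB /= ler_norml => /andP[h1 h2].
rewrite /half_plane /=; lra.
Qed.

Lemma half_plane_cut : half_plane `<=` @cut_plane R.
Proof.
move=> z hz t t1; apply/eqP => E; move: hz; rewrite /half_plane /= E /=; lra.
Qed.

Lemma pfaff_analytic a b N z : half_plane z -> analytic_at (pfa a b N) z.
Proof.
move=> /half_plane_cabs /mob_norm[r [r0 s n1 E]].
have hq : 0 <= nrm (mob z) r < 1 by rewrite nrm_ge0// ltW.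
have [s' E'] := pser_comp (ltW r0) s (psr_one (ltW r0)) (pfaff_psr (@rgamE R) a b N hq).
apply/analyticP; eexists; exists r; split; [exact: r0|exact: s'|].
by move=> h hr; rewrite (E' h hr) pser_one mul1r E.
Qed.

(** The substitution of series is legitimate only near 0; the equality is carried to z along the
    segment from 0, which stays in both domains. *)
Lemma pfaff_hypc a b N z : half_plane z -> cabs z < 1 ->
  pfa a b N z = pser (hyc a b N) z.
Proof.
move=> hz z1; apply/eqP; rewrite -subr_eq0; apply/eqP.
apply: (analytic_ray (G := fun y => pfa a b N y - pser (hyc a b N) y)).
  move=> t t01; apply: analyticB.
    by apply: pfaff_analytic; exact: half_plane_star.
  apply: pser_analytic; first by move=> r; apply: hypc_psr; exact: rgamE.
  rewrite cabsM cabsr; apply: le_lt_trans z1; rewrite ler_piMl ?cabs_ge0//.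
  by case/andP: t01 => t0 t1; rewrite ger0_norm.
exists (1 / 4); split; first by lra.
move=> t /andP[t0 _] t4; apply/eqP; rewrite subr_eq0 eq_sym; apply/eqP.
apply: pfaff_near0; [exact: rgamE|exact: rgam1|].
rewrite cabsM cabsr (ger0_norm t0) (le_trans _ (ltW t4))//.
by rewrite ler_piMr// ltW.
Qed.

Lemma pfaff_is_hyp2F1 a b N w : half_plane w ->
  is_hyp2F1_reg a b N%:~R w (pfa a b N w).
Proof.
move=> hw; exists half_plane, (pfa a b N); split; split => //.
- exact: half_plane_open.
- exact: half_plane_star.
- exact: half_plane_cut.
- by move=> z; exact: pfaff_analytic.
move=> z hz; rewrite cabsE (ltcR _ 1) => z1; rewrite pfaff_hypc//.
have hr : 0 <= cabs z < 1 by rewrite cabs_ge0.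
have := pser_series (lexx _) (hypc_psr (@rgamE R) a b N hr).
by congr is_seriesC; apply/funext => k; rewrite hyp2F1_coefE.
Qed.

(** Star-shapedness puts the segment from 0 to w in both open sets; near 0 both functions are the
    sum of the same series, and [analytic_ray] carries this to w. *)
Lemma is_hyp2F1_unique a b c w v v' :
  is_hyp2F1_reg a b c w v -> is_hyp2F1_reg a b c w v' -> v = v'.
Proof.
move=> [U [F [[_ sU _ Uw] [aF sF <-]]]] [U' [F' [[_ sU' _ Uw'] [aF' sF' <-]]]].
apply/eqP; rewrite -subr_eq0; apply/eqP.
apply: (analytic_ray (G := fun y => F y - F' y)).
  by move=> t t01; apply: analyticB; [apply: aF; apply: sU|apply: aF'; apply: sU'].
exists (1 / (cabs w + 1)); have w0 := cabs_ge0 w.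
split; first by rewrite divr_gt0//; lra.
move=> t t01 tw; apply/eqP; rewrite subr_eq0; apply/eqP.
have h : `|t%:C * w| < 1.
  rewrite cabsE (ltcR _ 1) cabsM cabsr; case/andP: t01 => t0 t1; rewrite ger0_norm//.
  by move: tw; rewrite ltr_pdivlMr; nra.
exact: is_limC_unique (sF _ (sU _ _ Uw t01) h) (sF' _ (sU' _ _ Uw' t01) h).
Qed.

Lemma hyp2F1_regE a b N w : half_plane w ->
  hyp2F1_reg a b N%:~R w = pfa a b N w.
Proof.
move=> hw; apply: xget_unique; first exact: pfaff_is_hyp2F1.
by move=> y hy; apply: is_hyp2F1_unique hy _; exact: pfaff_is_hyp2F1.
Qed.

(** The map z / (z - 1) is an involution, so at xi / (xi - 1) the transformed series is evaluated at
    xi itself. *)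
Lemma hyp2F1_reg_xi a b N (xi : R) : 0 < xi < 1 ->
  hyp2F1_reg a b N%:~R (xi / (xi - 1))%:C =
  pser (bc (- a)) xi%:C * pser (hyc a (N%:~R - b) N) xi%:C.
Proof.
move=> /andP[x0 x1]; rewrite hyp2F1_regE; last first.
  rewrite /half_plane /= ltr_ndivrMr; lra.
have cx : cabs xi%:C = xi by rewrite cabsr gtr0_norm.
have hx : 0 <= cabs xi%:C < 1 by rewrite cx ltW.
rewrite /pfaff (_ : _ / _ = xi%:C).
  rewrite (pser_conv (lexx _))//; first exact: bc_psr.
  exact: hypc_psr (@rgamE R) _ _ _ _ hx.
have x10 : xi - 1 != 0 by rewrite subr_eq0 lt_eqF.
rewrite -(rmorph1 (real_complex R)) -rmorphB /= -fmorphV /= -rmorphM /=; congr (_%:C).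
have -> : xi / (xi - 1) - 1 = (xi - 1)^-1 by field.
by rewrite invrK mulfVK.
Qed.

Lemma hyp2F1_regC a b c w : hyp2F1_reg a b c w = hyp2F1_reg b a c w.
Proof.
rewrite /hyp2F1_reg; congr xget; apply/seteqP; split => v [U [F [h1 [h2 h3 h4]]]];
  exists U, F; split => //; split => // z Uz z1; move: (h3 z Uz z1);
  congr is_seriesC; apply/funext => k; rewrite /hyp2F1_coef; congr (_ / _ * _); exact: mulrC.
Qed.

End Hyp2F1.

(** * Correlations of binomial series *)

Section Lattice.
Variable R : realType.
Local Notation C := R[i].

Lemma bij_shift (n : int) : bijective (fun k : int => k + n).
Proof. by exists (fun k => k - n) => k; rewrite ?addrK ?subrK. Qed.

Lemma csum_shift (f : int -> C) n : csum (fun k => f (k + n)) = csum f.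
Proof. exact: (csum_reindex f (bij_shift n)). Qed.

Lemma csumm_shift (f : int -> C) n : csumm (fun k => f (k + n)) <-> csumm f.
Proof. exact: (csumm_reindex f (bij_shift n)). Qed.

Lemma psum_shift (u : int -> R) n : psum (fun k => u (k + n)) = psum u.
Proof. exact: (psum_reindex u (bij_shift n)). Qed.

Lemma csumm_bounded (I : choiceType) (f g : I -> C) M :
  csumm f -> (forall i, cabs (g i) <= M) -> csumm (fun i => f i * g i).
Proof.
move=> sf gM; apply: le_csumm (summZ M sf) => i.
by rewrite cabsM mulrC ler_wpM2r ?cabs_ge0.
Qed.

Lemma csumm_le_psum (I : choiceType) (f : I -> C) i : csumm f ->
  cabs (f i) <= psum (fun i => cabs (f i)).
Proof. by move=> sf; apply: (ger_psum (u := fun i => cabs (f i))) => // j; exact: cabs_ge0. Qed.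

Lemma csumm_mul2 (I : choiceType) (f g : I -> C) :
  csumm f -> csumm g -> csumm (fun i => f i * g i).
Proof. by move=> sf sg; apply: csumm_bounded sf _ => i; exact: csumm_le_psum. Qed.

Definition corr (p q : int -> C) (n : int) : C := csum (fun k => p (n + k) * q k).
Definition convZ (p q : int -> C) (n : int) : C := csum (fun k => p (n - k) * q k).

Lemma corr_summ (p q : int -> C) n : csumm p -> csumm q ->
  csumm (fun k => p (n + k) * q k).
Proof.
move=> sp sq; apply: csumm_mul2 => //.
by have := (csumm_shift p n).2 sp; congr csumm; apply/funext => k; rewrite addrC.
Qed.

Lemma bij_opp_shift (n : int) : bijective (fun k : int => n - k).
Proof. by exists (fun k => n - k) => k; rewrite subKr. Qed.

Lemma convZ_summ (p q : int -> C) n : csumm p -> csumm q ->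
  csumm (fun k => p (n - k) * q k).
Proof.
move=> sp sq; apply: csumm_mul2 => //.
exact: (csumm_reindex p (bij_opp_shift n)).2 sp.
Qed.

(** With summation variables k and l in the two correlations, the substitution t = x + n + k + l
    regroups p with q' and p' with q, and turns correlations into convolutions. For [bz] a
    convolution just adds the exponents. *)
Lemma corr_lattice (p q p' q' : int -> C) (m n : int) :
  csumm p -> csumm q -> csumm p' -> csumm q' ->
  csumm (fun x => corr p q (x + m) * corr p' q' (x + n)) /\
  csum (fun x => corr p q (x + m) * corr p' q' (x + n)) =
  csum (fun t => convZ p q' (t + (m - n)) * convZ p' q t).
Proof.
move=> sp sq sp' sq'.
pose F (k : int * int) (x : int) : C := (p (x + m + k.1) * q k.1) * (p' (x + n + k.2) * q' k.2).
pose F' (k : int * int) (t : int) : C := (p (t + (m - n) - k.2) * q' k.2) * (p' (t - k.1) * q k.1).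
have FF' k x : F k x = F' k (x + (n + k.1 + k.2)).
  rewrite /F /F'.
  rewrite (_ : x + (n + k.1 + k.2) + (m - n) - k.2 = x + m + k.1); last by ring.
  rewrite (_ : x + (n + k.1 + k.2) - k.1 = x + n + k.2); last by ring.
  ring.
pose Mp := psum (fun i => cabs (p i)); pose Mp' := psum (fun i => cabs (p' i)).
have inner k : csumm (F' k) /\ psum (fun t => cabs (F' k t)) <= Mp * Mp' * cabs (q k.1 * q' k.2).
  have B t : cabs (F' k t) <= (cabs (q k.1 * q' k.2) * Mp') * cabs (p (t + (m - n - k.2))).
    rewrite /F' !cabsM (_ : t + (m - n) - k.2 = t + (m - n - k.2)); last by ring.
    have := csumm_le_psum (t - k.1) sp'; rewrite -/Mp'.
    have := cabs_ge0 (p (t + (m - n - k.2))); have := cabs_ge0 (q k.1); have := cabs_ge0 (q' k.2).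
    have := cabs_ge0 (p' (t - k.1)).
    move: (cabs _) (cabs _) (cabs _) (cabs _) => a b c d a0 b0 c0 d0 h.
    rewrite (_ : a * c * (d * b) = (b * c * a) * d); last by ring.
    rewrite (_ : b * c * Mp' * a = (b * c * a) * Mp'); last by ring.
    by rewrite ler_wpM2l// !mulr_ge0.
  have sB : summ (fun t => cabs (q k.1 * q' k.2) * Mp' * cabs (p (t + (m - n - k.2)))).
    by apply: summZ; exact: (csumm_shift p (m - n - k.2)).2 sp.
  split; first exact: le_csumm B sB.
  have Mp0 : 0 <= Mp' by apply: psum_ge0 => i; exact: cabs_ge0.
  apply: (le_trans (le_psum (fun t => cabs_ge0 _) B sB)).
  rewrite psumZ ?mulr_ge0 ?cabs_ge0//; last by move=> i; exact: cabs_ge0.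
  by rewrite (psum_shift (fun i => cabs (p i))) -/Mp -mulrA mulrC [Mp' * _]mulrC.
have qq := csumm_mul sq sq'.
have Mp0 : 0 <= Mp by apply: psum_ge0 => i; exact: cabs_ge0.
have Mp'0 : 0 <= Mp' by apply: psum_ge0 => i; exact: cabs_ge0.
have sF' : csumm (fun z : (int * int) * int => F' z.1 z.2).
  apply: (csumm_pair (a := F')) => [k|]; first by have [] := inner k.
  apply: le_summ (summZ (Mp * Mp') qq) => k.
  rewrite !ger0_norm ?mulr_ge0 ?cabs_ge0//; last by apply: psum_ge0 => t; exact: cabs_ge0.
  by have [] := inner k.
have EF k : F k = fun x => F' k (x + (n + k.1 + k.2)) by apply/funext => x.
have sF : csumm (fun z : (int * int) * int => F z.1 z.2).
  apply: (csumm_pair (a := F)) => [k|].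
    by rewrite EF; apply/(csumm_shift (F' k)); have [] := inner k.
  have := summZ (Mp * Mp') qq; apply: le_summ => k.
  rewrite EF (psum_shift (fun t => cabs (F' k t))).
  rewrite !ger0_norm ?mulr_ge0 ?cabs_ge0//; last by apply: psum_ge0 => t; exact: cabs_ge0.
  by have [] := inner k.
have E1 x : csum (fun k => F k x) = corr p q (x + m) * corr p' q' (x + n).
  by rewrite /corr -(csum_mul (corr_summ (x + m) sp sq) (corr_summ (x + n) sp' sq')).
have E2 t : csum (fun k => F' k t) = convZ p q' (t + (m - n)) * convZ p' q t.
  rewrite mulrC /convZ -(csum_mul (convZ_summ t sp' sq) (convZ_summ (t + (m - n)) sp sq')).
  by congr csum; apply/funext => k; rewrite /F' mulrC.
have [_ s1 _] := csum_pair (a := fun x k => F k x) (csumm_pairT (a := F) sF).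
rewrite (_ : (fun x => corr p q _ * _) = fun x => csum (fun k => F k x)); last by apply/funext => x; rewrite E1.
split => //; rewrite -(csum_exchange (a := F) sF).
rewrite (_ : (fun t => convZ p q' _ * _) = fun t => csum (fun k => F' k t)); last by apply/funext => t; rewrite E2.
rewrite -(csum_exchange (a := F') sF'); congr csum; apply/funext => k.
by rewrite EF csum_shift.
Qed.

Variable s : R.
Hypothesis hs : 0 <= s < 1.

(* The binomial series (1 - s z) ^ (- a) as a sequence on the integers. *)
Definition bz (a : C) (j : int) : C :=
  if j is Posz n then bc a n * s%:C ^+ n else 0.

Lemma bz_summ a : csumm (bz a).
Proof.
apply: summ_int; last first.
  by apply: (csumm_fin (s := [::])) => i _.
have := bc_psr a hs; apply: le_summ => n /=.
by case/andP: hs => s0 _; rewrite cabsM cabsX cabsr (ger0_norm s0).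
Qed.

Lemma bzS a (j : int) : (j + 1)%:~R * bz a (j + 1) = s%:C * (a + j%:~R) * bz a j.
Proof.
case: j => [n|[|n]].
- have -> : Posz n + 1 = n.+1%:Z by lia.
  rewrite /bz -!pmulrn [LHS]mulrA bcS exprS; ring.
- by rewrite mulr0 mul0r.
- have -> : Negz n.+1 + 1 = Negz n by lia.
  by rewrite /= !mulr0.
Qed.

(** The derivative of (1 - s z)^(-a) is s a (1 - s z)^(-(a + 1)); so the family weighted by j is
    again summable. *)
Lemma bz_weight a (j : int) : j%:~R * bz a j = s%:C * a * bz (a + 1) (j - 1).
Proof.
case: j => [[|n]|n].
- by rewrite mul0r mulr0.
- have -> : n.+1%:Z - 1 = n%:Z by lia.
  rewrite /bz -!pmulrn [LHS]mulrA bcS exprS.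
  have -> : (a + n%:R) * bc a n = a * bc (a + 1) n.
    by rewrite /bc mulrA mulrA -pochSl pochS [_ * (a + _)]mulrC.
  by ring.
- by rewrite /= !mulr0.
Qed.

Lemma bz_weight_summ a : csumm (fun j => j%:~R * bz a j).
Proof.
rewrite (_ : (fun j => _) = fun j => s%:C * a * bz (a + 1) (j + -1)).
  by apply: csummZ; apply/(csumm_shift (bz (a + 1))); exact: bz_summ.
by apply/funext => j; exact: bz_weight.
Qed.

Lemma convZ_bz a b j : convZ (bz a) (bz b) j = bz (a + b) j.
Proof.
have E : convZ (bz a) (bz b) j = csum (fun k : nat => bz a (j - k%:Z) * bz b k%:Z).
  have Pinj : injective Posz by move=> x y [].
  rewrite /convZ -(csum_inj Pinj)// => -[k|k] h; last by rewrite mulr0.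
  by exfalso; apply: h; exists k.
rewrite {}E; case: j => [n|n]; last first.
  rewrite -[RHS](@csum0 R nat); congr csum; apply/funext => k.
  by rewrite (_ : Negz n - k%:Z = Negz (n + k)) ?mul0r//; lia.
rewrite (@csum_fin _ _ n.+1); last first.
  by move=> k nk; rewrite (_ : n%:Z - k%:Z = Negz (k - n.+1)) ?mul0r//; lia.
rewrite [RHS]/bz addrC -conv_bc /conv mulr_suml; apply: eq_bigr => k _.
have kn : (k <= n)%N by rewrite -ltnS.
rewrite (_ : n%:Z - k%:Z = (n - k)%N%:Z); last by lia.
rewrite /bz mulrACA -exprD subnK// mulrC [bc a _ * _]mulrC//.
by rewrite mulrC.
Qed.

Lemma bz_neg0 (n : nat) j : (n < j)%N -> bz (- n%:R) j%:Z = 0.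
Proof.
move=> nj; rewrite /bz /bc; suff -> : pochhammer (- n%:R : C) j = 0 by rewrite !mul0r.
by rewrite /pochhammer (bigD1 (Ordinal nj))//= addNr mul0r.
Qed.

(** Regrouping makes v disappear: with d = m - n the exponents add up to 1 - d and 1 + d. For d = 0
    the sum is geometric in s^2. For d > 0 the series of exponent 1 - d is a polynomial of degree d
    - 1, read at indices t + d; for d < 0 that of exponent 1 + d has degree |d| - 1, while t + d >=
    0 forces t >= |d|. Every term then vanishes. *)
Lemma corr_bz_orth (h v : C) (m n : int) :
  csumm (fun x => corr (bz (h + v - m%:~R)) (bz (h + v + m%:~R)) (x + m) *
    corr (bz (h - v - n%:~R)) (bz (h - v + n%:~R)) (x + n)) /\
  (2 * h = 1 ->
  csum (fun x => corr (bz (h + v - m%:~R)) (bz (h + v + m%:~R)) (x + m) *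
    corr (bz (h - v - n%:~R)) (bz (h - v + n%:~R)) (x + n)) =
   (if m == n then (1 - s ^+ 2)^-1 else 0)%:C).
Proof.
have [h1 h2] := corr_lattice m n (bz_summ (h + v - m%:~R)) (bz_summ (h + v + m%:~R))
  (bz_summ (h - v - n%:~R)) (bz_summ (h - v + n%:~R)).
split; first exact: h1.
move=> hh; rewrite {}h2.
pose d := m - n.
have -> : (fun t => convZ (bz (h + v - m%:~R)) (bz (h - v + n%:~R)) (t + (m - n)) *
    convZ (bz (h - v - n%:~R)) (bz (h + v + m%:~R)) t) =
   fun t => bz (1 - d%:~R) (t + d) * bz (1 + d%:~R) t.
  apply/funext => t; rewrite !convZ_bz /d; congr (bz _ _ * bz _ _).
    transitivity (2 * h - m%:~R + n%:~R); first by ring.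
    by rewrite hh intrB; ring.
  transitivity (2 * h + m%:~R - n%:~R); first by ring.
  by rewrite hh intrB; ring.
case: eqVneq => [mn|mn].
  have -> : d = 0 by rewrite /d mn subrr.
  rewrite mulr0z subr0 addr0.
  have Pinj : injective Posz by move=> x y [].
  rewrite -(csum_inj Pinj); last by move=> [k|k] hk; rewrite ?mulr0//; exfalso; apply: hk; exists k.
  have hs2 : 0 <= s ^+ 2 < 1.
    by case/andP: hs => s0 s1; rewrite sqr_ge0/= expr_lt1.
  have bc1 k : bc (1 : C) k = 1.
    elim: k => [|k IH]; first by rewrite /bc poch0 fact0 divr1.
    by apply: (mulfI (natr1_neq0 R k)); rewrite bcS IH !mulr1 addrC natr1.
  rewrite -(psum_geometric hs2) -rsum_psum; last by move=> k; rewrite exprn_ge0// sqr_ge0.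
  rewrite -csum_real; congr csum; apply/funext => k.
  by rewrite addr0 /bz bc1 mul1r -exprMn -expr2 -!rmorphXn.
rewrite -[RHS](@csum0 R int); congr csum; apply/funext => t.
have dn0 : d != 0 by rewrite subr_eq0.
move: d dn0 => -[[//|d]|d] _.
- case: t => [t|t]; last by rewrite mulr0.
  have -> : Posz t + d.+1%:Z = (t + d.+1)%N%:Z by lia.
  have -> : 1 - d.+1%:Z%:~R = - d%:R :> C by rewrite -pmulrn -(natr1 d); ring.
  by rewrite bz_neg0 ?mul0r//; lia.
- have -> : 1 + (Negz d)%:~R = - d%:R :> C by rewrite NegzE mulrNz -pmulrn -(natr1 d); ring.
  case: t => [t|t]; last by rewrite mulr0.
  have [td|td] := leqP t d; last by rewrite bz_neg0 ?mulr0.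
  by rewrite (_ : Posz t + Negz d = Negz (d - t)) ?mul0r//; lia.
Qed.

(* The generating function of corr satisfies a first-order ODE; these are its coefficients. *)
Lemma corr_bz_rec a b (n : int) :
  s%:C * (a + n%:~R - 1) * corr (bz a) (bz b) (n - 1) +
  s%:C * (n%:~R + 1 - b) * corr (bz a) (bz b) (n + 1) =
  (n%:~R + s%:C ^+ 2 * (a - b + n%:~R)) * corr (bz a) (bz b) n.
Proof.
pose p := bz a; pose q := bz b; pose E n := corr p q n.
have sp := bz_summ a; have sq := bz_summ b.
have wp := bz_weight_summ a; have wq := bz_weight_summ b.
(* [T1] and [T2] weight one of the two factors by its index; they are eliminated by [T12], which
   splits the index n + k, and by [bzS], which relates shifted values. *)
pose T1 n := corr (fun j => j%:~R * p j) q n.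
pose T2 n := corr p (fun j => j%:~R * q j) n.
have T12 k : T1 k = k%:~R * E k + T2 k.
  rewrite /T1 /T2 /E /corr -csumZ; last exact: corr_summ.
  rewrite -csumD; [|exact: csummZ (corr_summ _ sp sq)|exact: corr_summ].
  congr csum; apply/funext => i; rewrite intrD; ring.
have A1 : s%:C * (a + n%:~R - 1) * E (n - 1) = T1 n - s%:C * T2 (n - 1).
  rewrite /T1 /T2 /E /corr -!csumZ; try exact: corr_summ.
  rewrite -csumB; [|exact: (corr_summ n wp sq)|exact: csummZ (corr_summ _ sp wq)].
  congr csum; apply/funext => i.
  have := bzS a (n - 1 + i); rewrite (_ : n - 1 + i + 1 = n + i); last by ring.
  rewrite /p => ->; rewrite intrD intrB; ring.
have A2 k : T2 (k - 1) = s%:C * (b * E k + T2 k).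
  rewrite /T2 /E /corr -(csum_shift _ 1).
  rewrite -csumZ; last exact: corr_summ.
  rewrite -csumD; [|exact: csummZ (corr_summ _ sp sq)|exact: corr_summ].
  rewrite -csumZ; last first.
    by apply: csummD; [exact: csummZ (corr_summ _ sp sq)|exact: corr_summ].
  congr csum; apply/funext => i; rewrite /q bzS.
  by rewrite (_ : k - 1 + (i + 1) = k + i); ring.
have A3 : s%:C * (n%:~R + 1 - b) * E (n + 1) = s%:C ^+ 2 * (a * E n + T1 n) - T2 n.
  have B1 : T2 n = s%:C * (b * E (n + 1) + T2 (n + 1)).
    by rewrite -A2 addrK.
  have B2 : T1 (n + 1) = s%:C * (a * E n + T1 n).
    rewrite /T1 /E /corr -csumZ; last exact: corr_summ.
    rewrite -csumD; [|exact: csummZ (corr_summ _ sp sq)|exact: (corr_summ n wp sq)].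
    rewrite -csumZ; last first.
      by apply: csummD; [exact: csummZ (corr_summ _ sp sq)|exact: (corr_summ n wp sq)].
    congr csum; apply/funext => i.
    rewrite (_ : n + 1 + i = n + i + 1); last by ring.
    by rewrite /p bzS; ring.
  rewrite B1 (_ : s%:C ^+ 2 * (a * E n + T1 n) = s%:C * T1 (n + 1)); last by rewrite B2; ring.
  rewrite T12 intrD; ring.
have := A1; have := A3; rewrite /E /p /q => -> ->.
by rewrite A2 T12 /E /p /q; ring.
Qed.

End Lattice.

(** * The functions phi *)

Lemma int_updown (P : int -> Prop) : P 0 -> (forall x, P x <-> P (x + 1)) ->
  forall x, P x.
Proof.
move=> P0 PS; have h n : P n%:Z /\ P (- n%:Z).
  elim: n => [|n [IH1 IH2]]; first by [].
  have e1 : n.+1%:Z = n%:Z + 1 by lia.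
  have e2 : - n.+1%:Z + 1 = - n%:Z by lia.
  by split; [rewrite e1; exact: (PS _).1|apply: (PS _).2; rewrite e2].
by case=> n; [have [] := h n|rewrite NegzE; have [] := h n.+1].
Qed.

Section RealComplex.
Variable R : realType.
Implicit Types a b : R.

Lemma rcM a b : (a * b)%:C = a%:C * b%:C :> R[i].
Proof. exact: (rmorphM (real_complex R)). Qed.

Lemma rcD a b : (a + b)%:C = a%:C + b%:C :> R[i].
Proof. exact: (rmorphD (real_complex R)). Qed.

Lemma rcB a b : (a - b)%:C = a%:C - b%:C :> R[i].
Proof. exact: (rmorphB (real_complex R)). Qed.

Lemma rcX a n : (a ^+ n)%:C = a%:C ^+ n :> R[i].
Proof. exact: (rmorphXn (real_complex R)). Qed.

Lemma rcV a : (a^-1)%:C = (a%:C)^-1 :> R[i].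
Proof. exact: (fmorphV (real_complex R)). Qed.

Lemma rcZ (m : int) : (m%:~R : R)%:C = m%:~R :> R[i].
Proof. exact: (rmorph_int (real_complex R)). Qed.

Lemma rcI a b : a%:C = b%:C :> R[i] -> a = b.
Proof. exact: (@complexI R). Qed.

Lemma rc_eq0 a : (a%:C == 0 :> R[i]) = (a == 0).
Proof. exact: (inj_eq (@complexI R) a 0). Qed.

End RealComplex.

Section Phi.
Variable R : realType.
Local Notation C := R[i].
Variables (alpha xi : R).
Hypothesis halpha : 0 < alpha.
Hypothesis hxi : 0 < xi < 1.

Let xi0 : 0 < xi. Proof. by case/andP: hxi. Qed.
Let xi1 : xi < 1. Proof. by case/andP: hxi. Qed.

Let s : R := Num.sqrt xi.

Let s0 : 0 < s. Proof. by rewrite sqrtr_gt0. Qed.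

Let s2 : s ^+ 2 = xi. Proof. by rewrite sqr_sqrtr// ltW. Qed.

Let s01 : 0 <= s < 1.
Proof.
rewrite ltW//= -(ltr_pXn2r (n := 2)) ?nnegrE ?ler01// ?(ltW s0)//.
by rewrite s2 expr1n.
Qed.

Let h : C := 2^-1.

Let h2 : 2 * h = 1. Proof. by rewrite /h mulfV// pnatr_eq0. Qed.

(** The ratio of consecutive values in x of Gamma(1/2 + nu + x) Gamma(1/2 - nu + x), see [zzM] and
    [GGS]. *)
Definition gamma_step (x : int) : R := alpha + (x * (x + 1))%:~R.

Lemma gamma_step_gt0 x : 0 < gamma_step x.
Proof.
rewrite ltr_wpDr//; rewrite (ler0z R); case: x => n; first by [].
by rewrite NegzE; nia.
Qed.

Section OneSign.
Variable v : C.
Hypothesis hv : v ^+ 2 = (1 / 4 - alpha)%:C.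

Definition zz (u : C) (x : int) : C := h + u + x%:~R.

Lemma zzM x : zz v x * zz (- v) x = (gamma_step x)%:C.
Proof.
have h4 : h ^+ 2 = (1 / 4)%:C.
  rewrite /h exprVn -natrX rmorphM /= rmorph1 fmorphV /= rmorph_nat mul1r.
  by [].
rewrite /zz /gamma_step (_ : _ * _ = h ^+ 2 - v ^+ 2 + (2 * h) * x%:~R + x%:~R ^+ 2); last by ring.
have v4 : v ^+ 2 = (1 / 4)%:C - alpha%:C by rewrite hv rmorphB.
have -> : (alpha + (x * (x + 1))%:~R)%:C = alpha%:C + x%:~R * (x%:~R + 1) :> C.
  by rewrite rmorphD /= rmorph_int intrM intrD.
by rewrite h4 v4 h2; ring.
Qed.

(** The product of 1/2 + v + x and 1/2 - v + x is alpha + x (x + 1), positive since x (x + 1) >= 0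
    on the integers. Hence the arguments of Gamma avoid its poles. *)
Lemma zz_neq0 x : zz v x != 0.
Proof.
have := zzM x; apply: contra_eq_neq => ->; rewrite mul0r eq_sym.
by rewrite (inj_eq (@complexI R) _ 0) gt_eqF// gamma_step_gt0.
Qed.

Lemma zzD u x (y : int) : zz u x + y%:~R = zz u (x + y).
Proof. by rewrite /zz intrD addrA. Qed.

Lemma zz_pole x (k : nat) : zz v x + k%:R != 0.
Proof. by have := zzD v x k%:Z; rewrite -pmulrn => ->; exact: zz_neq0. Qed.

Definition Gm (u : C) x : C := GammaC (zz u x).

Lemma GmS x : Gm v (x + 1) = zz v x * Gm v x.
Proof. by rewrite /Gm -zzD GammaC_shift//; exact: zz_pole. Qed.

Lemma Gm_neq0 x : Gm v x != 0.
Proof. by apply: GammaC_neq0; exact: zz_pole. Qed.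

Lemma GmD x (k : nat) : Gm v (x + k%:Z) = pochhammer (zz v x) k * Gm v x.
Proof.
elim: k => [|k IH]; first by rewrite addr0 poch0 mul1r.
rewrite (_ : x + k.+1%:Z = x + k%:Z + 1); last by lia.
rewrite GmS IH pochS -(zzD v x k%:Z) -pmulrn; ring.
Qed.

Definition corrv (u : C) (m x : int) : C :=
  corr (bz s (h + u - m%:~R)) (bz s (h + u + m%:~R)) (x + m).

Lemma rgam_neg j : j <= 0 -> rgam R j = 0.
Proof.
case: j => [[|n]|n] // _; rewrite /rgam.
  by rewrite -[X in GammaC X]oppr0 (GammaC_pole R 0) invr0.
by rewrite NegzE mulrNz -pmulrn GammaC_pole invr0.
Qed.

(** A termwise identity: with n = x + m + k one has x + k = - m + n, so the Gamma value at 1/2 + v +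
    x + k can be written as a Pochhammer symbol of length k based at x or of length n based at -
    m. *)
Lemma hyp_corr m x :
  Gm v x * (s ^ (x + m))%:C *
    pser (hypc (@rgam R) (zz v m) (zz v x) (x + m + 1)) xi%:C =
  Gm v (- m) * corrv v m x.
Proof.
have cx : cabs xi%:C = xi by rewrite cabsr gtr0_norm.
have hx : 0 <= xi < 1 by rewrite ltW.
have sh := psr_csumm (z := xi%:C) (r := xi) (eq_ind_r (fun t => t <= xi) (lexx _) cx) (hypc_psr (@rgamE R) (zz v m) (zz v x) (x + m + 1) hx).
have Pinj : injective Posz by move=> y z [].
rewrite /pser -csumZ// /corrv /corr -(csum_inj Pinj); last first.
  by move=> [k|k] hk; rewrite ?mulr0//; exfalso; apply: hk; exists k.
rewrite -csumZ; last first.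
  have := corr_summ (x + m) (bz_summ s01 (h + v - m%:~R)) (bz_summ s01 (h + v + m%:~R)).
  by move=> /(csumm_inj Pinj).
congr csum; apply/funext => k.
have sk : (s ^ (x + m))%:C * xi%:C ^+ k = (s ^ (x + m + k%:Z))%:C * s%:C ^+ k.
  rewrite -!rmorphXn -!rmorphM /= -s2; congr (_%:C).
  rewrite [in RHS]expfzDr ?gt_eqF// -mulrA; congr (_ * _).
  by rewrite -exprnP -exprMn -expr2.
(* For a negative index 1 / Gamma vanishes on the left, and on the right [bz] is supported on the
   nonnegative integers. *)
rewrite /hypc; have [jn|jp] := ltP (x + m + k%:Z) 0.
  rewrite rgam_neg; last by lia.
  case E : (x + m + k%:Z) => [n|n]; first by exfalso; lia.
  by rewrite /= !(mulr0, mul0r).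
have [n En] : exists n : nat, x + m + k%:Z = n%:Z by case: (x + m + k%:Z) jp => // n _; exists n.
rewrite (_ : x + m + 1 + k%:Z = n.+1%:Z); last by lia.
rewrite (rhoS (@rgamE R) (rgam1 R)) En /bz.
have E1 := GmD x k; have E2 := GmD (- m) n.
rewrite (_ : - m + n%:Z = x + k%:Z) in E2; last by lia.
rewrite (_ : h + v - m%:~R = zz v (- m)); last by rewrite /zz mulrNz.
rewrite -/(zz v m).
transitivity ((pochhammer (zz v x) k * Gm v x) * pochhammer (zz v m) k / n`!%:R / k`!%:R * ((s ^ (x + m))%:C * xi%:C ^+ k)).
  by rewrite -!mulrA; move: (_^-1) (_^-1) => a b; ring.
rewrite -E1 E2 sk En /bc -exprnP rmorphXn /=.
by move: (_^-1) (_^-1) => a b; ring.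
Qed.

Lemma int_powR x : xi `^ (x%:~R / 2) = s ^ x.
Proof. by rewrite mulrC powRrM powR12_sqrt ?(ltW xi0)// powR_intmul// ltW. Qed.

(** The power (1 - xi)^(1/2 + u). By [beta_shift] the factor (1 - xi)^(-m) of phi_m reduces (1 -
    xi)^(1/2 + u + m) to it, so that no dependence on m remains. *)
Definition beta (u : C) : C := pser (bc (- (h + u))) xi%:C.

Let cxi : cabs xi%:C < 1. Proof. by rewrite cabsr gtr0_norm. Qed.

Lemma beta_shift u (m : int) :
  pser (bc (- (h + u + m%:~R))) xi%:C * ((1 - xi) ^ (- m))%:C = beta u.
Proof.
have x1 : 1 - xi != 0 by rewrite subr_eq0 eq_sym lt_eqF.
have step a : pser (bc (a + 1)) xi%:C * (1 - xi)%:C = pser (bc a) xi%:C.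
  rewrite -pser_bcD// (pser_bc1 cxi) -(rmorph1 (real_complex R)) -rmorphB /= mulfVK//.
  by rewrite (inj_eq (@complexI R) _ 0).
elim/int_updown : m => [|m]; first by rewrite oppr0 expr0z mulr1 addr0.
rewrite -(step (- (h + u + (m + 1)%:~R))).
rewrite (_ : - (h + u + (m + 1)%:~R) + 1 = - (h + u + m%:~R)); last by rewrite intrD; ring.
rewrite -mulrA -rmorphM /= (_ : (1 - xi) * (1 - xi) ^ (- (m + 1)) = (1 - xi) ^ (- m)); first by [].
by rewrite -{1}[1 - xi]expr1z -expfzDr//; congr (_ ^ _); lia.
Qed.

End OneSign.

Section TwoSigns.
Variable v : C.
Hypothesis hv : v ^+ 2 = (1 / 4 - alpha)%:C.

Let hv' : (- v) ^+ 2 = (1 / 4 - alpha)%:C. Proof. by rewrite sqrrN. Qed.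

Definition GG (u : C) x : C := Gm u x * Gm (- u) x.

Lemma GG_neq0 x : GG v x != 0.
Proof. by rewrite mulf_neq0// Gm_neq0. Qed.

Lemma GGS x : GG v (x + 1) = (gamma_step x)%:C * GG v x.
Proof. by rewrite /GG !GmS// -(zzM hv); ring. Qed.

(* The square of the prefactor sqrt (Gamma(1/2 + nu + x) Gamma(1/2 - nu + x)),
   normalized at x = 0. *)
Definition rr2 x : R := complex.Re (GG v x / GG v 0).

(** Consecutive ratios are the positive reals [gamma_step], so ratios of values of [GG] are positive
    whatever the complex number [GG v 0] is. *)
Lemma rr2P x : 0 < rr2 x /\ GG v x = (rr2 x)%:C * GG v 0.
Proof.
suff [r [r0 E]] : exists r : R, 0 < r /\ GG v x = r%:C * GG v 0.
  by rewrite /rr2 E mulfK ?GG_neq0.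
elim/int_updown: x => [|x]; first by exists 1; rewrite mul1r ltr01.
split => -[r [r0 E]].
  exists (gamma_step x * r); rewrite mulr_gt0 ?gamma_step_gt0// GGS E rmorphM /= -(mulrA (gamma_step x)%:C); split => //.
exists (r / gamma_step x); rewrite divr_gt0 ?gamma_step_gt0//; split => //.
have a0 : (gamma_step x)%:C != 0 :> C by rewrite (inj_eq (@complexI R) _ 0) gt_eqF ?gamma_step_gt0.
have e : r%:C = (gamma_step x)%:C * (r / gamma_step x)%:C :> C.
  by rewrite -(rmorphM (real_complex R)) /= mulrC divfK// gt_eqF ?gamma_step_gt0.
by apply: (mulfI a0); rewrite -GGS E e -(mulrA (gamma_step x)%:C).
Qed.

Lemma rr2S x : rr2 (x + 1) = gamma_step x * rr2 x.
Proof.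
have [_ E] := rr2P x; have [_ E'] := rr2P (x + 1).
apply/complexI/(mulIf (GG_neq0 0)); by rewrite -E' GGS E rmorphM /= -(mulrA (gamma_step x)%:C).
Qed.

Lemma rr20 : rr2 0 = 1.
Proof. by rewrite /rr2 divff ?GG_neq0. Qed.

(** The polynomial x (x + 1) is invariant under the exchange of x and - (x + 1), and so is
    [gamma_step]. *)
Lemma rr2N x : rr2 x * rr2 (- x) = 1.
Proof.
elim/int_updown: x => [|x]; first by rewrite oppr0 rr20 mulr1.
have : rr2 (- x) = gamma_step x * rr2 (- (x + 1)).
  have := rr2S (- (x + 1)); rewrite (_ : - (x + 1) + 1 = - x); last by ring.
  by move=> ->; congr (_ * _); rewrite /gamma_step; congr (_ + _%:~R); ring.
by move=> ->; rewrite rr2S mulrCA mulrA.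
Qed.

Definition rr x : R := Num.sqrt (rr2 x).

Lemma rr_gt0 x : 0 < rr x.
Proof. by rewrite sqrtr_gt0; have [] := rr2P x. Qed.

Lemma rr_sqr x : rr x ^+ 2 = rr2 x.
Proof. by rewrite sqr_sqrtr//; apply: ltW; have [] := rr2P x. Qed.

Lemma rrN x : rr x * rr (- x) = 1.
Proof.
have r0 y : 0 <= rr2 y by apply: ltW; have [] := rr2P y.
by rewrite /rr -sqrtrM// rr2N sqrtr1.
Qed.

Lemma rrS x : rr (x + 1) = Num.sqrt (gamma_step x) * rr x.
Proof. by rewrite /rr rr2S sqrtrM// ltW// gamma_step_gt0. Qed.

(* phi with an arbitrary u in place of nu: it depends on u ^+ 2 only, and
   orthogonality pairs the expressions obtained from nu and - nu. *)
Definition phiv (u : C) (m x : int) : C :=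
  sqrtC (GG u x / GG u (- m)) * (xi `^ ((x + m)%:~R / 2))%:C *
  ((1 - xi) ^ (- m))%:C *
  hyp2F1_reg (zz u m) (zz (- u) m) (x + m + 1)%:~R (xi / (xi - 1))%:C.

Lemma phivN m x : phiv (- v) m x = phiv v m x.
Proof.
rewrite /phiv /GG opprK hyp2F1_regC; congr (sqrtC _ * _ * _ * _).
by rewrite [Gm (- v) x * _]mulrC [Gm (- v) (- m) * _]mulrC.
Qed.

Lemma sqrtC_GG m x : sqrtC (GG v x / GG v (- m)) = (rr x * rr m)%:C.
Proof.
have [_ ->] := rr2P x; have [r0 ->] := rr2P (- m).
rewrite -mulf_div divff ?GG_neq0// mulr1 -!rr_sqr -fmorphV -rmorphM /=.
rewrite (_ : rr x ^+ 2 / rr (- m) ^+ 2 = (rr x * rr m) ^+ 2).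
  rewrite rmorphXn /= sqrCK// ler0c mulr_ge0 ?ltW ?rr_gt0//.
have rn : rr (- m) != 0 by rewrite gt_eqF ?rr_gt0.
have -> : rr m = (rr (- m))^-1 by apply: (mulIf rn); rewrite mulVf// rrN.
by rewrite exprMn exprVn.
Qed.

(** Pfaff replaces the second parameter 1/2 - v + m by N minus it, with N = x + m + 1, that is, by
    1/2 + v + x. All factors are now symmetric in m and x. *)
Lemma phiv_sym m x : phiv v m x =
  (rr x * rr m * s ^ (x + m))%:C * beta v *
  pser (hypc (@rgam R) (zz v m) (zz v x) (x + m + 1)) xi%:C.
Proof.
rewrite /phiv hyp2F1_reg_xi// sqrtC_GG int_powR -(beta_shift v m).
rewrite (_ : (x + m + 1)%:~R - zz (- v) m = zz v x); last first.
  by rewrite /zz !intrD -h2; ring.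
rewrite -/(zz v m) [in RHS]rmorphM /=; move: (pser _ _) (pser _ _) => p q; ring.
Qed.

Lemma phiv_corr m x : phiv v m x =
  ((rr m)%:C * beta v * Gm v (- m)) * ((rr x)%:C / Gm v x * corrv v m x).
Proof.
have g0 := Gm_neq0 hv x.
have := hyp_corr hv m x; rewrite phiv_sym => E.
apply: (mulfI g0).
transitivity ((rr x * rr m)%:C * beta v * (Gm v x * (s ^ (x + m))%:C * pser (hypc (rgam R) (zz v m) (zz v x) (x + m + 1)) xi%:C)).
  by rewrite [(rr x * rr m * _)%:C]rmorphM /=; ring.
rewrite E rmorphM /=.
transitivity ((rr m)%:C * beta v * Gm v (- m) * ((rr x)%:C * corrv v m x)); first by ring.
move: (Gm v x) g0 (corrv _ _ _) (Gm _ _) (beta v) => g g0 c g' b; by field.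
Qed.

Lemma GG_opp x : GG (- v) x = GG v x.
Proof. by rewrite /GG opprK mulrC. Qed.

End TwoSigns.

Section Conclusion.
Variable v : C.
Hypothesis hv : v ^+ 2 = (1 / 4 - alpha)%:C.

Let hv' : (- v) ^+ 2 = (1 / 4 - alpha)%:C. Proof. by rewrite sqrrN. Qed.

Lemma rr_opp x : rr (- v) x = rr v x.
Proof. by rewrite /rr /rr2 !GG_opp. Qed.

Lemma rgam_conj j : (rgam R j)^* = rgam R j.
Proof.
case: (leP j 0) => [/rgam_neg ->|]; first by rewrite conjc0.
case: j => [[|n]|n] // _; rewrite (rhoS (@rgamE R) (rgam1 R)).
by rewrite conjc_inv conjc_nat.
Qed.

Lemma conjcM (a b : C) : conjc (a * b) = conjc a * conjc b.
Proof. exact: (rmorphM (@conjc R)). Qed.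

Lemma conjcD (a b : C) : conjc (a + b) = conjc a + conjc b.
Proof. exact: (rmorphD (@conjc R)). Qed.

Lemma conjcN (a : C) : conjc (- a) = - conjc a.
Proof. exact: (rmorphN (@conjc R)). Qed.

Lemma conjcX (a : C) k : conjc (a ^+ k) = conjc a ^+ k.
Proof. exact: (rmorphXn (@conjc R)). Qed.

Lemma poch_conj (a : C) k : (pochhammer a k)^* = pochhammer a^* k.
Proof.
elim: k => [|k IH]; first by rewrite !poch0 conjc1.
by rewrite !pochS conjcM IH conjcD conjc_nat.
Qed.

Lemma pser_conj (f : nat -> C) (x : R) :
  (pser f x%:C)^* = pser (fun n => conjc (f n)) x%:C.
Proof.
rewrite /pser -csumJ; congr csum; apply/funext => n.
by rewrite conjcM conjcX conjc_real.
Qed.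

Lemma zz_conj u x : (zz u x)^* = zz u^* x.
Proof.
rewrite /zz !conjcD /h conjc_inv conjc_nat; congr (_ + _).
by rewrite -(rmorph_int (real_complex R)) conjc_real.
Qed.

(** Since v^2 is real, the conjugate of v is v or - v, and [phiv] is even in v. *)
Lemma phiv_conj m x : (phiv v m x)^* = phiv v m x.
Proof.
have cv : v^* = v \/ v^* = - v.
  have : (conjc v == v) || (conjc v == - v) by rewrite -eqf_sqr -conjcX hv conjc_real.
  by case/orP => /eqP; [left|right].
rewrite [in LHS](phiv_sym hv) !conjcM conjc_real /beta !pser_conj.
have E w : w ^+ 2 = (1 / 4 - alpha)%:C -> rr w =1 rr v -> v^* = w ->
   (rr v x * rr v m * s ^ (x + m))%:C *
   pser (fun n => conjc (bc (- (h + v)) n)) xi%:C *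
   pser (fun n => conjc (hypc (@rgam R) (zz v m) (zz v x) (x + m + 1) n)) xi%:C = phiv w m x.
  move=> hw rw vw.
  have -> : (fun n => conjc (bc (- (h + v)) n)) = bc (- (h + w)).
    apply/funext => n; rewrite /bc conjcM conjc_inv conjc_nat poch_conj.
    by rewrite conjcN conjcD vw /h conjc_inv conjc_nat.
  have -> : (fun n => conjc (hypc (@rgam R) (zz v m) (zz v x) (x + m + 1) n)) =
      hypc (@rgam R) (zz w m) (zz w x) (x + m + 1).
    apply/funext => n; rewrite /hypc (conjcM _ (n`!%:R^-1)) conjcM rgam_conj conjcM !poch_conj.
    by rewrite conjc_inv conjc_nat !zz_conj vw.
  by rewrite (phiv_sym hw) /beta (rw x) (rw m).
case: cv => cv; first exact: E.
by rewrite (E _ hv' rr_opp cv) phivN.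
Qed.

Definition phiR (m x : int) : R := complex.Re (phiv v m x).

Lemma phiRE m x : (phiR m x)%:C = phiv v m x.
Proof.
rewrite /phiR; have := phiv_conj m x; case: (phiv v m x) => a b [] /= /eqP.
by rewrite -subr_eq0 -opprD oppr_eq0 -mulr2n mulrn_eq0 /= => /eqP ->.
Qed.

Lemma beta_opp : beta v * beta (- v) = (1 - xi)%:C.
Proof.
rewrite /beta pser_bcD ?cabsr ?gtr0_norm//.
rewrite (_ : - (h + v) + - (h - v) = - (1 : C)); last by rewrite -h2; ring.
rewrite /pser (@csum_fin _ _ 2%N).
  rewrite big_ord_recl big_ord1 /bc /= poch0 pochSl poch0 fact0 factS fact0.
  by rewrite muln1 !invr1 expr0 !mulr1 mulN1r expr1 rmorphB rmorph1.
move=> [|[|k]] // _; rewrite /bc !pochSl.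
by rewrite addNr mul0r mulr0 mul0r mul0r.
Qed.

Lemma corrv_rec m x :
  s%:C * zz v (x - 1) * corrv v m (x - 1) + s%:C * zz (- v) x * corrv v m (x + 1) =
  (x%:~R + m%:~R + xi%:C * (x%:~R - m%:~R)) * corrv v m x.
Proof.
have rec := corr_bz_rec s01 (h + v - m%:~R) (h + v + m%:~R) (x + m).
rewrite /corrv (_ : x - 1 + m = x + m - 1); last by ring.
rewrite (_ : x + 1 + m = x + m + 1); last by ring.
pose C0 := corr (bz s (h + v - m%:~R)) (bz s (h + v + m%:~R)).
rewrite -/C0 in rec *.
transitivity (((x + m)%:~R + s%:C ^+ 2 * (h + v - m%:~R - (h + v + m%:~R) + (x + m)%:~R)) * C0 (x + m)).
  rewrite -rec /zz !intrD; move: (C0 _) (C0 _) => p q.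
  have -> : h - v + x%:~R = 2 * h - h - v + x%:~R by ring.
  by rewrite h2 intrN; ring.
by rewrite -rcX s2 intrD; ring.
Qed.

Lemma hypcC (a d : C) N : hypc (rgam R) a d N = hypc (rgam R) d a N.
Proof. by apply/funext => n; rewrite /hypc (mulrC (pochhammer a n)). Qed.

Lemma GGE u x : Gm u x * Gm (- u) x = GG u x. Proof. by []. Qed.

Local Opaque phiv beta Gm corrv hypc pser phiR GG rr.

Lemma phiR_sym m x : phiR m x = phiR x m.
Proof.
apply: rcI; rewrite {1}(phiRE m x) {1}(phiRE x m) (phiv_sym hv m x) (phiv_sym hv x m).
by rewrite (mulrC (rr v x)) (addrC x m) (hypcC (zz v m)).
Qed.

(** Row m is written with v and row n with - v, so that [corr_bz_orth] applies. For m = n the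
    constant K times 1 / (1 - xi) reduces to rr2 m * rr2 (- m) = 1. *)
Lemma phiR_orth m n :
  csumm (fun x => (phiR m x * phiR n x)%:C : C) /\
  csum (fun x => (phiR m x * phiR n x)%:C) = (m == n)%:R :> C.
Proof.
pose K : C := (rr v m * rr v n)%:C * (1 - xi)%:C * (Gm v (- m) * Gm (- v) (- n)) / GG v 0.
have E x : (phiR m x * phiR n x)%:C = K * (corrv v m x * corrv (- v) n x).
  rewrite rcM {1}(phiRE m x) {1}(phiRE n x) -(phivN v n x) (phiv_corr hv m x) (phiv_corr hv' n x) !rr_opp.
  have [_ gx] := rr2P hv x; have r0 := rr_gt0 hv x.
  have g0 := Gm_neq0 hv x; have g0' := Gm_neq0 hv' x.
  have G0 := GG_neq0 hv 0.
  (* The dependence on x of the two prefactors cancels: [rr v x ^+ 2] is [GG v x / GG v 0]. *)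
  have e : ((rr v x)%:C / Gm v x) * ((rr v x)%:C / Gm (- v) x) = (GG v 0)^-1.
    rewrite mulf_div -rcM -expr2 rr_sqr// GGE gx invfM mulrA divff ?mul1r//.
    by rewrite rc_eq0 gt_eqF//; have [] := rr2P hv x.
  rewrite /K -e -beta_opp (rcM (rr v m)).
  ring.
have [s1 s3'] := corr_bz_orth s01 h v m n.
have s3 : csum (fun x => corrv v m x * corrv (- v) n x) =
    (if m == n then (1 - s ^+ 2)^-1 else 0)%:C by exact: s3' h2.
have -> : (fun x => (phiR m x * phiR n x)%:C : C) = fun x => K * (corrv v m x * corrv (- v) n x).
  by apply/funext => x; rewrite E.
split; first exact: csummZ s1.
rewrite csumZ; last exact: s1.
rewrite s3 s2; case: eqVneq => [mn|_]; last by rewrite mulr0.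
have x1 : (1 - xi)%:C != 0 :> C by rewrite rc_eq0 subr_eq0 eq_sym lt_eqF.
rewrite /K -mn rcV GGE; have [_ ->] := rr2P hv (- m).
rewrite -expr2 rr_sqr//.
have : (rr2 v m)%:C * (rr2 v (- m))%:C = 1 :> C by rewrite -rcM rr2N.
have := GG_neq0 hv 0; move: (GG v 0) (rr2 v m)%:C (rr2 v (- m))%:C => g a b g0 ab.
move: ((1 - xi)%:C) x1 => y x1; rewrite mulr1n -ab; field; by rewrite g0 x1.
Qed.

Definition offdiag (x : int) : R := Num.sqrt (xi * gamma_step x).

(** Conjugation by the factor rr x / Gm x turns the coefficients s (1/2 + v + x - 1) and s (1/2 - v
    + x) of [corrv_rec] into the symmetric off-diagonal entries [offdiag]; this is the content of
    [e1] and [e2]. *)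
Lemma phiR_rec m x :
  offdiag x * phiR m (x + 1) + offdiag (x - 1) * phiR m (x - 1) - x%:~R * (1 + xi) * phiR m x =
  m%:~R * (1 - xi) * phiR m x.
Proof.
pose c x : C := corrv v m x.
have aE y : offdiag y = s * Num.sqrt (gamma_step y) by rewrite /offdiag sqrtrM// ltW.
have sal y : Num.sqrt (gamma_step y) * Num.sqrt (gamma_step y) = gamma_step y.
  by rewrite -expr2 sqr_sqrtr// ltW// gamma_step_gt0.
have g0 y : Gm v y != 0 by exact: Gm_neq0.
have e1 : (offdiag x)%:C * ((rr v (x + 1))%:C / Gm v (x + 1)) =
    s%:C * zz (- v) x * ((rr v x)%:C / Gm v x).
  rewrite rrS// GmS// aE.
  have -> : (s * Num.sqrt (gamma_step x))%:C * ((Num.sqrt (gamma_step x) * rr v x)%:C / (zz v x * Gm v x)) =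
     s%:C * (gamma_step x)%:C * ((rr v x)%:C / (zz v x * Gm v x)).
    have <- : (Num.sqrt (gamma_step x))%:C * (Num.sqrt (gamma_step x))%:C = (gamma_step x)%:C :> C by rewrite -rcM sal.
    by rewrite !rcM; move: (_^-1) => i; ring.
  by rewrite -(zzM hv); field; rewrite zz_neq0// g0.
have e2 : (offdiag (x - 1))%:C * ((rr v (x - 1))%:C / Gm v (x - 1)) =
    s%:C * zz v (x - 1) * ((rr v x)%:C / Gm v x).
  have rx := rrS hv (x - 1); have gx := GmS hv (x - 1).
  rewrite subrK in rx gx; rewrite rx gx aE !rcM.
  by field; rewrite zz_neq0// g0.
pose f (y : C) := (rr v m)%:C * beta v * Gm v (- m) * y.
have fE y : (phiR m y)%:C = f ((rr v y)%:C / Gm v y * c y).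
  by rewrite phiRE (phiv_corr hv).
have := fE (x + 1); have := fE (x - 1); have := fE x.
move: (phiR m (x + 1)) (phiR m (x - 1)) (phiR m x) => A B D eD eB eA.
apply: rcI; rewrite rcB rcD !rcM eA eB eD.
transitivity (f (((offdiag x)%:C * ((rr v (x + 1))%:C / Gm v (x + 1))) * c (x + 1) +
   ((offdiag (x - 1))%:C * ((rr v (x - 1))%:C / Gm v (x - 1))) * c (x - 1) -
   x%:~R%:C * (1 + xi)%:C * ((rr v x)%:C / Gm v x * c x))).
  rewrite /f /c; move: (_ / _) (_ / _) (_ / _) => p q r; ring.
rewrite e1 e2.
have crec : s%:C * zz v (x - 1) * c (x - 1) + s%:C * zz (- v) x * c (x + 1) =
   (x%:~R + m%:~R + xi%:C * (x%:~R - m%:~R)) * c x by exact: corrv_rec.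
transitivity (f ((rr v x)%:C / Gm v x * ((s%:C * zz v (x - 1) * c (x - 1) + s%:C * zz (- v) x * c (x + 1)) -
   x%:~R%:C * (1 + xi)%:C * c x))).
  by rewrite /f; move: (_ / _) => p; ring.
rewrite crec /f /c rcB rcD !rcZ (_ : 1%:C = 1)//; move: (_ / _) => p; ring.
Qed.

End Conclusion.

Lemma nu_sqr : (nu alpha) ^+ 2 = (1 / 4 - alpha)%:C.
Proof.
rewrite /nu expr_div_n sqrtCK -natrX -(rmorph_nat (real_complex R)) -rcV -rcM.
by congr (_%:C); field.
Qed.

Lemma phi_phiv m x : phi alpha xi m x = phiv (nu alpha) m x.
Proof. by rewrite /phiv /GG /Gm /zz mulrNz. Qed.

End Phi.

(** * Square-summable functions *)

Section Ell2.
Variable R : realType.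
Local Notation C := R[i].
Implicit Types f g : int -> C.

Definition sqnR f : R := psum (fun x => cabs (f x) ^+ 2).

Lemma ell2P f : ell2 f <-> summ (fun x => cabs (f x) ^+ 2).
Proof.
rewrite /ell2 /= /sqnorm /summ.
have -> : (\esum_(x in [set: int]) (complex.Re `|f x| ^+ 2)%:E =
    \esum_(x in [set: int]) `|cabs (f x) ^+ 2|%:E)%E by
  apply: eq_esum => x _; rewrite (ger0_norm (sqr_ge0 (cabs (f x)))).
by [].
Qed.

Lemma sqnormE f : ell2 f -> sqnorm f = (sqnR f)%:E.
Proof. by move=> /ell2P sf; rewrite /sqnR psumE// => x; rewrite sqr_ge0. Qed.

Lemma sqnR_ge0 f : 0 <= sqnR f.
Proof. by apply: psum_ge0 => x; rewrite sqr_ge0. Qed.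

Lemma ell2D f g : ell2 f -> ell2 g -> ell2 (fun x => f x + g x).
Proof.
move=> /ell2P sf /ell2P sg; apply/ell2P.
apply: le_summ (summZ 2 (summD sf sg)) => x.
rewrite (ger0_norm (sqr_ge0 _)) ger0_norm ?mulr_ge0 ?addr_ge0 ?sqr_ge0//.
have := cabsD (f x) (g x); have := cabs_ge0 (f x + g x).
have := cabs_ge0 (f x); have := cabs_ge0 (g x).
move: (cabs (f x)) (cabs (g x)) (cabs (_ + _)) => a b c b0 a0 c0 h.
apply: (@le_trans _ _ ((a + b) ^+ 2)); first by rewrite lerXn2r ?nnegrE ?addr_ge0.
  by have := sqr_ge0 (a - b); nra.
Qed.

Lemma ell2Z (a : C) f : ell2 f -> ell2 (fun x => a * f x).
Proof.
move=> /ell2P sf; apply/ell2P; apply: le_summ (summZ (cabs a ^+ 2) sf) => x.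
by rewrite cabsM exprMn.
Qed.

Lemma ell2_le f g : (forall x, cabs (f x) <= cabs (g x)) -> ell2 g -> ell2 f.
Proof.
move=> fg /ell2P sg; apply/ell2P; apply: le_summ sg => x.
by rewrite !ger0_norm ?sqr_ge0// lerXn2r ?nnegrE ?cabs_ge0.
Qed.

Lemma ell2_summ f g : ell2 f -> ell2 g -> csumm (fun x => f x * g x).
Proof.
move=> /ell2P sf /ell2P sg; apply: le_csumm (summD sf sg) => x; rewrite cabsM.
have := cabs_ge0 (f x); have := cabs_ge0 (g x).
by move: (cabs (f x)) (cabs (g x)) => a b; nra.
Qed.

Lemma ell2J f : ell2 f -> ell2 (fun x => conjc (f x)).
Proof. by apply: ell2_le => x; rewrite cabsJ. Qed.

Definition ip f g : C := csum (fun x => f x * conjc (g x)).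

Lemma ip_summ f g : ell2 f -> ell2 g -> csumm (fun x => f x * conjc (g x)).
Proof. by move=> sf sg; apply: ell2_summ => //; exact: ell2J. Qed.

Lemma dotE f g : ell2 f -> ell2 g -> dot f g = ip f g.
Proof. by move=> sf sg; rewrite /dot sumZ_csum//; exact: ip_summ. Qed.

Lemma ip_sqnR f : ip f f = (sqnR f)%:C.
Proof.
rewrite /ip (_ : (fun x => _) = fun x => (cabs (f x) ^+ 2)%:C); last first.
  by apply/funext => x; exact: mulcJ.
by rewrite csum_real rsum_psum// => x; rewrite sqr_ge0.
Qed.

Lemma ipDl f f' g : ell2 f -> ell2 f' -> ell2 g ->
  ip (fun x => f x + f' x) g = ip f g + ip f' g.
Proof.
move=> sf sf' sg; rewrite /ip -(csumD (ip_summ sf sg) (ip_summ sf' sg)).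
by congr csum; apply/funext => x; rewrite mulrDl.
Qed.

Lemma ipZl (a : C) f g : ell2 f -> ell2 g -> ip (fun x => a * f x) g = a * ip f g.
Proof.
move=> sf sg; rewrite /ip -(csumZ _ (ip_summ sf sg)).
by congr csum; apply/funext => x; rewrite mulrA.
Qed.

Lemma ipC f g : ip g f = conjc (ip f g).
Proof.
rewrite /ip -csumJ; congr csum; apply/funext => x.
by rewrite conjcM conjcK mulrC.
Qed.

Lemma ipDr f g g' : ell2 f -> ell2 g -> ell2 g' ->
  ip f (fun x => g x + g' x) = ip f g + ip f g'.
Proof.
by move=> sf sg sg'; rewrite ipC ipDl// conjcD -!ipC.
Qed.

Lemma ipZr (a : C) f g : ell2 f -> ell2 g -> ip f (fun x => a * g x) = conjc a * ip f g.
Proof. by move=> sf sg; rewrite ipC ipZl// conjcM -ipC. Qed.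

Lemma sqnRD (a : C) f g : ell2 f -> ell2 g ->
  sqnR (fun x => f x + a * g x) =
  sqnR f + cabs a ^+ 2 * sqnR g + 2 * complex.Re (conjc a * ip f g).
Proof.
move=> sf sg; have sg' := ell2Z a sg; have sfg := ell2D sf sg'.
apply: rcI; rewrite -ip_sqnR (ipDl sf sg' sfg) (ipDr sf sf sg') (ipDr sg' sf sg').
rewrite (ipZl a sg sf) (ipZl a sg sg') (ipZr a sf sg) (ipZr a sg sg).
rewrite [ip g f]ipC !ip_sqnR !rcD (rcM (_ ^+ 2) (sqnR g)) (rcM 2) -mulcJ.
have -> : (2 : R)%:C = 2 by rewrite rmorph_nat.
have -> : 2 * (complex.Re (conjc a * ip f g))%:C =
    conjc a * ip f g + a * conjc (ip f g) :> C.
  have := ReJ_add (conjc a * ip f g); rewrite conjcM conjcK => ->.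
  by rewrite mulrC divfK ?pnatr_eq0.
by move: (ip f g) (sqnR f)%:C (sqnR g)%:C => p q r; rewrite -/(conjc a); ring.
Qed.

Lemma ip_polar f g : ell2 f -> ell2 g ->
  ip f g = ((sqnR (fun x => f x + 1 * g x) - sqnR (fun x => f x + (-1) * g x)) / 4) +i*
    ((sqnR (fun x => f x + 'i * g x) - sqnR (fun x => f x + (- 'i) * g x)) / 4).
Proof.
move=> sf sg; rewrite !sqnRD//.
have -> : cabs (- 'i : C) = cabs ('i : C) by rewrite cabsN.
have -> : cabs (- 1 : C) = cabs (1 : C) by rewrite cabsN.
case: (ip f g) => a b; apply/eqP; rewrite eq_complex /=; apply/andP; split; apply/eqP; by field.
Qed.

Lemma sqnR_eq0 f : ell2 f -> sqnR f = 0 -> forall x, f x = 0.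
Proof.
move=> /ell2P sf n0 x; apply/eqP; rewrite -cabs_eq0 -sqrf_eq0 eq_le sqr_ge0 andbT -n0.
by apply: (ger_psum (u := fun x => cabs (f x) ^+ 2)) => // y; rewrite sqr_ge0.
Qed.

Lemma sqnR_isometry_ip (T : (int -> C) -> int -> C) :
  (forall f, ell2 f -> ell2 (T f)) ->
  (forall (a : C) f g, ell2 f -> ell2 g ->
     T (fun x => f x + a * g x) = fun x => T f x + a * T g x) ->
  (forall f, ell2 f -> sqnR (T f) = sqnR f) ->
  forall f g, ell2 f -> ell2 g -> ip (T f) (T g) = ip f g.
Proof.
move=> Te Tl Tn f g sf sg; rewrite !ip_polar//; try exact: Te.
by rewrite -!Tl// !Tn//; apply: ell2D => //; exact: ell2Z.
Qed.

Lemma summ_invabs : summ (fun x : int => ((1 + `|x%:~R|) ^+ 2)^-1 : R).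
Proof.
apply: summ_int.
  apply: le_summ (summ_invsq R) => n /=.
  by rewrite -pmulrn normr_nat nat1r.
apply: le_summ (summ_invsq R) => n /=.
have p : 0 < n.+1%:R :> R by [].
rewrite NegzE mulrNz normrN -pmulrn normr_nat !ger0_norm ?invr_ge0 ?exprn_ge0// ?addr_ge0//.
by rewrite lef_pV2 ?posrE ?exprn_gt0 ?addr_gt0// lerXn2r ?nnegrE ?addr_ge0//; lra.
Qed.

(** |f x| is the product of 1 / (1 + |x|) and (1 + |x|) |f x|, both square-summable. *)
Lemma ell2_weight_summ f : ell2 f -> ell2 (fun x => x%:~R * f x) -> csumm f.
Proof.
move=> sf sxf; have /ell2P s1 := ell2D sf sf; have /ell2P sf1 := sf; have /ell2P sxf1 := sxf.
apply: le_csumm (summD summ_invabs (summZ 2 (summD sf1 sxf1))) => x.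
rewrite cabsM -(rcZ R) cabsr.
have := cabs_ge0 (f x); have := normr_ge0 (x%:~R : R).
move: (cabs _) (`|_|) => a b b0 a0.
have p : 0 < 1 + b by lra.
have h : a <= ((1 + b) ^+ 2)^-1 + ((1 + b) * a) ^+ 2.
  rewrite -exprVn; have : a = (1 + b)^-1 * ((1 + b) * a) by rewrite mulKf// gt_eqF.
  move: ((1 + b)^-1) ((1 + b) * a) => u w ->; have := sqr_ge0 (u - w); nra.
apply: (le_trans h); rewrite lerD2l exprMn.
by have := sqr_ge0 (a - b * a); nra.
Qed.

End Ell2.

(** * A symmetric matrix with orthonormal rows as a unitary involution *)

Section Involution.
Variable R : realType.
Local Notation C := R[i].
Implicit Types f g : int -> C.
Variable M : int -> int -> R.
Hypothesis Msym : forall m x, M m x = M x m.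
Hypothesis Morth : forall m n,
  csumm (fun x => (M m x * M n x)%:C : C) /\
  csum (fun x => (M m x * M n x)%:C) = (m == n)%:R :> C.
Hypothesis Ml1 : forall m, csumm (fun x => (M m x)%:C : C).

Let row m : int -> C := fun x => (M m x)%:C.

Lemma row_ell2 m : ell2 (row m).
Proof.
apply/ell2P; have [s _] := Morth m m; apply: le_summ s => x.
by rewrite rcM cabsM.
Qed.

Definition trans f : int -> C := fun m => csum (fun x => (M m x)%:C * f x).

Lemma trans_summ f m : ell2 f -> csumm (fun x => (M m x)%:C * f x).
Proof. by move=> sf; apply: (ell2_summ (row_ell2 m) sf). Qed.

Lemma transD (a : C) f g : ell2 f -> ell2 g ->
  trans (fun x => f x + a * g x) = fun x => trans f x + a * trans g x.
Proof.
move=> sf sg; apply/funext => m; rewrite /trans.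
rewrite -(csumZ a (trans_summ m sg)) -(csumD (trans_summ m sf) (csummZ a (trans_summ m sg))).
by congr csum; apply/funext => x; ring.
Qed.

Lemma trans_ip f m : trans f m = ip f (row m).
Proof.
by rewrite /trans /ip; congr csum; apply/funext => x; rewrite /row conjc_real mulrC.
Qed.

Lemma row_ip m n : ip (row m) (row n) = (m == n)%:R.
Proof.
have [_ <-] := Morth m n; rewrite /ip; congr csum; apply/funext => x.
by rewrite /row conjc_real rcM.
Qed.

Lemma bessel f (F : seq int) : ell2 f -> uniq F ->
  exists g, [/\ ell2 g, sqnR g = sqnR f - \sum_(m <- F) cabs (trans f m) ^+ 2 &
    forall k, k \notin F -> ip g (row k) = trans f k].
Proof.
move=> sf; elim: F => [|n F IH] /=.
  by exists f; split => //; [rewrite big_nil subr0|move=> k _; rewrite trans_ip].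
move=> /andP[nF /IH[g [sg ng hg]]].
exists (fun x => g x + (- trans f n) * row n x); split.
- by apply: ell2D => //; apply: ell2Z; exact: row_ell2.
- rewrite sqnRD//; last exact: row_ell2.
  rewrite hg// ng big_cons cabsN conjcN mulNr [conjc _ * _]mulrC mulcJ.
  have -> : sqnR (row n) = 1 by apply: rcI; rewrite -ip_sqnR row_ip eqxx.
  rewrite raddfN /=; ring.
move=> k; rewrite inE negb_or => /andP[kn kF].
rewrite ipDl//; [|by apply: ell2Z; exact: row_ell2|exact: row_ell2].
rewrite ipZl//; [|exact: row_ell2|exact: row_ell2].
by rewrite row_ip eq_sym (negPf kn) mulr0 addr0 hg.
Qed.

Lemma trans_ell2 f : ell2 f -> ell2 (trans f) /\ sqnR (trans f) <= sqnR f.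
Proof.
move=> sf.
have h : (\esum_(m in [set: int]) (cabs (trans f m) ^+ 2)%:E <= (sqnR f)%:E)%E.
  apply: ge_ereal_sup => _ [F [finF _] <-]; rewrite fsbig_finite//= sumEFin lee_fin.
  have [g [_ ng _]] := bessel sf (finmap.fset_uniq (fset_set F)).
  by have := sqnR_ge0 g; rewrite ng subr_ge0.
have s : ell2 (trans f) by rewrite /ell2 /= /sqnorm; apply: le_lt_trans h _; rewrite ltry.
split => //; rewrite -lee_fin -sqnormE//.
Qed.

(** The inner sums are bounded by 1 + |f|^2 uniformly in m, rows being unit vectors, and the outer
    sum by the l1 norm of row y. The weight w is 1 for [transK] and the spectral weight for the
    kernel. *)
Lemma trans_fubini (w : int -> C) f y : (forall m, cabs (w m) <= 1) -> ell2 f ->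
  csumm (fun z : int * int => (M y z.1)%:C * w z.1 * ((M z.1 z.2)%:C * f z.2)).
Proof.
move=> w1 sf; have /ell2P sf2 := sf.
have key m : psum (fun x => cabs ((M m x)%:C * f x)) <= 1 + sqnR f.
  have [s1 e1] := Morth m m.
  have sM := (ell2P (row m)).1 (row_ell2 m).
  have n1 : psum (fun x => cabs (row m x) ^+ 2) = 1.
    by rewrite -/(sqnR _); apply: rcI; rewrite -ip_sqnR row_ip eqxx.
  rewrite -n1 /sqnR -psumD//; try by move=> x; rewrite sqr_ge0.
  apply: le_psum => [x|x|]; [exact: cabs_ge0| |exact: summD].
  rewrite cabsM -/(row m x); have := cabs_ge0 (f x); have := cabs_ge0 (row m x).
  by move: (cabs (f x)) (cabs (row m x)) => a b; nra.
apply: (csumm_pair (a := fun m x => (M y m)%:C * w m * ((M m x)%:C * f x))) => [m|].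
  by apply: csummZ; exact: trans_summ.
apply: le_summ (summZ (1 + sqnR f) (Ml1 y)) => m.
have n0 := sqnR_ge0 f.
rewrite ger0_norm; last by apply: psum_ge0 => x; exact: cabs_ge0.
rewrite ger0_norm; last by rewrite mulr_ge0 ?cabs_ge0//; lra.
rewrite (_ : (fun x => _) = fun x => cabs ((M y m)%:C * w m) * cabs ((M m x)%:C * f x)); last first.
  by apply/funext => x; rewrite cabsM.
rewrite psumZ ?cabs_ge0//; last by move=> x; exact: cabs_ge0.
rewrite mulrC; apply: ler_pM => //; [by apply: psum_ge0 => x; exact: cabs_ge0|exact: cabs_ge0|].
by rewrite cabsM ler_piMr ?cabs_ge0.
Qed.

(** By symmetry the columns are orthonormal as well, so the inner sum over m is a Kronecker delta
    after the exchange. *)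
Lemma transK f : ell2 f -> trans (trans f) = f.
Proof.
move=> sf; apply/funext => y.
have w1 (m : int) : cabs (1 : C) <= 1 by rewrite cabs1.
have sF := trans_fubini (w := fun=> 1) y w1 sf.
rewrite {1}/trans.
transitivity (csum (fun m => csum (fun x => (M y m)%:C * 1 * ((M m x)%:C * f x)))).
  congr csum; apply/funext => m; rewrite /trans -(csumZ _ (trans_summ m sf)).
  by congr csum; apply/funext => x; rewrite mulr1.
rewrite (csum_exchange (a := fun m x => (M y m)%:C * 1 * ((M m x)%:C * f x)) sF).
have key x : csum (fun m => (M y m)%:C * 1 * ((M m x)%:C * f x)) = f x * (y == x)%:R.
  have [s e] := Morth y x; rewrite -e -(csumZ (f x) s); congr csum; apply/funext => m.
  by rewrite rcM (Msym m x); ring.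
rewrite (csum_single (i0 := y)); first by rewrite key eqxx mulr1.
by move=> x xy; rewrite key eq_sym (negPf xy) mulr0.
Qed.

(** Bessel's inequality makes the transform a contraction, and an involutive contraction is an
    isometry. *)
Lemma trans_sqnR f : ell2 f -> sqnR (trans f) = sqnR f.
Proof.
move=> sf; have [s1 l1] := trans_ell2 sf; have [s2 l2] := trans_ell2 s1.
by apply/eqP; rewrite eq_le l1 -{1}(transK sf).
Qed.

Lemma trans_isometry f g : ell2 f -> ell2 g -> ip (trans f) (trans g) = ip f g.
Proof.
apply: sqnR_isometry_ip => //; [by move=> h /trans_ell2[]|exact: transD|exact: trans_sqnR].
Qed.

End Involution.

(** * Spectral measures and eigenvectors *)

Section Concentration.
Variable R : realType.
Variable mu : {measure set R -> \bar R}.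
Local Open Scope ereal_scope.

(** The function s (t - l) is positive almost everywhere but its integral is 0, so mu is zero; the
    sign of s selects the side of l. Integrability of t comes from |t| <= 1 + t^2. *)
Lemma mean_boundary_null (s l M : R) : mu setT = M%:E ->
  \int[mu]_t (t ^+ 2)%:E < +oo -> mu [set t | (s * (t - l) <= 0)%R] = 0 ->
  (\int[mu]_t t = l * M)%R -> M = 0%R.
Proof.
move=> muT t2 muN hl; have mT : measurable [set: R] by exact: measurableT.
have mid : measurable_fun [set: R] (@id R) by exact: measurable_id.
have i1 : mu.-integrable setT (fun=> 1 : \bar R).
  apply/integrableP; split; first exact: measurable_cst.
  under eq_integral do rewrite abse1.
  by rewrite integral_cst// mul1e; rewrite muT ltry.
have i2 : mu.-integrable setT (fun t : R => (t ^+ 2)%:E).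
  apply/integrableP; split; first by apply/measurable_EFinP; exact: measurable_funX.
  by under eq_integral do rewrite gee0_abs ?lee_fin ?sqr_ge0//.
have it : mu.-integrable setT (fun t : R => t%:E).
  apply: le_integrable (integrableD mT i1 i2) => //; first exact/measurable_EFinP.
  move=> t _; rewrite -EFinD !abse_EFin lee_fin [leRHS]ger0_norm ?addr_ge0 ?sqr_ge0//.
  by rewrite -(real_normK (num_real t)); have := sqr_ge0 (`|t| - 1)%R; have := normr_ge0 t; nra.
have il : mu.-integrable setT (fun t : R => (s * (t - l))%:E).
  have := integrableZl mT s (integrableB mT it (integrableZl mT l i1)).
  by apply: eq_integrable => // t _; rewrite mule1 -EFinB -EFinM.
have e0 : \int[mu]_t (s * (t - l))%:E = 0.
  have it' := integrableZl mT l i1.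
  under eq_integral do rewrite EFinM EFinB -[l%:E]mule1.
  rewrite integralZl//; last exact: integrableB.
  rewrite integralB// integralZl// integral_cst// mul1e.
  have -> : \int[mu]_t t%:E = (l * M)%:E.
    by rewrite -hl /Rintegral fineK//; exact: integrable_fin_num.
  by rewrite [X in X - _]EFinM muT subee// mule0.
pose N := [set t : R | (s * (t - l) <= 0)%R].
have mf : measurable_fun [set: R] (fun t => (s * (t - l))%R).
  by apply: measurable_funM => //; exact: measurable_funB.
have mN : measurable N.
  rewrite (_ : N = (fun t => (s * (t - l))%R) @^-1` `]-oo, 0%R]); last first.
    by apply/seteqP; split => t; rewrite /N /= in_itv.
  by rewrite -[X in measurable X]setTI; exact: mf.
have mC := measurableC mN.
have mfC : measurable_fun (~` N) (EFin \o (fun t => (s * (t - l))%R)).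
  by apply/measurable_EFinP; exact: measurable_funTS.
have : \int[mu]_(t in ~` N) `|(EFin \o (fun t => (s * (t - l))%R)) t| = 0.
  rewrite -[RHS]e0 (negligible_integral mN mT il muN) setTD.
  apply: eq_integral => t; rewrite inE /= => /negP; rewrite -ltNge => h.
  by rewrite gtr0_norm.
move=> /(ae_eq_integral_abs mu mC mfC) [Z [mZ Z0 hZ]].
have C0 : mu (~` N) = 0.
  apply: (subset_measure0 mC mZ _ Z0) => t Nt; apply: hZ => /(_ Nt) /= [h].
  by apply: Nt; rewrite /N /= h.
have e : mu (N `|` ~` N) = mu N + mu (~` N) by apply: measureU => //; exact: setICr.
by apply/eqP; rewrite -eqe -muT -(setUv N) e C0 adde0; apply/eqP.
Qed.

End Concentration.

(** * Eigenvectors under an arbitrary spectral measure *)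

Section Uniqueness.
Variable R : realType.
Local Notation C := R[i].
Implicit Types f g : int -> C.
Variables (D : operator R) (E : set R -> operator R).
Hypothesis DD : forall (a : C) f g,
  D (fun x => f x + a * g x) = fun x => D f x + a * D g x.
Let dom : set (int -> C) := [set f | ell2 f /\ ell2 (D f)].
Hypothesis hE : is_spectral_measure dom D E.

Let mE A : measurable A -> is_orthoprojection (E A).
Proof. by move=> mA; case: hE => [[h _ _] _]; exact: h. Qed.

Let E_ell2 A f : measurable A -> ell2 f -> ell2 (E A f).
Proof. by move=> /mE[h _ _ _]; exact: h. Qed.

Lemma proj_lin A (a : C) f g : measurable A -> ell2 f -> ell2 g ->
  E A (fun x => f x + a * g x) = fun x => E A f x + a * E A g x.
Proof.
move=> /mE[_ h _ _] sf sg; rewrite (_ : (fun x => _) = fun x => a * g x + f x).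
  by rewrite h//; apply/funext => x; rewrite addrC.
by apply/funext => x; rewrite addrC.
Qed.

Lemma proj_ip A f g : measurable A -> ell2 f -> ell2 g -> ip (E A f) g = ip f (E A g).
Proof.
move=> mA sf sg; case: (mE mA) => [_ _ _ h].
by have := h f g sf sg; rewrite !dotE//; exact: E_ell2.
Qed.

Lemma proj_idem A f : measurable A -> ell2 f -> E A (E A f) = E A f.
Proof. by move=> /mE[_ _ h _]; exact: h. Qed.

Lemma scalar_measure f : ell2 f -> exists mu : {measure set R -> \bar R},
  is_scalar_measure E f mu /\ forall A, measurable A -> mu A = (sqnR (E A f))%:E.
Proof.
move=> sf; case: hE => [[_ _ h] _]; have [mu hmu] := h f sf; exists mu; split => // A mA.
by rewrite hmu// sqnormE//; exact: E_ell2.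
Qed.

Lemma proj_setT f : ell2 f -> E setT f = f.
Proof. by case: hE => [[_ h _] _]; exact: h. Qed.

Lemma sqnR_projU A B f : measurable A -> measurable B -> A `&` B = set0 -> ell2 f ->
  sqnR (E (A `|` B) f) = sqnR (E A f) + sqnR (E B f).
Proof.
move=> mA mB AB sf; have [mu [_ hmu]] := scalar_measure sf.
apply: EFin_inj; rewrite EFinD -!hmu//; [exact: measureU|exact: measurableU].
Qed.

Lemma sqnR_proj_le A f : measurable A -> ell2 f -> sqnR (E A f) <= sqnR f.
Proof.
move=> mA sf; rewrite -[in leRHS](proj_setT sf) -(setUv A) sqnR_projU ?setICr//.
  by rewrite lerDl sqnR_ge0.
exact: measurableC.
Qed.

Lemma proj_eq0 A f : measurable A -> ell2 f -> sqnR (E A f) = 0 -> E A f = fun=> 0.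
Proof. by move=> mA sf h; apply/funext => x; apply: sqnR_eq0 => //; exact: E_ell2. Qed.

(** For g = E A f, additivity gives |E (A u B) g|^2 = |g|^2 + |E B g|^2, and the left-hand side is
    at most |g|^2. *)
Lemma proj_disjoint A B f : measurable A -> measurable B -> A `&` B = set0 -> ell2 f ->
  E B (E A f) = fun=> 0.
Proof.
move=> mA mB AB sf; have sA := E_ell2 mA sf; apply: proj_eq0 => //.
have := sqnR_proj_le (measurableU _ _ mA mB) sA.
rewrite sqnR_projU// proj_idem// gerDl => h.
by apply/eqP; rewrite eq_le h sqnR_ge0.
Qed.

Lemma proj_id A f : measurable A -> ell2 f -> sqnR (E A f) = sqnR f -> E A f = f.
Proof.
move=> mA sf h; have sA := E_ell2 mA sf.
have : sqnR (fun x => f x + (-1) * E A f x) = 0.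
  rewrite sqnRD// -{2}(proj_idem mA sf) -proj_ip// ip_sqnR h cabsN cabs1.
  by rewrite conjcN conjc1 mulN1r raddfN /=; lra.
move=> /sqnR_eq0 h0; apply/funext => x; apply/eqP; rewrite eq_sym -subr_eq0 -mulN1r.
by rewrite h0//; apply: ell2D => //; exact: ell2Z.
Qed.

Lemma proj_compl A f : measurable A -> ell2 f -> E A f = (fun=> 0) -> E (~` A) f = f.
Proof.
move=> mA sf h; have mC := measurableC mA; apply: proj_id => //.
rewrite -[in RHS](proj_setT sf) -(setUv A) sqnR_projU ?setICr// h.
by rewrite -[LHS]add0r; congr (_ + _); rewrite /sqnR /psum esum1// => x _; rewrite cabs0 expr0n.
Qed.

Section Eigenvector.
Variables (f : int -> C) (l : R).
Hypotheses (sf : ell2 f) (Df : D f = fun x => l%:C * f x).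

Let df : dom f. Proof. by split => //; rewrite Df; exact: ell2Z. Qed.

Section Component.
Variable A : set R.
Hypothesis mA : measurable A.
Let h := E A f.
Let sh : ell2 h. Proof. exact: E_ell2. Qed.

(* The squared norm of E B (f + u * h) splits into those of E (B `&` A) h, where
   the phase 1 + u is invisible, and of E (B `&` ~` A) (f - h). *)
Lemma scalar_measure_rotation (u : C) (mu : {measure set R -> \bar R}) :
  cabs (1 + u) = 1 -> is_scalar_measure E f mu ->
  is_scalar_measure E (fun x => f x + u * h x) mu.
Proof.
move=> u1 hmu B mB; rewrite hmu// !sqnormE; last 2 first.
- by apply: E_ell2 => //; apply: ell2D => //; exact: ell2Z.
- exact: E_ell2.
have mC := measurableC mA; have mBA := measurableI _ _ mB mA.
have mBC := measurableI _ _ mB mC.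
have EB v : ell2 v -> sqnR (E B v) = sqnR (E (B `&` A) v) + sqnR (E (B `&` ~` A) v).
  move=> sv; rewrite -sqnR_projU//; first by rewrite -setIUr setUv setIT.
  by rewrite setIACA setICr setI0.
have hC : E (B `&` ~` A) h = fun=> 0.
  apply: proj_disjoint => //.
  by rewrite setIC -setIA [~` A `&` _]setIC setICr setI0.
pose g : int -> C := fun x => f x + (-1) * h x.
have sg : ell2 g by apply: ell2D => //; exact: ell2Z.
have gA : E (B `&` A) g = fun=> 0.
  have Eg0 : E A g = fun=> 0.
    rewrite /g proj_lin// proj_idem//; apply/funext => x.
    by rewrite mulN1r subrr.
  rewrite -(proj_compl mA sg Eg0); apply: proj_disjoint => //.
  by rewrite setIC -setIA setICr setI0.
rewrite !EB//; last by apply: ell2D => //; exact: ell2Z.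
have fE : f = fun x => g x + 1 * h x by apply/funext => x; rewrite /g; ring.
have fuE : (fun x => f x + u * h x) = fun x => g x + (1 + u) * h x.
  by apply/funext => x; rewrite /g; ring.
clearbody g; have key (w : C) : cabs w = 1 ->
    sqnR (E (B `&` A) (fun x => g x + w * h x)) +
    sqnR (E (B `&` ~` A) (fun x => g x + w * h x)) =
    sqnR (E (B `&` A) h) + sqnR (E (B `&` ~` A) g).
  move=> w1; rewrite !proj_lin// gA hC; congr (_ + _).
    by congr psum; apply/funext => x; rewrite add0r cabsM w1 mul1r.
  by congr psum; apply/funext => x; rewrite mulr0 addr0.
by rewrite fuE key// {1 2}fE key// cabs1.
Qed.

(* Polarization over the phases 1 + u = -1 and 1 + u = 'i. *)
Lemma component_mean : dom h /\ ip (D h) h = l%:C * ip h h.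
Proof.
have [mu [hmu _]] := scalar_measure sf.
case: hE => _ hE2; have [dmu1 dmu2] := hE2 f mu sf hmu.
have sfu u : ell2 (fun x => f x + u * h x) by apply: ell2D => //; exact: ell2Z.
have key w : cabs w = 1 -> let u := w - 1 in dom (fun x => f x + u * h x) /\
    ip (D (fun x => f x + u * h x)) (fun x => f x + u * h x) = l%:C * ip f f.
  move=> w1 u; have u1 : cabs (1 + u) = 1 by rewrite addrC subrK.
  have hmu' := scalar_measure_rotation u1 hmu.
  have [d1 d2] := hE2 _ mu (sfu u) hmu'.
  have du : dom (fun x => f x + u * h x) by apply/d1/dmu1.
  split => //; rewrite -dotE//; last by case: du.
  by rewrite d2// -dmu2// dotE//; [rewrite Df ipZl|case: df].
have cN1 : cabs (-1 : C) = 1 by rewrite cabsN cabs1.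
have [i [ci iC i2]] : exists i : C, [/\ cabs i = 1, conjc i = - i & i ^+ 2 = - 1].
  exists 'i; split; [|by apply/eqP; rewrite eq_complex /= oppr0 !eqxx|exact: sqr_i].
  by apply/eqP; rewrite -sqrp_eq1 ?cabs_ge0// cabs_sqr /= expr0n expr1n add0r.
(* For w = -1 the vector f - 2 h is in the domain; being linear, D then maps h into l2 as well. *)
have dh : dom h.
  split => //; have [[_ d] _] := key _ cN1; rewrite DD in d.
  have := ell2Z (2^-1) (ell2D df.2 (ell2Z (-1) d)).
  by congr (ell2 _); apply/funext => x; field.
split => //; have sDh := dh.2; have sDf := df.2.
have ex w : cabs w = 1 -> (w - 1) * ip (D h) f + (conjc w - 1) * (l%:C * ip h h) +
    (w - 1) * (conjc w - 1) * ip (D h) h = 0.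
  have -> : conjc w - 1 = conjc (w - 1) by rewrite conjcD conjcN conjc1.
  move=> /key[_] /= + ; set u := w - 1 => e; have suD := ell2Z u sDh; have suh := ell2Z u sh.
  have ifh : ip f h = ip h h by rewrite {2}/h proj_ip// proj_idem.
  move: e; rewrite DD (ipDl sDf suD (sfu u)) (ipDr sDf sf suh) (ipDr suD sf suh).
  rewrite (ipZr u sDf sh) (ipZl u sDh sf) (ipZl u sDh suh) (ipZr u sDh sh).
  rewrite Df (ipZl _ sf sf) (ipZl _ sf sh) ifh => e.
  by apply: (addrI (l%:C * ip f f)); rewrite addr0 -[RHS]e; ring.
have := ex _ cN1; have := ex _ ci; rewrite conjcN conjc1 iC.
move: (ip (D h) f) (l%:C * ip h h) (ip (D h) h) => p q r e1 e2.
have i0 : 2 * i != 0.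
  by rewrite mulf_neq0// ?pnatr_eq0// -sqrf_eq0 i2 oppr_eq0 oner_eq0.
apply: (mulfI i0); apply/eqP; rewrite -subr_eq0; apply/eqP.
(* The relation for w = i minus (1 - i) / 2 times the one for w = -1 eliminates the unknown p = <D
   h, f>. *)
have -> : 2 * i * r - 2 * i * q = (i - 1) * p + (- i - 1) * q + (i - 1) * (- i - 1) * r
   - (1 - i) / 2 * ((-1 - 1) * p + (- 1 - 1) * q + (-1 - 1) * (-1 - 1) * r)
   + (i ^+ 2 + 1) * r by field.
by rewrite e1 e2 i2; ring.
Qed.

(** The scalar measure of h lives strictly on one side of l, yet its mean is l times its mass. *)
Lemma component_eq0 (s : R) : A = [set t | 0 < s * (t - l)] -> E A f = fun=> 0.
Proof.
move=> AE; apply: proj_eq0 => //; rewrite -/h.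
have [dh mh] := component_mean; have [mu [hmu muE]] := scalar_measure sh.
case: hE => _ hE2; have [dmu1 dmu2] := hE2 h mu sh hmu.
apply: (mean_boundary_null (mu := mu) (s := s) (l := l)).
- by rewrite muE// proj_setT.
- exact/dmu1.
- rewrite (_ : [set t | s * (t - l) <= 0] = ~` A).
    rewrite muE; last exact: measurableC.
    rewrite proj_disjoint ?setICr//; last exact: measurableC.
    by congr EFin; rewrite /sqnR /psum esum1// => x _; rewrite cabs0 expr0n.
  by rewrite AE; apply/seteqP; split => t /=; [rewrite leNgt => /negP|move=> /negP; rewrite -leNgt].
- by apply: (@rcI R); rewrite -dmu2// dotE//; [rewrite mh rcM ip_sqnR|case: dh].
Qed.

End Component.

Lemma measurable_side (s : R) : measurable [set t : R | 0 < s * (t - l)].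
Proof.
have mid : measurable_fun [set: R] (@id R) by exact: measurable_id.
have mf : measurable_fun [set: R] (fun t : R => s * (t - l)).
  by apply: measurable_funM => //; exact: measurable_funB.
rewrite (_ : [set t | _] = (fun t : R => s * (t - l)) @^-1` `]0, +oo[); last first.
  by apply/seteqP; split => t; rewrite /= in_itv /= andbT.
by rewrite -[X in measurable X]setTI; exact: mf.
Qed.

(** A set avoiding l is covered by the two open half-lines around l, where f has no component; if l
    is in A, this is applied to the complement of A. *)
Lemma proj_eigenvector A : measurable A -> E A f = fun x => (\1_A l : R)%:C * f x.
Proof.
have key B : measurable B -> ~ B l -> E B f = fun=> 0.
  move=> mB Bl; have [mu [_ muE]] := scalar_measure sf.
  have m1 := measurable_side 1; have m2 := measurable_side (-1).
  apply: proj_eq0 => //; apply: EFin_inj; rewrite -muE//.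
  have n0 : sqnR (fun _ : int => 0 : C) = 0.
    by rewrite /sqnR /psum esum1// => x _; rewrite cabs0 expr0n.
  apply: (subset_measure0 mB (measurableU _ _ m1 m2)).
    move=> t Bt; rewrite /setU /= mul1r mulN1r oppr_gt0 subr_gt0 subr_lt0.
    by case: (ltgtP t l) => [h|h|h]; [right|left|rewrite h in Bt].
  apply: etrans (muE _ (measurableU _ _ m1 m2)) _; rewrite sqnR_projU//; last first.
    apply/seteqP; split => // t; rewrite /setI /= mul1r mulN1r oppr_gt0 => -[h1 h2].
    by have := lt_trans h1 h2; rewrite ltxx.
  by rewrite !(component_eq0 _ erefl)// n0 addr0.
move=> mA; have [Al|Al] := pselect (A l).
  rewrite -[in LHS](setCK A) proj_compl//; [|exact: measurableC|by apply: key; [exact: measurableC|]].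
  by apply/funext => x; rewrite indicE mem_set// mul1r.
by rewrite key//; apply/funext => x; rewrite indicE memNset// mul0r.
Qed.

End Eigenvector.
End Uniqueness.

(** * Operators diagonal in an orthonormal basis *)

Section AtomicMeasure.
Variable R : realType.
Variables (c : int -> R) (lam : int -> R).
Hypothesis c0 : forall m, 0 <= c m.

Definition atoms (i : nat -> int) (n : nat) : {measure set R -> \bar R} :=
  mscale (NngNum (c0 (i n))) (dirac (lam (i n))).

(** Masses [c m] at the points [lam m]; countable sums of measures are indexed by [nat], hence one
    series for each half of the integers. *)
Definition atomic : {measure set R -> \bar R} :=
  measure_add (mseries (atoms Posz) 0) (mseries (atoms Negz) 0).

Local Open Scope ereal_scope.

Lemma integral_atomic (g : R -> \bar R) : measurable_fun setT g ->
  (forall t, 0 <= g t) ->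
  \int[atomic]_t g t = \esum_(m in [set: int]) ((c m)%:E * g (lam m)).
Proof.
move=> mg g0; rewrite esum_int; last by move=> m; rewrite mule_ge0// lee_fin.
rewrite ge0_integral_measure_add//.
have key (i : nat -> int) : \int[mseries (atoms i) 0]_t g t =
    \esum_(n in [set: nat]) ((c (i n))%:E * g (lam (i n))).
  rewrite ge0_integral_measure_series// -nneseries_esumT; last first.
    by move=> n; rewrite mule_ge0// lee_fin.
  apply: eq_eseriesr => n _.
  by rewrite ge0_integral_mscale// integral_dirac// diracT mul1e.
by rewrite !key.
Qed.

Lemma atomicE (A : set R) : measurable A ->
  atomic A = \esum_(m in [set: int]) (c m * \1_A (lam m))%:E.
Proof.
move=> mA; rewrite -[A in LHS]setIT -(integral_indic _ measurableT mA).
rewrite integral_atomic; first by apply: eq_esum => m _; rewrite EFinM.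
  by apply/measurable_EFinP; exact: measurable_indic.
by move=> t; rewrite lee_fin.
Qed.

Lemma Rintegral_atomic : summ (fun m => (c m * lam m)%R) ->
  (\int[atomic]_t t)%R = rsum (fun m => (c m * lam m)%R).
Proof.
move=> s; rewrite /Rintegral integralE.
have key (h : R -> R) : measurable_fun setT h -> (forall t, (0 <= h t)%R) ->
    \int[atomic]_t (h t)%:E = \esum_(m in [set: int]) (c m * h (lam m))%R%:E.
  move=> mh h0; rewrite integral_atomic//; first exact/measurable_EFinP.
have mid : measurable_fun setT (@id R) by exact: measurable_id.
have Ep : \int[atomic]_t (EFin : R -> \bar R)^\+ t = \int[atomic]_t (rpos t)%:E.
  by apply: eq_integral => t _; rewrite funeposE -EFin_max.
have En : \int[atomic]_t (EFin : R -> \bar R)^\- t = \int[atomic]_t (rpos (- t))%:E.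
  by apply: eq_integral => t _; rewrite funenegE -EFinN -EFin_max.
rewrite Ep En !key; try by [move=> t; exact: rpos_ge0];
  try by apply: measurable_maxr => //; exact: measurable_funN.
have rposM m x : (c m * rpos x = rpos (c m * x))%R.
  by rewrite /rpos maxr_pMr// mulr0.
under eq_esum do rewrite rposM.
under [X in (_ - X)%E]eq_esum do rewrite rposM mulrN.
rewrite /rsum fineB; [by []|rewrite -psumE//|rewrite -psumE//].
- by move=> m; exact: rpos_ge0.
- exact: summ_pos.
- by move=> m; exact: rpos_ge0.
- exact: (summ_pos (summN s)).
Qed.

End AtomicMeasure.

(** * Spectral measure of an operator that [W] turns into multiplication by [lam] *)

Section Diagonalization.
Variable R : realType.
Local Notation C := R[i].
Implicit Types f g : int -> C.
Variables (lam : int -> R) (W V D : operator R).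
Hypothesis Well2 : forall f, ell2 f -> ell2 (W f).
Hypothesis Vell2 : forall f, ell2 f -> ell2 (V f).
Hypothesis WD : forall (a : C) f g, ell2 f -> ell2 g ->
  W (fun x => f x + a * g x) = fun x => W f x + a * W g x.
Hypothesis VD : forall (a : C) f g, ell2 f -> ell2 g ->
  V (fun x => f x + a * g x) = fun x => V f x + a * V g x.
Hypothesis WV : forall f, ell2 f -> W (V f) = f.
Hypothesis VW : forall f, ell2 f -> V (W f) = f.
Hypothesis Wip : forall f g, ell2 f -> ell2 g -> ip (W f) (W g) = ip f g.
Let dom : set (int -> C) := [set f | ell2 f /\ ell2 (D f)].
Hypothesis WDop : forall f, dom f -> W (D f) = fun m => (lam m)%:C * W f m.
Hypothesis DV : forall f, ell2 f -> ell2 (fun m => (lam m)%:C * W f m) ->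
  D f = V (fun m => (lam m)%:C * W f m).

Definition cut (A : set R) f : int -> C := fun m => (\1_A (lam m) : R)%:C * f m.

Definition Esp (A : set R) : operator R := fun f => V (cut A (W f)).

Lemma cut_ell2 A f : ell2 f -> ell2 (cut A f).
Proof.
apply: ell2_le => m; rewrite /cut cabsM indicE.
by case: (lam m \in A); rewrite ?cabs1 ?cabs0 ?mul1r// mul0r cabs_ge0.
Qed.

Lemma Esp_ell2 A f : ell2 f -> ell2 (Esp A f).
Proof. by move=> sf; apply/Vell2/cut_ell2/Well2. Qed.

Lemma W_Esp A f : ell2 f -> W (Esp A f) = cut A (W f).
Proof. by move=> sf; rewrite /Esp WV//; exact/cut_ell2/Well2. Qed.

Lemma W_sqnR f : ell2 f -> sqnR (W f) = sqnR f.
Proof. by move=> sf; apply: rcI; rewrite -!ip_sqnR Wip. Qed.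

Lemma dom_lam f : ell2 f -> dom f <-> ell2 (fun m => (lam m)%:C * W f m).
Proof.
move=> sf; split => [df|sl]; first by rewrite -WDop//; apply: Well2; case: df.
by split => //; rewrite DV//; exact: Vell2.
Qed.

Lemma Esp_projection A : is_orthoprojection (Esp A).
Proof.
split=> [f|a f g sf sg|f sf|f g sf sg]; first exact: Esp_ell2.
- have cutD (u v : int -> C) (b : C) :
    cut A (fun m => v m + b * u m) = fun m => cut A v m + b * cut A u m.
    by apply/funext => m; rewrite /cut; ring.
  rewrite (_ : (fun x => a * f x + g x) = fun x => g x + a * f x); last first.
    by apply/funext => x; rewrite addrC.
  rewrite /Esp WD// cutD VD; [|exact/cut_ell2/Well2|exact/cut_ell2/Well2].
  by apply/funext => x; rewrite addrC.
- rewrite {1}/Esp W_Esp// /Esp; congr V; apply/funext => m; rewrite /cut mulrA -rcM.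
  by rewrite indicE; case: (lam m \in A); rewrite ?mulr1 ?mulr0.
- have s1 := Esp_ell2 A sf; have s2 := Esp_ell2 A sg.
  rewrite !dotE// -Wip// -[RHS]Wip// !W_Esp// /ip /cut.
  congr csum; apply/funext => m; rewrite conjcM conjc_real; ring.
Qed.

Let sqW f m : R := cabs (W f m) ^+ 2.

Let sqW0 f m : 0 <= sqW f m. Proof. exact: sqr_ge0. Qed.

Lemma sqnorm_cut A f : ell2 f ->
  sqnorm (Esp A f) = (\esum_(m in [set: int]) (sqW f m * \1_A (lam m))%:E)%E.
Proof.
move=> sf; have s1 := Esp_ell2 A sf; rewrite sqnormE// -W_sqnR// W_Esp// -sqnormE; last first.
  exact/cut_ell2/Well2.
apply: eq_esum => m _; congr EFin; rewrite -/(cabs _) /cut cabsM exprMn /sqW mulrC.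
by rewrite indicE; case: (lam m \in A); rewrite ?cabs1 ?cabs0 ?expr1n ?expr0n.
Qed.

Lemma Esp_measure f : ell2 f -> is_scalar_measure Esp f (atomic lam (sqW0 f)).
Proof. by move=> sf A mA; rewrite sqnorm_cut// atomicE. Qed.

(** The scalar measure of f has mass |W f m|^2 at [lam m], so the integral of t^2 is the squared
    norm of [lam] times [W f], finite exactly on the domain, and the mean of t is <D f, f> by
    isometry. *)
Lemma Esp_spectral : is_spectral_measure dom D Esp.
Proof.
split; first split => [A _|f sf|f sf].
- exact: Esp_projection.
- rewrite /Esp (_ : cut setT (W f) = W f) ?VW//.
  by apply/funext => m; rewrite /cut indicT mul1r.
- by exists (atomic lam (sqW0 f)); exact: Esp_measure.
move=> f mu sf hmu.
have muE (A : set R) : measurable A -> mu A = atomic lam (sqW0 f) A.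
  by move=> mA; rewrite hmu// Esp_measure.
split.
  rewrite (eq_measure_integral (atomic lam (sqW0 f))); last by move=> A mA _; exact: muE.
  rewrite integral_atomic; last 2 first.
  - by apply/measurable_EFinP; exact: measurable_funX.
  - by move=> t; rewrite lee_fin sqr_ge0.
  rewrite dom_lam//.
  have -> : (\esum_(m in [set: int]) ((sqW f m)%:E * (lam m ^+ 2)%:E) =
    sqnorm (fun m => (lam m)%:C * W f m)%R)%E; last by [].
  apply: eq_esum => m _; rewrite -EFinM -/(cabs _); congr EFin.
  by rewrite cabsM cabsr exprMn real_normK ?num_real// mulrC.
move=> df; have sl := (dom_lam sf).1 df; have sW := Well2 sf; have sDf := df.2.
rewrite dotE// -Wip// WDop//.
have -> : ip (fun m => (lam m)%:C * W f m) (W f) = csum (fun m => (sqW f m * lam m)%:C).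
  rewrite /ip; congr csum; apply/funext => m; rewrite -mulrA mulcJ rcM mulrC//.
have s : summ (fun m => sqW f m * lam m).
  have := ip_summ sl sW; apply: le_summ => m.
  rewrite !cabsM cabsJ cabsr /sqW.
  have n0 := mulr_ge0 (mulr_ge0 (normr_ge0 (lam m)) (cabs_ge0 (W f m))) (cabs_ge0 (W f m)).
  rewrite (ger0_norm n0) normrM (ger0_norm (sqr_ge0 (cabs (W f m)))).
  by move: `|lam m| (cabs _) => a b; rewrite le_eqVlt; apply/orP; left; apply/eqP; ring.
rewrite csum_real -(Rintegral_atomic (sqW0 f) s); congr (_%:C).
by rewrite /Rintegral; congr fine; apply: eq_measure_integral => A mA _; rewrite muE.
Qed.

Hypothesis DD : forall (a : C) f g,
  D (fun x => f x + a * g x) = fun x => D f x + a * D g x.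

Let del (m : int) : int -> C := fun x => (x == m)%:R.

Let del_ell2 m : ell2 (del m).
Proof.
apply/ell2P; rewrite /summ; have -> : (\esum_(x in [set: int]) `|cabs (del m x) ^+ 2|%:E =
   \esum_(x in [set m]) 1)%E.
  rewrite [RHS]esum_mkcond; apply: eq_esum => x _; rewrite /del.
  case: eqP => [->|h]; first by rewrite mem_set// cabs1 expr1n normr1.
  by rewrite memNset// cabs0 expr0n normr0.
by rewrite esum_set1// ltry.
Qed.

(** The vectors [V (del m)] are eigenvectors, on which [proj_eigenvector] determines any spectral
    measure; pairing [E A f] with them gives all its coordinates. *)
Lemma spectral_measure_unique E A f : is_spectral_measure dom D E -> measurable A ->
  ell2 f -> E A f = Esp A f.
Proof.
move=> hE mA sf; have sE : ell2 (E A f) by case: hE => [[h _ _] _]; case: (h _ mA) => k _ _ _; exact: k.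
rewrite -[LHS]VW//; congr V; apply/funext => m.
have ip_del g : ip g (del m) = g m.
  rewrite /ip (csum_single (i0 := m)); first by rewrite /del eqxx conjc1 mulr1.
  by move=> x xm; rewrite /del (negPf xm) conjc0 mulr0.
have sd := del_ell2 m; have sV := Vell2 sd.
have WVd := WV sd.
(* The multiple of [del m] is written in the form v + b w in which linearity of [V] is stated. *)
have lamd : (fun k => (lam k)%:C * W (V (del m)) k) = fun k => del m k + ((lam m)%:C - 1) * del m k.
  apply/funext => k; rewrite WVd /del; by case: (k =P m) => [->|_] /=; rewrite ?mulr1n ?mulr0n; ring.
have DV_del : D (V (del m)) = fun x => (lam m)%:C * V (del m) x.
  rewrite DV//; last by rewrite lamd; apply: ell2D => //; exact: ell2Z.
  by rewrite lamd VD//; apply/funext => x; ring.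
rewrite -[LHS]ip_del -WVd Wip// (proj_ip hE mA sf sV) (proj_eigenvector DD hE sV DV_del mA).
by rewrite ipZr// conjc_real -Wip// WVd ip_del.
Qed.

Lemma spectral_projectionE A f : measurable A -> ell2 f ->
  spectral_projection dom D A f = Esp A f.
Proof.
move=> mA sf; apply: spectral_measure_unique => //.
apply: (@xgetPex _ (fun _ f => f) [set E | is_spectral_measure dom D E]).
by exists Esp; exact: Esp_spectral.
Qed.

End Diagonalization.

(** * The difference operator and its spectral projections *)

Section GaugeSign.
Variable R : realType.

(* The sign (-1) ^ min(x, 0) of the functions denoted phi tilde. *)
Definition gauge (x : int) : R := (-1) ^ Num.min x 0.

Let N10 : (-1 : R) != 0. Proof. by rewrite oppr_eq0 oner_eq0. Qed.

Lemma gauge_sqr x : gauge x * gauge x = 1.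
Proof. by rewrite /gauge -expfzMl mulrNN mulr1 exp1rz. Qed.

Lemma gauge_succ x : (-1) ^+ (x < 0)%R * gauge (x + 1) = gauge x.
Proof.
rewrite /gauge; case: (ltP x 0) => h /=.
  by rewrite (min_l (_ : x + 1 <= 0)) ?expfzDr//; [rewrite !expr1 mulrCA mulrNN !mulr1|lia].
by rewrite min_r ?mul1r//; lia.
Qed.

Lemma gauge_pred x : (-1) ^+ (x <= 0)%R * gauge (x - 1) = gauge x.
Proof.
rewrite /gauge; case: (leP x 0) => h /=.
  rewrite (min_l (_ : x - 1 <= 0)) ?expfzDr//; last lia.
  by rewrite exprN1 invrN1 expr1 mulrCA mulrNN !mulr1.
by rewrite min_r ?mul1r//; lia.
Qed.

(** Since max(y, 0) = - min(- y, 0), the sign of the kernel is the product of the gauges at x and at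
    the reflected point - y. *)
Lemma gauge_minmax x y :
  ((-1) ^ (Num.min x 0 + Num.max y 0) : R[i]) = (gauge x * gauge (- y))%:C.
Proof.
rewrite /gauge -expfzDr// (fmorphXz (real_complex R)) rmorphN1 expfzDr ?oppr_eq0 ?oner_eq0//.
rewrite [RHS]expfzDr ?oppr_eq0 ?oner_eq0//; congr (_ * _).
have -> : Num.min (- y) 0 = - Num.max y 0 by rewrite oppr_max oppr0.
by rewrite -exprz_inv invrN1.
Qed.

End GaugeSign.

Lemma ell2_reindex (R : realType) (e : int -> int) (f : int -> R[i]) : bijective e ->
  ell2 (fun x => f (e x)) <-> ell2 f.
Proof.
move=> be; rewrite !ell2P; exact: (summ_reindex (fun x => cabs (f x) ^+ 2) be).
Qed.

Lemma ell2_shift (R : realType) (n : int) (f : int -> R[i]) :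
  ell2 (fun x => f (x + n)) <-> ell2 f.
Proof. by apply: ell2_reindex; exists (fun x => x - n) => x; ring. Qed.

(** * Jacobi operators diagonalized by a symmetric orthogonal matrix *)

Section Jacobi.
Variable R : realType.
Local Notation C := R[i].
Implicit Types f g : int -> C.
Variables (M : int -> int -> R) (a : int -> R) (b : R) (lam : int -> R).
Hypothesis Msym : forall m x, M m x = M x m.
Hypothesis Morth : forall m n,
  csumm (fun x => (M m x * M n x)%:C : C) /\
  csum (fun x => (M m x * M n x)%:C) = (m == n)%:R :> C.
Hypothesis Mmom : forall m, ell2 (fun x : int => x%:~R * (M m x)%:C : C).
Hypothesis Ma : forall m, ell2 (fun x => (a x)%:C * (M m x)%:C : C).
Hypothesis Ma1 : forall m, ell2 (fun x => (a (x - 1))%:C * (M m x)%:C : C).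
Hypothesis Mrec : forall m x, a x * M m (x + 1) + a (x - 1) * M m (x - 1) -
  x%:~R * b * M m x = lam m * M m x.

Definition jac f : int -> C := fun x =>
  (a x)%:C * f (x + 1) + (a (x - 1))%:C * f (x - 1) - (x%:~R * b)%:C * f x.

Let MrecC m x : (a x)%:C * (M m (x + 1))%:C + (a (x - 1))%:C * (M m (x - 1))%:C -
  (x%:~R * b)%:C * (M m x)%:C = (lam m)%:C * (M m x)%:C :> C.
Proof. by rewrite -(rcM (lam m)) -(Mrec m x) rcB rcD !(rcM _ (M _ _)). Qed.

(** Summation by parts: the three parts converge absolutely because the row stays in l2 when
    multiplied by x or by the off-diagonal entries, and index shifts move [jac] onto the row, an
    eigenvector. *)
Lemma trans_jac f m : ell2 f -> trans M (jac f) m = (lam m)%:C * trans M f m.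
Proof.
move=> sf; rewrite /trans -(csumZ _ (trans_summ Morth m sf)).
pose hA (x : int) : C := (M m x)%:C * ((a x)%:C * f (x + 1)).
pose hB (x : int) : C := (M m x)%:C * ((a (x - 1))%:C * f (x - 1)).
pose hC (x : int) : C := (M m x)%:C * (- (x%:~R * b)%:C * f x).
have sA : csumm hA.
  have := ell2_summ (Ma m) ((ell2_shift 1 f).2 sf).
  by congr csumm; apply/funext => x; rewrite /hA; ring.
have sB : csumm hB.
  have := ell2_summ (Ma1 m) ((ell2_shift (-1) f).2 sf).
  by congr csumm; apply/funext => x; rewrite /hB; ring.
have sC : csumm hC.
  have := csummZ (- b%:C) (ell2_summ (Mmom m) sf).
  by congr csumm; apply/funext => x; rewrite /hC rcM (rcZ R); ring.
have -> : (fun x => (M m x)%:C * jac f x) = fun x => hA x + hB x + hC x.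
  by apply/funext => x; rewrite /jac /hA /hB /hC; ring.
have sA' := (csumm_shift hA (-1)).2 sA; have sB' := (csumm_shift hB 1).2 sB.
rewrite (csumD (csummD sA sB) sC) (csumD sA sB).
rewrite -(csum_shift hA (-1)) -(csum_shift hB 1) -(csumD sA' sB').
rewrite -(csumD (csummD sA' sB') sC); congr csum; apply/funext => x.
rewrite /hA /hB /hC (subrK 1 x) (addrK 1 x) (mulrA (lam m)%:C) -MrecC.
by ring.
Qed.

(** At a fixed x only three convergent sums are combined; the symmetry of M lets the recurrence be
    applied under the sum over m. *)
Lemma jac_trans g : ell2 g -> jac (trans M g) = trans M (fun m => (lam m)%:C * g m).
Proof.
move=> sg; apply/funext => x; rewrite /jac /trans.
have s y := trans_summ Morth y sg.
rewrite -(csumZ _ (s (x + 1))) -(csumZ _ (s (x - 1))) -(csumZ _ (s x)).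
have s1 := csummZ (a x)%:C (s (x + 1)); have s2 := csummZ (a (x - 1))%:C (s (x - 1)).
rewrite -(csumD s1 s2) -(csumB (csummD s1 s2) (csummZ _ (s x))).
congr csum; apply/funext => m; rewrite (Msym (x + 1) m) (Msym (x - 1) m) (Msym x m).
by rewrite [RHS]mulrCA [RHS]mulrA -MrecC; ring.
Qed.

End Jacobi.

Section Diagonal.
Variable R : realType.
Local Notation C := R[i].
Implicit Types f g : int -> C.
Variables (alpha xi : R).
Hypothesis halpha : 0 < alpha.
Hypothesis hxi : 0 < xi < 1.

Local Notation M := (phiR xi (nu alpha)).
Local Notation a := (offdiag alpha xi).
Let hv := nu_sqr alpha.
Let Msym := phiR_sym halpha hxi hv.
Let Morth := phiR_orth halpha hxi hv.
Let Mrec := phiR_rec halpha hxi hv.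
Local Opaque phiR.

Let xi1 : 1 - xi != 0 :> R. Proof. by case/andP: hxi => _ h; rewrite subr_eq0 gt_eqF. Qed.

(** Through the symmetry, the recurrence in x is read as one in m: x (1 - xi) times row m is a
    combination of the rows m - 1, m and m + 1. *)
Lemma row_moment m : ell2 (fun x : int => x%:~R * (M m x)%:C : C).
Proof.
have s1 := ell2Z (a m)%:C (row_ell2 Morth (m + 1)).
have s2 := ell2Z (a (m - 1))%:C (row_ell2 Morth (m - 1)).
have s3 := ell2Z (- (m%:~R * (1 + xi))%:C) (row_ell2 Morth m).
have := ell2Z ((1 - xi)^-1)%:C (ell2D (ell2D s1 s2) s3).
congr (ell2 _); apply/funext => x /=.
rewrite !(Msym _ x) -(rcZ R) -rcM; apply: (mulfI (x := (1 - xi)%:C)); first by rewrite rc_eq0.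
rewrite mulrA -rcM mulfV// mul1r -!rcM mulNr -!rcM -rcD -rcB Mrec.
by congr (_%:C); ring.
Qed.

Lemma row_summ m : csumm (fun x => (M m x)%:C : C).
Proof. exact: ell2_weight_summ (row_ell2 Morth m) (row_moment m). Qed.

Lemma ell2_coef m (k : int -> R) : (forall x, `|k x| ^+ 2 <= alpha + 2 * x%:~R ^+ 2) ->
  ell2 (fun x => (k x)%:C * (M m x)%:C : C).
Proof.
move=> hk; have /ell2P s1 := row_ell2 Morth m; have /ell2P s2 := row_moment m.
apply/ell2P; apply: le_summ (summD (summZ alpha s1) (summZ 2 s2)) => x.
have -> : cabs ((k x)%:C * (M m x)%:C : C) ^+ 2 = `|k x| ^+ 2 * cabs (M m x)%:C ^+ 2.
  by rewrite cabsM cabsr exprMn.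
have -> : cabs (x%:~R * (M m x)%:C : C) ^+ 2 = x%:~R ^+ 2 * cabs (M m x)%:C ^+ 2.
  by rewrite cabsM -(rcZ R) cabsr exprMn real_normK ?num_real.
have h := hk x; have n0 := sqr_ge0 (cabs (M m x)%:C).
have x2 : 0 <= (x%:~R : R) ^+ 2 by exact: sqr_ge0.
have k2 : 0 <= `|k x| ^+ 2 by exact: sqr_ge0.
move: (cabs _ ^+ 2) (`|k x| ^+ 2) (x%:~R ^+ 2 : R) h n0 x2 k2 => b c d h n0 x2 k2.
rewrite !ger0_norm ?mulr_ge0//; first by nra.
by rewrite addr_ge0 ?mulr_ge0// ltW.
Qed.

Lemma offdiag_sqr x : a x ^+ 2 = xi * gamma_step alpha x.
Proof.
case/andP: hxi => x0 _; have p := gamma_step_gt0 halpha hxi x.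
by rewrite sqr_sqrtr// mulr_ge0// ltW.
Qed.

Lemma offdiag_row m : ell2 (fun x => (a x)%:C * (M m x)%:C : C) /\
  ell2 (fun x => (a (x - 1))%:C * (M m x)%:C : C).
Proof.
have /andP[x0 x1] := hxi.
(* Used with d = x^2 and p = x (x + 1) or x (x - 1), both at most 2 x^2 on the integers. *)
have bound (d p : R) : 0 < alpha + p -> p <= 2 * d -> 0 <= d -> xi * (alpha + p) <= alpha + 2 * d.
  by move=> h1 h2 h3; nra.
split; apply: ell2_coef => x; rewrite real_normK ?num_real// offdiag_sqr.
  apply: bound; [exact: (gamma_step_gt0 halpha hxi x)| |exact: sqr_ge0].
  by rewrite -rmorphXn /= -[2]/(2%:~R) -intrM ler_int; nia.
apply: bound; [exact: (gamma_step_gt0 halpha hxi (x - 1))| |exact: sqr_ge0].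
by rewrite -rmorphXn /= -[2]/(2%:~R) -intrM ler_int; nia.
Qed.

Definition to_eigen : operator R := fun f => trans M (fun x => (gauge R x)%:C * f x).
Definition of_eigen : operator R := fun g x => (gauge R x)%:C * trans M g x.
Definition level (m : int) : R := m%:~R * (1 - xi).

Lemma gauge_ell2 f : ell2 f -> ell2 (fun x => (gauge R x)%:C * f x).
Proof.
apply: ell2_le => x; rewrite cabsM cabsr.
have -> : `|gauge R x| = 1; last by rewrite mul1r.
by apply/eqP; rewrite -sqrp_eq1// real_normK ?num_real// expr2 gauge_sqr.
Qed.

Lemma gaugeK (x : int) (z : C) : (gauge R x)%:C * ((gauge R x)%:C * z) = z.
Proof. by rewrite mulrA -rcM gauge_sqr mul1r. Qed.

Local Notation jac := (jac a (1 + xi)).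

(** The signs of the operator are ratios of gauges at neighbouring points, so conjugation by the
    gauge leaves a Jacobi operator with positive off-diagonal entries. *)
Lemma diff_op_jac f x :
  diff_op alpha xi f x = (gauge R x)%:C * jac (fun y => (gauge R y)%:C * f y) x.
Proof.
rewrite /diff_op /jac.
have -> : Num.sqrt (xi * (alpha + (x * (x + 1))%:~R)) = a x by [].
have -> : Num.sqrt (xi * (alpha + (x * (x - 1))%:~R)) = a (x - 1).
  by rewrite /offdiag /gamma_step; congr (Num.sqrt (_ * (_ + _%:~R))); ring.
have s1 : (-1) ^+ (x < 0)%R = gauge R x * gauge R (x + 1) :> R.
  by rewrite -(gauge_succ R x) -mulrA gauge_sqr mulr1.
have s2 : (-1) ^+ (x <= 0)%R = gauge R x * gauge R (x - 1) :> R.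
  by rewrite -(gauge_pred R x) -mulrA gauge_sqr mulr1.
rewrite s1 s2 !rcM -[in LHS](gaugeK x (f x)); ring.
Qed.

Lemma gauge_ip f g : ell2 f -> ell2 g ->
  ip (fun x => (gauge R x)%:C * f x) (fun x => (gauge R x)%:C * g x) = ip f g.
Proof.
move=> sf sg; rewrite /ip; congr csum; apply/funext => x.
by rewrite conjcM conjc_real mulrACA -rcM gauge_sqr mul1r.
Qed.

Let T_ell2 f : ell2 f -> ell2 (trans M f).
Proof. by move=> /(trans_ell2 Morth)[]. Qed.

Let TT f : ell2 f -> trans M (trans M f) = f.
Proof. exact: (transK Msym Morth row_summ). Qed.

Lemma to_eigen_ell2 f : ell2 f -> ell2 (to_eigen f).
Proof. by move=> sf; apply/T_ell2/gauge_ell2. Qed.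

Lemma of_eigen_ell2 f : ell2 f -> ell2 (of_eigen f).
Proof. by move=> sf; apply/gauge_ell2/T_ell2. Qed.

Lemma to_eigenD (b : C) f g : ell2 f -> ell2 g ->
  to_eigen (fun x => f x + b * g x) = fun x => to_eigen f x + b * to_eigen g x.
Proof.
move=> sf sg; rewrite /to_eigen -(transD Morth b (gauge_ell2 sf) (gauge_ell2 sg)).
by congr trans; apply/funext => x; ring.
Qed.

Lemma of_eigenD (b : C) f g : ell2 f -> ell2 g ->
  of_eigen (fun x => f x + b * g x) = fun x => of_eigen f x + b * of_eigen g x.
Proof. by move=> sf sg; rewrite /of_eigen (transD Morth)//; apply/funext => x; ring. Qed.

Lemma of_eigenK f : ell2 f -> to_eigen (of_eigen f) = f.
Proof.
move=> sf; rewrite /to_eigen -[RHS](TT sf); congr trans; apply/funext => x; exact: gaugeK.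
Qed.

Lemma to_eigenK f : ell2 f -> of_eigen (to_eigen f) = f.
Proof. by move=> sf; rewrite /of_eigen /to_eigen (TT (gauge_ell2 sf)); apply/funext => x; exact: gaugeK. Qed.

Lemma to_eigen_ip f g : ell2 f -> ell2 g -> ip (to_eigen f) (to_eigen g) = ip f g.
Proof.
move=> sf sg; rewrite /to_eigen (trans_isometry Msym Morth row_summ (gauge_ell2 sf) (gauge_ell2 sg)).
exact: gauge_ip.
Qed.

Lemma to_eigen_diff_op f : ell2 f /\ ell2 (diff_op alpha xi f) ->
  to_eigen (diff_op alpha xi f) = fun m => (level m)%:C * to_eigen f m.
Proof.
move=> [sf sD]; apply/funext => m.
rewrite -(trans_jac Morth row_moment (fun m => (offdiag_row m).1) (fun m => (offdiag_row m).2) Mrec)//.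
  by congr (trans _ _ m); apply/funext => x; rewrite diff_op_jac gaugeK.
exact: gauge_ell2.
Qed.

Lemma diff_op_of_eigen f : ell2 f -> ell2 (fun m => (level m)%:C * to_eigen f m) ->
  diff_op alpha xi f = of_eigen (fun m => (level m)%:C * to_eigen f m).
Proof.
move=> sf sl; apply/funext => x; rewrite diff_op_jac /of_eigen -[in LHS](TT (gauge_ell2 sf)) -/(to_eigen f).
by rewrite (jac_trans Msym Morth Mrec (to_eigen_ell2 sf)).
Qed.

Lemma diff_op_lin (b : C) f g : diff_op alpha xi (fun x => f x + b * g x) =
  fun x => diff_op alpha xi f x + b * diff_op alpha xi g x.
Proof. by apply/funext => x; rewrite /diff_op; ring. Qed.

Lemma ProjE A f : measurable A -> ell2 f -> Proj alpha xi A f = Esp level to_eigen of_eigen A f.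
Proof.
exact: (spectral_projectionE to_eigen_ell2 of_eigen_ell2 to_eigenD of_eigenD of_eigenK to_eigenK to_eigen_ip to_eigen_diff_op diff_op_of_eigen diff_op_lin).
Qed.

(** As 1 - xi > 0, [level m] has the sign of m: the weight is 1, 1/2 or 0 for m positive, zero or
    negative, which extends the factor of the kernel series by zero to all integers. *)
Definition proj_weight (m : int) : C :=
  (\1_[set t : R | 0 < t] (level m) : R)%:C + 2^-1 * (\1_[set (0 : R)] (level m) : R)%:C.

Lemma proj_weight_Posz (n : nat) : proj_weight n%:Z = 2 ^- (n == 0%N).
Proof.
have xi2 : 0 < 1 - xi by case/andP: hxi => _; rewrite subr_gt0.
rewrite /proj_weight !indicE /level; case: n => [|n] /=.
  rewrite mul0r memNset /= ?ltxx// mem_set// add0r expr1 mulr1 //.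
rewrite mem_set /=; last by rewrite mulr_gt0.
by rewrite memNset /= ?mulr0 ?addr0 ?expr0 ?invr1//; apply/eqP; rewrite gt_eqF ?mulr_gt0.
Qed.

Lemma proj_weight_Negz (n : nat) : proj_weight (Negz n) = 0.
Proof.
have xi2 : 0 < 1 - xi by case/andP: hxi => _; rewrite subr_gt0.
have h : level (Negz n) < 0 by rewrite /level pmulr_llt0// ltrz0.
rewrite /proj_weight !indicE memNset /=; last by rewrite ltNge (ltW h).
by rewrite memNset /= ?mulr0 ?addr0//; apply/eqP; rewrite lt_eqF.
Qed.

Lemma cabs_proj_weight m : cabs (proj_weight m) <= 1.
Proof.
case: m => n; last by rewrite proj_weight_Negz cabs0.
rewrite proj_weight_Posz cabsV cabsX (_ : cabs (2 : C) = 2); last first.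
  by rewrite cabs_nat.
by case: (n == 0%N); [rewrite expr1 invf_le1 ?ler1n|rewrite expr0 invr1].
Qed.

Lemma kernelE x y : csumm (fun m => (M x m)%:C * proj_weight m * (M m (- y))%:C) ->
  pfaffian_kernel alpha xi x y =
  (gauge R x)%:C * csum (fun m => (M x m)%:C * proj_weight m * (M m (- y))%:C) * (gauge R (- y))%:C.
Proof.
move=> s; rewrite /pfaffian_kernel gauge_minmax rcM -!mulrA; congr (_ * _); rewrite [LHS]mulrC; congr (_ * _).
have e : (fun n : nat => 2 ^- (n == 0%N) * phi alpha xi n%:Z x * phi alpha xi n%:Z (- y)) =
   fun n : nat => (M x n%:Z)%:C * proj_weight n%:Z * (M n%:Z (- y))%:C.
  apply/funext => n; rewrite !phi_phiv -!(phiRE halpha hxi hv) proj_weight_Posz (Msym x).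
  by rewrite [_ * (M _ x)%:C]mulrC.
have pinj : injective Posz by move=> i j [].
rewrite e seriesC_csum; last exact: (csumm_inj pinj s).
rewrite (csum_inj (f := fun m => (M x m)%:C * proj_weight m * (M m (- y))%:C) pinj) //.
by case=> n h; [case: h; exists n|rewrite proj_weight_Negz mulr0 mul0r].
Qed.

(** In coordinates the operator is a product gauge, M, weight, M, gauge, reflection. Exchanging the
    two sums coming from M exhibits its matrix, and the substitution y = - z absorbs the
    reflection. *)
Lemma proj_sum_matrix : has_matrix
    (fun f x => Proj alpha xi [set t | 0 < t] (@reflection R f) x +
                2^-1 * Proj alpha xi [set 0] (@reflection R f) x)
    (pfaffian_kernel alpha xi).
Proof.
move=> f sf; set g := reflection f.
have oppb : bijective (fun x : int => - x) by exists (fun x => - x) => x; rewrite opprK.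
have sg : ell2 g by apply/(ell2_reindex f oppb).
have m1 : measurable [set t : R | 0 < t].
  by rewrite (_ : [set t | _] = `]0, +oo[%classic)//; apply/seteqP; split => t /=; rewrite in_itv /= andbT.
have m2 : measurable [set (0 : R)] by exact: measurable_set1.
have sW := to_eigen_ell2 sg.
have TE : (fun x => Proj alpha xi [set t | 0 < t] g x + 2^-1 * Proj alpha xi [set 0] g x) =
    of_eigen (fun m => proj_weight m * to_eigen g m).
  rewrite !ProjE// /Esp -of_eigenD; [|exact: cut_ell2|exact: cut_ell2].
  by congr of_eigen; apply/funext => m; rewrite /cut /proj_weight; ring.
have swW : ell2 (fun m => proj_weight m * to_eigen g m).
  by apply: ell2_le sW => m; rewrite cabsM ler_piMl ?cabs_ge0// cabs_proj_weight.
rewrite -[X in ell2 X]/(fun x => Proj alpha xi [set t | 0 < t] g x + 2^-1 * Proj alpha xi [set 0] g x).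
rewrite TE; split => [|x]; first exact: of_eigen_ell2.
rewrite -[X in is_sumZ _ X]/((fun x => Proj alpha xi [set t | 0 < t] g x + 2^-1 * Proj alpha xi [set 0] g x) x).
rewrite TE; pose F (z : int) : C := (gauge R z)%:C * g z.
have sF : ell2 F by exact: gauge_ell2.
pose K (m z : int) : C := (M x m)%:C * proj_weight m * ((M m z)%:C * F z).
have fub : csumm (fun k : int * int => K k.1 k.2).
  exact: (trans_fubini Morth row_summ (w := proj_weight) x cabs_proj_weight sF).
have [_ scK _] := csum_pair (a := fun z m => K m z) (csumm_pairT fub).
have e1 : of_eigen (fun m => proj_weight m * to_eigen g m) x = csum (fun z => (gauge R x)%:C * csum (K^~ z)).
  rewrite (csumZ _ scK).
  rewrite /of_eigen /trans; congr (_ * _); rewrite -(csum_exchange (a := K) fub); congr csum; apply/funext => m.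
  rewrite /to_eigen /trans mulrA -csumZ//; exact: trans_summ Morth _ _ sF.
(* The summability in [fub] carries the factor F z, which may vanish; that of the bare kernel series
   is obtained from two rows in l2. *)
have sK z : csumm (fun m => (M x m)%:C * proj_weight m * (M m z)%:C).
  have sMw : ell2 (fun m => (M x m)%:C * proj_weight m).
    apply: ell2_le (row_ell2 Morth x) => m.
    by rewrite cabsM ler_piMr ?cabs_ge0// cabs_proj_weight.
  have -> : (fun m => (M x m)%:C * proj_weight m * (M m z)%:C) =
      fun m => (M x m)%:C * proj_weight m * (M z m)%:C.
    by apply/funext => m; rewrite (Msym m z).
  exact: ell2_summ sMw (row_ell2 Morth z).
have e2 : (fun y => (gauge R x)%:C * csum (K^~ (- y))) = fun y => pfaffian_kernel alpha xi x y * f y.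
  apply/funext => y; rewrite kernelE// -!mulrA; congr (_ * _).
  have -> : K^~ (- y) = fun m => F (- y) * ((M x m)%:C * proj_weight m * (M m (- y))%:C).
    by apply/funext => m; rewrite /K [LHS]mulrA [LHS]mulrC.
  by rewrite csumZ// /F /g /reflection opprK mulrC mulrA.
have s3 : csumm (fun y => pfaffian_kernel alpha xi x y * f y).
  rewrite -e2; apply/(csumm_reindex (fun z => (gauge R x)%:C * csum (K^~ z)) oppb).
  exact: csummZ.
have re := csum_reindex (fun z => (gauge R x)%:C * csum (K^~ z)) oppb.
have <- : csum (fun y => pfaffian_kernel alpha xi x y * f y) = of_eigen (fun m => proj_weight m * to_eigen g m) x.
  by rewrite -e2 e1; exact: re.
exact: csum_sumZ s3.
Qed.

End Diagonal.

Theorem proposition7p5 (R : realType) (alpha xi : R)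
    (halpha : 0 < alpha) (hxi : 0 < xi < 1) :
  has_matrix
    (fun f x => Proj alpha xi [set t | 0 < t] (@reflection R f) x +
                2^-1 * Proj alpha xi [set 0] (@reflection R f) x)
    (pfaffian_kernel alpha xi).
Proof. exact: proj_sum_matrix. Qed.
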